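(* Let $(M,g,J)$ be an almost Hermitian manifold of real dimension four, oriented by $J$, let $t>0$, and let $\Sigma_J$ be the hypersurface of the twistor space $({\cal Z}_+,h_t)$ consisting of the complex structures anti-commuting with $J$. If $(M,g,J)$ is K\''ahler, then $\Sigma_J$ is a totally geodesic submanifold of $({\cal Z}_+,h_t)$.
   Context: $(M,g,J)$ is an almost Hermitian four-manifold with the orientation induced by $J$. The metric on $\Lambda^2TM$ is $g(v_1\wedge v_2,v_3\wedge v_4)=\frac12\det[g(v_i,v_j)]$, i.e. $\frac12\left(g(v_1,v_3)g(v_2,v_4)-g(v_1,v_4)g(v_2,v_3)\right)$. $\Lambda^2_+TM$ is the $(+1)$-eigenbundle of the Hodge star on $\Lambda^2TM$, and $\nabla$ denotes the Levi-Civita connection of $g$ and the connections it induces on $\Lambda^2TM$ and $\Lambda^2_+TM$. For $a\in\Lambda^2T_pM$ the skew-symmetric endomorphism $K_a$ of $T_pM$ is defined by $g(K_aX,Y)=2g(a,X\wedge Y)$. The twistor space ${\cal Z}_+$ is the unit sphere bundle $\pi:{\cal Z}_+\to M$ of $\Lambda^2_+TM$; via $\sigma\mapsto K_\sigma$ its points are the complex structures on the tangent spaces of $M$ compatible with the metric and the orientation. The tangent bundle splits as $T{\cal Z}_+={\cal H}\oplus{\cal V}$, where ${\cal V}$ is tangent to the fibres (${\cal V}_\tau$ is identified with the orthogonal complement of ${\mathbb R}\tau$ in $\Lambda^2_+T_{\pi(\tau)}M$) and ${\cal H}$ is the horizontal distribution of $\nabla$; $X^h_\tau$ denotes the horizontal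 lift of $X\in T_{\pi(\tau)}M$. For $t>0$ the Riemannian metric $h_t$ on ${\cal Z}_+$ is $$h_t(X^h_\sigma+V,Y^h_\sigma+W)=g(X,Y)+t\,g(V,W),\quad X,Y\in T_{\pi(\sigma)}M,\ V,W\in{\cal V}_\sigma.$$ Let $\alpha$ be the section of ${\cal Z}_+$ defined by $g(\alpha,X\wedge Y)=\frac12 g(JX,Y)$ (so $K_\alpha=J$). Then $\Sigma_J=\{\sigma\in{\cal Z}_+: g(\sigma,\alpha_{\pi(\sigma)})=0\}$; equivalently, the points $\sigma$ of ${\cal Z}_+$ for which $K_\sigma$ anti-commutes with $J$. *)

(* Defs.v *)
From HB Require Import structures.
From mathcomp Require Import all_boot all_order all_algebra.
From mathcomp Require Import all_classical all_reals all_analysis.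
From mathcomp Require Import ring.
Set Implicit Arguments.
Unset Strict Implicit.
Unset Printing Implicit Defensive.
Import Order.TTheory GRing.Theory Num.Theory.
Import numFieldNormedType.Exports.
Local Open Scope classical_set_scope.
Local Open Scope ring_scope.

(* C^k and C^infinity maps on an open subset U of a finite-dimensional normed
   space; iterated directional derivatives are required to exist and to be
   (Frechet) differentiable. *)
Fixpoint Ck {R : realType} {V W : normedModType R} (k : nat) (U : set V)
    (f : V -> W) : Prop :=
  match k with
  | 0 => forall x, U x -> {for x, continuous f}
  | k'.+1 => (forall x, U x -> differentiable f x) /\
             forall v : V, Ck k' U (fun x => 'D_v f x)
  end.

Definition smooth_on {R : realType} {V W : normedModType R} (U : set V)
  (f : V -> W) : Prop := forall k, Ck k U f.

(* A set with charts modelled on V.  The atlas is indexed by the points: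
   [cmap x] is a preferred chart around x, with domain [cdom x] and inverse
   [cinv x].  No generality is lost: choose a chart around each point.
   The tangent space at x is V, a tangent vector being represented by its
   components in the preferred chart at x. *)
Record charted (R : realType) (V : normedModType R) := Charted {
  point :> Type;
  cdom : point -> set point;
  cmap : point -> point -> V;
  cinv : point -> V -> point }.

Section Manifold.
Context {R : realType} {V : normedModType R} (X : charted V).
Implicit Types (x y : X) (S N : set X) (f : X -> R) (xi eta : X -> V).

(* The topology induced by the atlas. *)
Definition copen (A : set X) : Prop :=
  forall x, open (cmap x @` (A `&` cdom x)).

Definition is_manifold : Prop :=
  [/\ forall x, cdom x x,
      forall x y, cdom x y -> cinv x (cmap x y) = y,
      forall x y, open (cmap x @` (cdom x `&` cdom y)) &
      forall x y,
        smooth_on (cmap x @` (cdom x `&` cdom y)) (cmap y \o cinv x)] /\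
  (forall x y, x <> y -> exists A B : set X,
     [/\ copen A, copen B, A x, B y & A `&` B = set0]) /\
  (exists B : nat -> set X, (forall k, copen (B k)) /\
     forall (A : set X) x, copen A -> A x -> exists2 k, B k x & B k `<=` A).

(* Components in the chart at y of the tangent vector v at x. *)
Definition tchange x y (v : V) : V := 'D_v (cmap y \o cinv x) (cmap x x).

(* Maps, curves and vector fields on a subset S of X: a map on S is smooth if
   it extends locally to a smooth map, and the tangent vectors of S are the
   velocities of the smooth curves contained in S.  For S a submanifold these
   are the usual notions; S = setT is the case of X itself. *)
Definition smooth_at {W : normedModType R} S x (F : X -> W) : Prop :=
  exists (O : set V) (G : V -> W),
    [/\ open O, O (cmap x x), smooth_on O G &
        forall y, S y -> cdom x y -> O (cmap x y) -> F y = G (cmap x y)].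

Definition smooth_along {W : normedModType R} S (F : X -> W) : Prop :=
  forall x, S x -> smooth_at S x F.

Definition curve S x (v : V) (c : R -> X) : Prop :=
  exists2 e : R, 0 < e &
    [/\ c 0 = x,
        forall s, `|s| < e -> S (c s) /\ cdom x (c s),
        smooth_on [set s : R^o | `|s| < e] (cmap x \o c : R^o -> V) &
        derive1 (cmap x \o c) 0 = v].

Definition tangent S x (v : V) : Prop := exists c, curve S x v c.

Definition vfield S xi : Prop := forall x, S x ->
  tangent S x (xi x) /\ smooth_at S x (fun y => tchange y x (xi y)).

(* v(f): the derivative at x of a function f, smooth along S, in the direction
   of v, a tangent vector of S; it does not depend on the curve. *)
Definition dv S f x (v : V) : R :=
  get [set d : R | exists2 c, curve S x v c & d = derive1 (f \o c) 0].

(* D x v xi is the covariant derivative of xi at x in the direction of v.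
   The torsion-free identity D_xi eta - D_eta xi = [xi, eta] is expressed by
   the action of both sides on the functions f defined near x. *)
Definition levi_civita S (h : X -> V -> V -> R)
    (D : X -> V -> (X -> V) -> V) : Prop :=
  [/\ forall xi eta, vfield S xi -> vfield S eta ->
        vfield S (fun x => D x (xi x) eta),
      forall x v w (a : R) eta, S x -> tangent S x v -> tangent S x w ->
        vfield S eta -> D x (a *: v + w) eta = a *: D x v eta + D x w eta,
      forall x v xi eta, S x -> tangent S x v -> vfield S xi ->
        vfield S eta -> D x v (fun y => xi y + eta y) = D x v xi + D x v eta &
      forall x v f eta, S x -> tangent S x v -> vfield S eta ->
        smooth_along S (f : X -> R^o) ->
        D x v (fun y => f y *: eta y) = dv S f x v *: eta x + f x *: D x v eta]
  /\
  [/\ forall x f xi eta, S x -> vfield S xi -> vfield S eta ->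
        smooth_along (S `&` cdom x) (f : X -> R^o) ->
        dv S f x (D x (xi x) eta) - dv S f x (D x (eta x) xi) =
        dv S (fun y => dv S f y (eta y)) x (xi x) -
        dv S (fun y => dv S f y (xi y)) x (eta x) &
      forall x v xi eta, S x -> tangent S x v -> vfield S xi ->
        vfield S eta ->
        dv S (fun y => h y (xi y) (eta y)) x v =
        h x (D x v xi) (eta x) + h x (xi x) (D x v eta)].

(* N is an (embedded) hypersurface of S: locally the zero set of a smooth
   function with non-zero differential. *)
Definition hypersurface S N : Prop :=
  N `<=` S /\ forall x, N x -> exists (O : set V) (u : X -> R),
    [/\ open O, O (cmap x x), smooth_along (S `&` cdom x) (u : X -> R^o),
        forall y, S y -> cdom x y -> O (cmap x y) -> (N y <-> u y = 0) &
        exists2 v, tangent S x v & dv S u x v <> 0].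

(* The second fundamental form of N in (S, h), i.e. the component of D_xi eta
   normal to N for xi, eta tangent to N, vanishes. *)
Definition totally_geodesic S (h : X -> V -> V -> R) N : Prop :=
  forall D, levi_civita S h D ->
  forall xi eta, vfield S xi -> vfield S eta ->
  (forall x, N x -> tangent N x (xi x)) ->
  (forall x, N x -> tangent N x (eta x)) ->
  forall x, N x -> tangent N x (D x (xi x) eta).

End Manifold.

(* Multilinear algebra on R^4: G is the Gram matrix of the metric and a
   bivector a is encoded by its skew-symmetric component matrix, a = sum_(i < j)
   a_ij e_i /\ e_j. *)
Section Algebra.
Context {R : realType}.
Implicit Types (G J A B : 'M[R]_4) (v w : 'cV[R]_4).

Definition gdot G v w : R := (v^T *m G *m w) 0 0.

Definition wedge v w : 'M[R]_4 := v *m w^T - w *m v^T.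

(* The factor 1/4 is fixed by [bivec_metric_wedge] below. *)
Definition bivec_metric G A B : R := 4^-1 * \tr (A^T *m G *m B *m G).

Definition eps (i j k l : 'I_4) : R :=
  \det (\matrix_(a < 4, b < 4) (tnth [tuple i; j; k; l] a == b)%:R : 'M[R]_4).

Definition complex_frame J v w : 'M[R]_4 :=
  \matrix_(i < 4, a < 4) tnth [tuple v; J *m v; w; J *m w] a i 0.

(* 1 if the standard basis of R^4 is positive for the orientation induced by J,
   in which the bases (v, Jv, w, Jw) are positive; -1 otherwise. *)
Definition orient J : R :=
  if `[< exists v w, 0 < \det (complex_frame J v w) >] then 1 else -1.

(* Hodge star for G and the orientation induced by J:
   ( *a)^ij = 1/2 (+/- det G ^ -1/2) eps_ijkl a_kl, a_kl = G_km a^mn G_nl. *)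
Definition hodge G J A : 'M[R]_4 :=
  (orient J / (2 * Num.sqrt (\det G))) *:
  \matrix_(i < 4, j < 4) \sum_(k < 4) \sum_(l < 4)
    eps i j k l * (G *m A *m G) k l.

(* The bivector dual to J; see [bivec_metric_alpha]. *)
Definition alpha_of G J : 'M[R]_4 := - (J *m invmx G).

Lemma gdotC G v w : G^T = G -> gdot G v w = gdot G w v.
Proof.
move=> GT; rewrite /gdot; have -> : v^T *m G *m w = (w^T *m G *m v)^T.
  by rewrite !trmx_mul trmxK GT mulmxA.
by rewrite mxE.
Qed.

Lemma mxtrace_outer (v w : 'cV[R]_4) : \tr (v *m w^T) = (w^T *m v) 0 0.
Proof. by rewrite mxtrace_mulC /mxtrace big_ord1. Qed.

Lemma bivec_metric_wedger G A v w : G^T = G -> A^T = - A ->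
  bivec_metric G A (wedge v w) = 2^-1 * gdot G v (A *m G *m w).
Proof.
move=> GT AT; rewrite /bivec_metric /wedge AT mulmxBr mulmxBl raddfB /=.
have tr u u' : \tr (- A *m G *m (u *m u'^T) *m G) = - gdot G u' (A *m G *m u).
  rewrite mxtrace_mulC !mulmxA mxtrace_outer /gdot.
  by rewrite !(mulNmx, mulmxN) mxE !mulmxA.
rewrite !tr opprK.
have -> : gdot G w (A *m G *m v) = - gdot G v (A *m G *m w).
  rewrite /gdot; have -> : w^T *m G *m (A *m G *m v) =
    - (v^T *m G *m (A *m G *m w))^T.
    by rewrite !trmx_mul trmxK GT AT !mulmxN !mulNmx opprK !mulmxA.
  by rewrite !mxE.
by field.
Qed.

Lemma bivec_metric_wedge G v1 v2 v3 v4 : G^T = G ->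
  bivec_metric G (wedge v1 v2) (wedge v3 v4) =
  2^-1 * (gdot G v1 v3 * gdot G v2 v4 - gdot G v1 v4 * gdot G v2 v3).
Proof.
move=> GT; rewrite bivec_metric_wedger//; last first.
  by rewrite /wedge raddfB /= !trmx_mul !trmxK opprB.
congr (_ * _); rewrite (gdotC v1 v3)// (gdotC v2 v3)// /gdot /wedge.
rewrite !mulmxBl mulmxBr.
have mB (a b : 'M[R]_1) : (a - b) 0 0 = a 0 0 - b 0 0 by rewrite !mxE.
rewrite mB -!mulmxA.
have E (u u' : 'cV[R]_4) : (v3^T *m (G *m (u *m (u'^T *m (G *m v4))))) 0 0 =
    (v3^T *m (G *m u)) 0 0 * (u'^T *m (G *m v4)) 0 0.
  have m11 (a b : 'M[R]_1) : (a *m b) 0 0 = a 0 0 * b 0 0.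
    by rewrite mxE big_ord1.
  by rewrite -m11 !mulmxA.
by rewrite !E; congr (_ - _); rewrite mulrC.
Qed.

Lemma bivec_metric_alpha G J v w : G^T = G -> G \in unitmx ->
  J *m J = - 1%:M -> J^T *m G *m J = G ->
  bivec_metric G (alpha_of G J) (wedge v w) = 2^-1 * gdot G (J *m v) w.
Proof.
move=> GT Gu JJ JG.
have GJ : J^T *m G = - (G *m J).
  by rewrite -[in RHS]JG -!mulmxA JJ !mulmxN mulmx1 opprK.
rewrite bivec_metric_wedger//; last first.
  rewrite /alpha_of raddfN /= trmx_mul trmx_inv GT opprK.
  rewrite -[J^T](mulmxK Gu) GJ mulNmx !mulmxN !mulmxA mulVmx// mul1mx.
  by rewrite opprK.
rewrite /alpha_of mulNmx mulmxKV// /gdot trmx_mul.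
by rewrite -[in RHS](mulmxA v^T) GJ !(mulNmx, mulmxN) !mulmxA.
Qed.

End Algebra.

Section AlmostHermitian.
Context {R : realType} (M : charted 'cV[R]_4).
Implicit Types (p q : M) (v : 'cV[R]_4).

Definition jac (F : 'cV[R]_4 -> 'cV[R]_4) (z : 'cV[R]_4) : 'M[R]_4 :=
  \matrix_(i, j) ('D_(delta_mx j 0) F z) i 0.

(* The total space of the bundle TM (x) TM, whose skew-symmetric part is
   Lambda^2 TM (v /\ w = v (x) w - w (x) v): a point (q, A) consists of q and
   of the components A of the tensor in the preferred chart at q. *)
Definition tensor2 : charted ('cV[R]_4 * 'M[R]_4)%type :=
  @Charted R ('cV[R]_4 * 'M[R]_4)%type (M * 'M[R]_4)%type
    (fun e e' => cdom e.1 e'.1)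
    (fun e e' => let T := jac (cmap e.1 \o cinv e'.1) (cmap e'.1 e'.1) in
       (cmap e.1 e'.1, T *m e'.2 *m T^T))
    (fun e z => let q := cinv e.1 z.1 in
       let T := jac (cmap q \o cinv e.1) z.1 in (q, T *m z.2 *m T^T)).

Variables g J : M -> 'M[R]_4.

(* Components of g and J in the chart at p, as functions on the image of that
   chart; g q and J q are the components at q in the preferred chart at q. *)
Definition gloc p (z : 'cV[R]_4) : 'M[R]_4 :=
  let q := cinv p z in let T := jac (cmap q \o cinv p) z in T^T *m g q *m T.

Definition Jloc p (z : 'cV[R]_4) : 'M[R]_4 :=
  let q := cinv p z in let T := jac (cmap q \o cinv p) z in
  invmx T *m J q *m T.

Definition almost_hermitian : Prop :=
  [/\ forall p, (g p)^T = g p,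
      forall p v, v != 0 -> 0 < gdot (g p) v v &
      forall p, smooth_on (cmap p @` cdom p) (gloc p)] /\
  [/\ forall p, J p *m J p = - 1%:M,
      forall p v w, gdot (g p) (J p *m v) (J p *m w) = gdot (g p) v w &
      forall p, smooth_on (cmap p @` cdom p) (Jloc p)].

(* Partial derivative, at p and in the chart at p, of a matrix-valued map. *)
Definition partial p (F : 'cV[R]_4 -> 'M[R]_4) (i : 'I_4) : 'M[R]_4 :=
  'D_(delta_mx i 0 : 'cV[R]_4) F (cmap p p).

(* Kaehler form Omega(X, Y) = g(JX, Y). *)
Definition kahler_form p (z : 'cV[R]_4) : 'M[R]_4 := (Jloc p z)^T *m gloc p z.

Definition kahler_form_closed : Prop := forall p (i j k : 'I_4),
  partial p (kahler_form p) i j k + partial p (kahler_form p) j k i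
  + partial p (kahler_form p) k i j = 0.

(* N(X, Y) = [JX, JY] - J[JX, Y] - J[X, JY] - [X, Y] on coordinate fields. *)
Definition nijenhuis p (i j k : 'I_4) : R :=
  \sum_(l < 4) (J p l i * partial p (Jloc p) l k j
              - J p l j * partial p (Jloc p) l k i
              - J p k l * (partial p (Jloc p) i l j
                         - partial p (Jloc p) j l i)).

Definition kahler : Prop :=
  (forall p i j k, nijenhuis p i j k = 0) /\ kahler_form_closed.

(* Christoffel symbol Gamma^k_ij at p of the Levi-Civita connection of g. *)
Definition christoffel p (k i j : 'I_4) : R :=
  2^-1 * \sum_(l < 4) invmx (g p) k l *
    (partial p (gloc p) i j l + partial p (gloc p) j i l
     - partial p (gloc p) l i j).

Definition conn_mx p v : 'M[R]_4 :=
  \matrix_(k, j) \sum_(i < 4) christoffel p k i j * v i 0.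

(* Horizontal lift of v at e: the velocity of the curves s |-> (p(s), A(s))
   through e with p'(0) = v and covariant derivative A' + Gamma(v) A +
   A Gamma(v)^T equal to zero. *)
Definition hlift (e : tensor2) v : 'cV[R]_4 * 'M[R]_4 :=
  (v, - (conn_mx e.1 v *m e.2 + e.2 *m (conn_mx e.1 v)^T)).

Definition vert (e : tensor2) (u : 'cV[R]_4 * 'M[R]_4) : 'M[R]_4 :=
  (u - hlift e u.1).2.

(* Z_+, the unit sphere bundle of Lambda^2_+ TM, as a subset of TM (x) TM. *)
Definition twistor : set tensor2 :=
  [set e | [/\ e.2^T = - e.2, hodge (g e.1) (J e.1) e.2 = e.2 &
               bivec_metric (g e.1) e.2 e.2 = 1]].

(* h_t(X^h + V, Y^h + W) = g(X, Y) + t g(V, W). *)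
Definition h_metric (t : R) (e : tensor2) (u w : 'cV[R]_4 * 'M[R]_4) : R :=
  gdot (g e.1) u.1 w.1 + t * bivec_metric (g e.1) (vert e u) (vert e w).

Definition Sigma_J : set tensor2 :=
  [set e | twistor e /\
           bivec_metric (g e.1) e.2 (alpha_of (g e.1) (J e.1)) = 0].

End AlmostHermitian.

(* Main.v *)
(* Let u(sigma) = g(sigma, alpha) be the height function on the twistor space,
   so that Sigma_J = {u = 0}.  In the Kaehler case J, hence alpha, is parallel;
   therefore du vanishes on horizontal vectors and the vertical field
   W(sigma) = alpha - u(sigma) sigma is t times the h_t-gradient of u.  Koszul's
   formula for vector fields xi, eta tangent to Sigma_J reduces, on Sigma_J, to
   2 h_t(D_xi eta, W) = - (L_W h_t)(xi, eta), because h_t(xi, W), h_t(eta, W)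
   and du([xi, eta]) vanish there.  As alpha is parallel,
   (L_W h_t)(xi, eta) = - 2 t u g(V xi, V eta) with V the vertical part, which
   is zero on Sigma_J.  Hence D_xi eta is tangent to {u = 0}. *)
Require Import Defs.
From HB Require Import structures.
From mathcomp Require Import all_boot all_order all_algebra.
From mathcomp Require Import all_classical all_reals all_analysis.
From mathcomp Require Import ring lra.
Set Implicit Arguments.
Unset Strict Implicit.
Unset Printing Implicit Defensive.
Import Order.TTheory GRing.Theory Num.Theory.
Import numFieldNormedType.Exports.
Local Open Scope classical_set_scope.
Local Open Scope ring_scope.

(** * Calculus of smooth maps *)

Section Differential.
Context {R : realType}.
Implicit Types U V W : normedModType R.

Lemma near_eq_diff V W (f g : V -> W) (x : V) :
  (\forall y \near x, f y = g y) -> differentiable f x -> differentiable g x.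
Proof.
move=> fg dF; have fgx : f x = g x by apply: nbhs_singleton fg.
suff H : g \o shift x = cst (g x) + 'd f x +o_ 0 id.
  have cd := (proj1 ((diff_locallyP _ _).1 dF)).
  by apply/diff_locallyP; rewrite (diff_unique cd H).
apply/eqaddoP => e e0.
have /diff_locallyP [_ /eqaddoP /(_ e e0)] := dF.
have nfg := fg; rewrite (near_shift 0 x) /= subr0 in nfg.
apply: filterS2 nfg.
by move=> h /= fgh; rewrite !fctE /= fgx fgh.
Qed.

Lemma deriveZv V W (f : V -> W) x (a : R) v : differentiable f x ->
  'D_(a *: v) f x = a *: 'D_v f x.
Proof. by move=> df; rewrite !deriveE// linearZ. Qed.

Lemma derive_sumv V W (f : V -> W) x (I : Type) (r : seq I) (v : I -> V) :
  differentiable f x ->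
  'D_(\sum_(i <- r) v i) f x = \sum_(i <- r) 'D_(v i) f x.
Proof.
move=> df; rewrite deriveE// linear_sum.
by apply: eq_bigr => i _; rewrite deriveE.
Qed.

Lemma derive_comp V W U (f : V -> W) (g : W -> U) x v :
  differentiable f x -> differentiable g (f x) ->
  'D_v (g \o f) x = 'D_('D_v f x) g (f x).
Proof.
move=> df dg; rewrite deriveE; last exact: differentiable_comp.
by rewrite diff_comp //= (deriveE v df) (deriveE _ dg).
Qed.

Lemma derive_lin V W (L : {linear V -> W}) x v :
  continuous L -> 'D_v L x = L v.
Proof.
by move=> cL; rewrite deriveE ?diff_lin//; apply: linear_differentiable.
Qed.

Lemma differentiable_lincomp V W U (f : V -> W) (L : {linear W -> U}) x :
  continuous L -> differentiable f x -> differentiable (L \o f) x.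
Proof.
by move=> cL df; apply: differentiable_comp => //; apply: linear_differentiable.
Qed.

Lemma derive_lincomp V W U (f : V -> W) (L : {linear W -> U}) x v :
  continuous L -> differentiable f x -> 'D_v (L \o f) x = L ('D_v f x).
Proof.
move=> cL df; rewrite derive_comp ?derive_lin//.
exact: linear_differentiable.
Qed.

End Differential.

Section Smooth.
Context {R : realType}.
Implicit Types V W : normedModType R.

Lemma Ck_eq V W k (U : set V) (f g : V -> W) : open U ->
  (forall x, U x -> f x = g x) -> Ck k U f -> Ck k U g.
Proof.
move=> oU; elim: k f g => [|k IH] f g fg /=.
  move=> cf x Ux; move: (cf x Ux); rewrite /continuous_at /prop_for /= -(fg _ Ux).
  apply: cvg_trans; apply: near_eq_cvg.
  by near=> y; apply/fg; near: y; exact: open_nbhs_nbhs.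
have nfg x : U x -> \forall y \near x, f y = g y.
  by move=> Ux; near=> y; apply/fg; near: y; exact: open_nbhs_nbhs.
move=> [df cf]; split=> [x Ux|v].
  by apply: near_eq_diff (df x Ux); apply: nfg.
by apply: IH (cf v) => x Ux; apply: near_eq_derive; apply: nfg.
Unshelve. all: by end_near. Qed.

Lemma Ck_pred V W k (U : set V) (f : V -> W) : Ck k.+1 U f -> Ck k U f.
Proof.
elim: k f => [|k IH] f [df cf]; last by split=> // v; apply: IH.
by move=> x Ux; apply: differentiable_continuous; apply: df.
Qed.

Lemma Ck_subset V W k (U U' : set V) (f : V -> W) :
  U' `<=` U -> Ck k U f -> Ck k U' f.
Proof.
move=> sU; elim: k f => [|k IH] f /=; first by move=> cf x /sU; apply: cf.
by move=> [df cf]; split=> [x /sU|v]; [apply: df|apply: IH].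
Qed.

Lemma Ck_cst V W k (U : set V) (a : W) : Ck k U (fun _ : V => a).
Proof.
elim: k a => [|k IH] a /=; first by move=> x _; exact: cst_continuous.
split=> [x _|v]; first exact: differentiable_cst.
by rewrite (_ : 'D_v _ = fun=> 0)//; apply/funext => x; rewrite derive_cst.
Qed.

Lemma Ck_lin V W k (U : set V) (L : {linear V -> W}) :
  continuous L -> Ck k U L.
Proof.
move=> cL; case: k => [|k] /=; first by move=> x _; apply: cL.
split=> [x _|v]; first exact: linear_differentiable.
rewrite (_ : 'D_v _ = fun=> L v); first exact: Ck_cst.
by apply/funext => x; rewrite derive_lin.
Qed.

Lemma CkD V W k (U : set V) (f g : V -> W) : open U ->
  Ck k U f -> Ck k U g -> Ck k U (fun x => f x + g x).
Proof.
move=> oU; elim: k f g => [|k IH] f g /=.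
  by move=> cf cg x Ux; apply: continuousD; [apply: cf|apply: cg].
move=> [df cf] [dg cg]; split=> [x Ux|v].
  by apply: differentiableD; [apply: df|apply: dg].
apply: (@Ck_eq _ _ _ _ (fun x => 'D_v f x + 'D_v g x)) => //; last exact: IH.
by move=> x Ux; rewrite -deriveD//; apply: diff_derivable;
  [apply: df|apply: dg].
Qed.

Lemma Ck_lincomp V W W' k (U : set V) (f : V -> W) (L : {linear W -> W'}) :
  open U -> continuous L -> Ck k U f -> Ck k U (fun x => L (f x)).
Proof.
move=> oU cL; elim: k f => [|k IH] f /=.
  by move=> cf x Ux; apply: continuous_comp; [apply: cf|apply: cL].
move=> [df cf]; split=> [x Ux|v].
  by apply: differentiable_lincomp => //; apply: df.
apply: (@Ck_eq _ _ _ _ (fun x => L ('D_v f x))) => //; last exact: IH.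
by move=> x Ux; apply/esym/(@derive_lincomp _ _ _ _ f L) => //; exact: df.
Qed.

Lemma CkN V W k (U : set V) (f : V -> W) : open U ->
  Ck k U f -> Ck k U (fun x => - f x).
Proof.
move=> oU; apply: (@Ck_lincomp _ _ _ _ _ _ -%R) => // x.
exact: opp_continuous.
Qed.

Lemma CkZ V W k (U : set V) (a : R) (f : V -> W) : open U ->
  Ck k U f -> Ck k U (fun x => a *: f x).
Proof.
move=> oU; apply: (@Ck_lincomp _ _ _ _ _ _ ( *:%R a)) => // x.
exact: scaler_continuous.
Qed.

Lemma CkZl V W k (U : set V) (f : V -> R^o) (w : W) : open U ->
  Ck k U f -> Ck k U (fun x => f x *: w).
Proof.
have lin : linear (fun a : R^o => a *: w) by move=> a u v; rewrite scalerDl scalerA.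
pose Lm := GRing.isLinear.Build _ _ _ _ _ lin.
pose L : {linear R^o -> W} := HB.pack (fun a : R^o => a *: w) Lm.
by move=> oU; apply: (@Ck_lincomp _ _ _ _ _ _ L) => //; exact: scalel_continuous.
Qed.

Lemma Ck_sum V W k (U : set V) (I : Type) (r : seq I) (f : I -> V -> W) :
  open U -> (forall i, Ck k U (f i)) -> Ck k U (fun x => \sum_(i <- r) f i x).
Proof.
move=> oU cf; elim: r => [|i r IH].
  by apply: Ck_eq (Ck_cst _ _ 0) => // x _; rewrite big_nil.
apply: Ck_eq (CkD oU (cf i) IH) => // x _; by rewrite big_cons.
Qed.

Lemma CkM V k (U : set V) (f g : V -> R^o) : open U ->
  Ck k U f -> Ck k U g -> Ck k U (fun x => f x * g x : R^o).
Proof.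
move=> oU; elim: k f g => [|k IH] f g /=.
  by move=> cf cg x Ux; apply: continuousM; [apply: cf|apply: cg].
move=> F G; have [df cf] := F; have [dg cg] := G; split=> [x Ux|v].
  by apply: (@differentiableM _ _ f g); [apply: df|apply: dg].
apply: (@Ck_eq _ _ _ _ (fun x => f x * 'D_v g x + g x * 'D_v f x : R^o)) => //.
  by move=> x Ux; rewrite (@deriveM _ _ f g)//; apply: diff_derivable;
    [apply: df|apply: dg].
by apply: CkD => //; apply: IH => //; exact: Ck_pred.
Qed.

Lemma Ck_prod V k (U : set V) (I : Type) (r : seq I) (f : I -> V -> R^o) :
  open U -> (forall i, Ck k U (f i)) ->
  Ck k U (fun x => \prod_(i <- r) f i x : R^o).
Proof.
move=> oU cf; elim: r => [|i r IH].
  by apply: (Ck_eq (f := fun=> 1 : R^o)) (Ck_cst _ _ _) => // x _; rewrite big_nil.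
apply: Ck_eq (CkM oU (cf i) IH) => // x _; by rewrite big_cons.
Qed.

Lemma CkV V k (U : set V) (f : V -> R^o) : open U ->
  (forall x, U x -> f x != 0) ->
  Ck k U f -> Ck k U (fun x => (f x)^-1 : R^o).
Proof.
move=> oU f0; elim: k => [|k IH] /=.
  by move=> cf x Ux; apply: continuousV; [apply: f0|apply: cf].
move=> F; have [df cf] := F; split=> [x Ux|v].
  by apply: (@differentiableV _ _ f); [apply: df|apply: f0].
apply: (@Ck_eq _ _ _ _ (fun x => - ((f x)^-1 * (f x)^-1 * 'D_v f x) : R^o)) => //.
  move=> x Ux; rewrite (@deriveV _ _ f) ?f0//; last exact/diff_derivable/df.
  by rewrite expr2 invfM scaleNr.
have := IH (Ck_pred F) => H.
by apply: CkN => //; apply: CkM (cf v) => //; apply: CkM.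
Qed.

Lemma Ck_rsqrt V k (U : set V) (f : V -> R^o) : open U ->
  (forall x, U x -> 0 < f x) ->
  Ck k U f -> Ck k U (fun x => (Num.sqrt (f x))^-1 : R^o).
Proof.
move=> oU f0.
have dsqrt (a : R) : 0 < a -> differentiable (Num.sqrt : R^o -> R^o) a.
  by move=> a0; apply/derivable1_diffP; have [] := is_derive1_sqrt a0.
have s0 x : U x -> Num.sqrt (f x) != 0.
  by move=> Ux; rewrite sqrtr_eq0 -ltNge f0.
elim: k => [|k IH].
  move=> /= cf x Ux; apply: continuousV; first exact: s0.
  apply: continuous_comp; first exact: cf.
  by apply: differentiable_continuous; apply: dsqrt; apply: f0.
move=> F; have [df cf] := F.
have dsf x : U x -> differentiable (fun x => Num.sqrt (f x) : R^o) x.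
  move=> Ux; apply: (@differentiable_comp _ _ _ _ f (Num.sqrt : R^o -> R^o)).
    exact: df.
  by apply: dsqrt; apply: f0.
have H := IH (Ck_pred F).
split=> [x Ux|v].
  apply: (@differentiableV _ _ (fun x => Num.sqrt (f x))); last exact: s0.
  exact: dsf.
apply: (@Ck_eq _ _ _ _ (fun x => (- (2^-1 : R)) *: ((Num.sqrt (f x))^-1 *
   (Num.sqrt (f x))^-1 * (Num.sqrt (f x))^-1 * 'D_v f x : R^o))) => //.
  move=> x Ux; rewrite (@deriveV _ _ (fun x => Num.sqrt (f x))) ?s0//; last first.
    exact/diff_derivable/dsf.
  rewrite (@derive_comp _ _ _ _ f (Num.sqrt : R^o -> R^o)); last 2 first.
  - exact: df.
  - by apply: dsqrt; apply: f0.
  have -> : 'D_v f x = 'D_v f x *: (1 : R^o) by rewrite /GRing.scale /= mulr1.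
  rewrite deriveZv; last by apply: dsqrt; apply: f0.
  rewrite derive_sqrt ?f0//.
  by rewrite /GRing.scale /= expr2 !invfM; ring.
apply: CkZ => //; apply: CkM (cf v) => //.
by apply: CkM => //; apply: CkM.
Qed.

End Smooth.

Section FiniteDimension.
Context {R : realType}.
Implicit Types V W Z : normedModType R.

Definition fin_dim V : Prop := exists n (b : 'I_n -> V)
  (l : 'I_n -> {linear V -> R^o}),
  (forall i, continuous (l i)) /\ forall v, v = \sum_i l i v *: b i.

Lemma linear_pack V W (f : V -> W) : linear f ->
  exists L : {linear V -> W}, L = f :> (V -> W).
Proof.
move=> lf; pose Lm := GRing.isLinear.Build _ _ _ _ _ lf.
by pose L : {linear V -> W} := HB.pack f Lm; exists L.
Qed.

Lemma fin_dimR : fin_dim R^o.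
Proof.
exists 1, (fun=> 1), (fun=> idfun : {linear R^o -> R^o}); split.
  by move=> _ x; exact: cvg_id.
by move=> v; rewrite big_ord1 /GRing.scale /= mulr1.
Qed.

Lemma coordP m n (i : 'I_m) (j : 'I_n) : exists2 L : {linear 'M[R]_(m, n) -> R^o},
  L = (fun A => A i j) :> ('M[R]_(m, n) -> R^o) & continuous L.
Proof.
have lin : linear (fun A : 'M[R]_(m, n) => A i j : R^o).
  by move=> a A B; rewrite !mxE.
have [L LE] := linear_pack lin; exists L => //.
by rewrite LE => x; exact: coord_continuous.
Qed.

Lemma fin_dim_mx m n : fin_dim 'M[R]_(m, n).
Proof.
pose e : 'I_(m * n) -> 'I_m * 'I_n := fun k => enum_val (cast_ord (esym (mxvec_cast m n)) k).
pose b k : 'M[R]_(m, n) := delta_mx (e k).1 (e k).2.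
pose l k := projT1 (cid2 (coordP (e k).1 (e k).2)).
have lE k A : l k A = A (e k).1 (e k).2.
  by rewrite /l; case: cid2 => L /= -> _.
exists (m * n)%N, b, l; split=> [k|A].
  by rewrite /l; case: cid2.
apply/matrixP => i j; rewrite summxE (bigD1 (mxvec_index i j))//=.
have eE i' j' : e (mxvec_index i' j') = (i', j').
  by rewrite /e /mxvec_index cast_ordK enum_rankK.
rewrite lE mxE /b eE /= mxE !eqxx mulr1 big1 ?addr0// => k.
case/mxvec_indexP: k => i' j' ne; rewrite lE mxE /b eE /= mxE.
case: eqP => [ei|_]; case: eqP => [ej|_] /=; rewrite ?mulr0//.
by rewrite ei ej eqxx in ne.
Qed.

Lemma continuous_pairl V W : continuous (fun v : V => (v, 0 : W)).
Proof. by move=> x; apply: cvg_pair; [exact: cvg_id|exact: cvg_cst]. Qed.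

Lemma continuous_pairr V W : continuous (fun w : W => (0 : V, w)).
Proof. by move=> x; apply: cvg_pair; [exact: cvg_cst|exact: cvg_id]. Qed.

Lemma fin_dim_pair V W : fin_dim V -> fin_dim W -> fin_dim (V * W)%type.
Proof.
move=> [m [b [l [cl bl]]]] [n [b' [l' [cl' bl']]]].
have l1 i : exists2 L : {linear (V * W)%type -> R^o},
    L = (fun v => l i v.1) :> ((V * W)%type -> R^o) & continuous L.
  have lin : linear (fun v : (V * W)%type => l i v.1).
    by move=> a u v; rewrite linearP.
  have [L LE] := linear_pack lin; exists L => //.
  by rewrite LE => x; apply: continuous_comp; [exact: cvg_fst|exact: cl].
have l2 i : exists2 L : {linear (V * W)%type -> R^o},
    L = (fun v => l' i v.2) :> ((V * W)%type -> R^o) & continuous L.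
  have lin : linear (fun v : (V * W)%type => l' i v.2).
    by move=> a u v; rewrite linearP.
  have [L LE] := linear_pack lin; exists L => //.
  by rewrite LE => x; apply: continuous_comp; [exact: cvg_snd|exact: cl'].
exists (m + n)%N, (fun k => match fintype.split k with inl i => (b i, 0) | inr i => (0, b' i) end),
  (fun k => match fintype.split k with inl i => projT1 (cid2 (l1 i))
                            | inr i => projT1 (cid2 (l2 i)) end); split.
  by move=> k; case: (fintype.split k) => i; case: cid2.
move=> [v w]; rewrite big_split_ord /=.
rewrite (eq_bigr (fun i => (l i v *: b i, 0))); last first.
  move=> i _; rewrite -[lshift n i]/(unsplit (inl i)) unsplitK.
  by case: cid2 => L /= -> _; congr pair; rewrite scaler0.
rewrite [X in _ = _ + X](eq_bigr (fun i => (0, l' i w *: b' i))); last first.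
  move=> i _; rewrite -[rshift m i]/(unsplit (inr i)) unsplitK.
  by case: cid2 => L /= -> _; congr pair; rewrite scaler0.
have sum1 (I : finType) (F : I -> V) : \sum_i (F i, 0 : W) = (\sum_i F i, 0).
  by elim/big_rec2 : _ => // i x y _ ->; congr pair; rewrite /= addr0.
have sum2 (I : finType) (F : I -> W) : \sum_i (0 : V, F i) = (0, \sum_i F i).
  by elim/big_rec2 : _ => // i x y _ ->; congr pair; rewrite /= addr0.
by rewrite sum1 sum2 -bl -bl'; congr pair; rewrite /= ?addr0 ?add0r.
Qed.

Lemma Ck_fin_dim V W k (U : set V) (f : V -> W) : fin_dim W -> open U ->
  (forall L : {linear W -> R^o}, continuous L -> Ck k U (fun x => L (f x))) ->
  Ck k U f.
Proof.
move=> [n [b [l [cl bl]]]] oU cf.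
apply: (Ck_eq (f := fun x => \sum_i l i (f x) *: b i)) => //.
by apply: Ck_sum => // i; apply: CkZl => //; apply: cf.
Qed.

Lemma fin_dim_eq W (v w : W) : fin_dim W ->
  (forall L : {linear W -> R^o}, continuous L -> L v = L w) -> v = w.
Proof.
move=> [n [b [l [cl bl]]]] H; rewrite (bl v) (bl w).
by apply: eq_bigr => i _; rewrite H.
Qed.

Lemma Ck_mx V m n k (U : set V) (f : V -> 'M[R]_(m, n)) : open U ->
  (forall i j, Ck k U (fun x => f x i j : R^o)) -> Ck k U f.
Proof.
move=> oU cf; apply: (Ck_eq (f := fun x => \sum_i \sum_j f x i j *: delta_mx i j)) => //.
  by move=> x _; rewrite -matrix_sum_delta.
by apply: Ck_sum => // i; apply: Ck_sum => // j; apply: CkZl.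
Qed.

Lemma Ck_coord V m n k (U : set V) (f : V -> 'M[R]_(m, n)) i j : open U ->
  Ck k U f -> Ck k U (fun x => f x i j : R^o).
Proof.
move=> oU cf; have [L LE cL] := coordP i j.
by apply: Ck_eq (Ck_lincomp oU cL cf) => // x _; rewrite LE.
Qed.

Lemma Ck_pair V W W' k (U : set V) (f : V -> W) (g : V -> W') : open U ->
  Ck k U f -> Ck k U g -> Ck k U (fun x => (f x, g x)).
Proof.
move=> oU cf cg.
have ll : linear (fun w : W => (w, 0 : W')).
  by move=> a u v; congr pair; rewrite /= scaler0 addr0.
have lr : linear (fun w : W' => (0 : W, w)).
  by move=> a u v; congr pair; rewrite /= scaler0 addr0.
have [Ll LlE] := linear_pack ll; have [Lr LrE] := linear_pack lr.
apply: (Ck_eq (f := fun x => Ll (f x) + Lr (g x))) => //.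
  by move=> x _; rewrite LlE LrE; congr pair; rewrite /= ?addr0 ?add0r.
apply: CkD => //; apply: Ck_lincomp => //; rewrite ?LlE ?LrE.
  exact: continuous_pairl.
exact: continuous_pairr.
Qed.

Lemma Ck_fst V W W' k (U : set V) (f : V -> (W * W')%type) : open U ->
  Ck k U f -> Ck k U (fun x => (f x).1).
Proof.
have lin : linear (fst : (W * W')%type -> W) by [].
have [L LE] := linear_pack lin.
move=> oU cf; apply: Ck_eq (Ck_lincomp (L := L) oU _ cf) => //.
  by move=> x _; rewrite LE.
by rewrite LE => x; exact: cvg_fst.
Qed.

Lemma Ck_snd V W W' k (U : set V) (f : V -> (W * W')%type) : open U ->
  Ck k U f -> Ck k U (fun x => (f x).2).
Proof.
have lin : linear (snd : (W * W')%type -> W') by [].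
have [L LE] := linear_pack lin.
move=> oU cf; apply: Ck_eq (Ck_lincomp (L := L) oU _ cf) => //.
  by move=> x _; rewrite LE.
by rewrite LE => x; exact: cvg_snd.
Qed.

Lemma Ck_id V k (U : set V) : Ck k U (fun x : V => x).
Proof. by apply: (@Ck_lin _ _ _ _ _ idfun) => x; exact: cvg_id. Qed.

(* The chain rule expands the direction of differentiation of the outer
   function in a basis. *)
Lemma Ck_comp V W Z k (U : set V) (U' : set W) (g : V -> W) (f : W -> Z) :
  fin_dim W -> fin_dim Z -> open U -> (forall x, U x -> U' (g x)) ->
  Ck k U g -> Ck k U' f -> Ck k U (fun x => f (g x)).
Proof.
move=> fW fZ oU UU'.
have [n [b [l [cl bl]]]] := fW.
elim: k f => [|k IH] f cg cf.
  move=> x Ux; apply: continuous_comp; first exact: cg.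
  by apply: cf; apply: UU'.
have [dg ddg] := cg; have [df ddf] := cf; split=> [x Ux|v].
  by apply: differentiable_comp; [apply: dg|apply/df/UU'].
apply: (Ck_eq (f := fun x => 'D_('D_v g x) f (g x))) => //.
  by move=> x Ux; rewrite -derive_comp//; [exact: dg|exact/df/UU'].
apply: (Ck_eq (f := fun x => \sum_i l i ('D_v g x) *: 'D_(b i) f (g x))) => //.
  move=> x Ux; rewrite [in RHS](bl ('D_v g x)) derive_sumv; last exact/df/UU'.
  by apply: eq_bigr => i _; rewrite deriveZv//; exact/df/UU'.
apply: Ck_sum => // i; apply: Ck_fin_dim => // L cL.
apply: (Ck_eq (f := fun x => l i ('D_v g x) * L ('D_(b i) f (g x)) : R^o)) => //.
  by move=> x _; rewrite linearZ.
have /(Ck_pred) cg' := cg.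
apply: CkM => //; first by apply: Ck_lincomp => //; apply: ddg.
by apply: Ck_lincomp (IH _ cg' (ddf (b i))).
Qed.

End FiniteDimension.

Section MatrixFunctions.
Context {R : realType} {V : normedModType R}.
Implicit Types (U : set V).

Lemma Ck_mul k U m n p (A : V -> 'M[R]_(m, n)) (B : V -> 'M[R]_(n, p)) :
  open U -> Ck k U A -> Ck k U B -> Ck k U (fun x => A x *m B x).
Proof.
move=> oU cA cB; apply: Ck_mx => // i j.
apply: (Ck_eq (f := fun x => \sum_l A x i l * B x l j : R^o)) => //.
  by move=> x _; rewrite mxE.
by apply: Ck_sum => // l; apply: CkM => //; apply: Ck_coord.
Qed.

Lemma Ck_tr k U m n (A : V -> 'M[R]_(m, n)) :
  open U -> Ck k U A -> Ck k U (fun x => (A x)^T).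
Proof.
move=> oU cA; apply: Ck_mx => // i j.
apply: (Ck_eq (f := fun x => A x j i : R^o)) => //.
  by move=> x _; rewrite mxE.
exact: Ck_coord.
Qed.

Lemma Ck_trace k U n (A : V -> 'M[R]_n) :
  open U -> Ck k U A -> Ck k U (fun x => \tr (A x) : R^o).
Proof. by move=> oU cA; apply: Ck_sum => // i; apply: Ck_coord. Qed.

Lemma Ck_det k U n (A : V -> 'M[R]_n) :
  open U -> Ck k U A -> Ck k U (fun x => \det (A x) : R^o).
Proof.
move=> oU cA; apply: Ck_sum => // s; apply: CkM => //; first exact: Ck_cst.
by apply: Ck_prod => // i; apply: Ck_coord.
Qed.

Lemma Ck_invmx k U n (A : V -> 'M[R]_n) : open U ->
  (forall x, U x -> A x \in unitmx) ->
  Ck k U A -> Ck k U (fun x => invmx (A x)).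
Proof.
move=> oU uA cA.
apply: (Ck_eq (f := fun x => \matrix_(i, j) ((\det (A x))^-1 * cofactor (A x) j i))) => //.
  by move=> x Ux; rewrite /invmx uA//; apply/matrixP => i j; rewrite !mxE.
apply: Ck_mx => // i j.
apply: (Ck_eq (f := fun x => (\det (A x))^-1 * ((-1) ^+ (j + i) *
    \det (row' j (col' i (A x)))) : R^o)) => //.
  by move=> x Ux; rewrite mxE.
apply: CkM => //.
  apply: CkV => //; last exact: Ck_det.
  by move=> x Ux; rewrite -unitfE -unitmxE uA.
apply: CkM => //; first exact: Ck_cst.
apply: Ck_det => //; apply: Ck_mx => // i' j'.
apply: (Ck_eq (f := fun x => A x (lift j i') (lift i j') : R^o)) => //.
  by move=> x Ux; rewrite !mxE.
exact: Ck_coord.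
Qed.

Lemma is_derive_mx m n (A : V -> 'M[R]_(m, n)) x v dA :
  is_derive x v A dA <-> forall i j, is_derive x v (fun y => A y i j : R^o) (dA i j).
Proof.
split=> [[dAx <-] i j|H].
  split; first exact: (derivable_mxP _ _ _).1.
  by rewrite derive_mx// mxE.
have dAx : derivable A x v.
  by apply/derivable_mxP => i j; have [] := H i j.
split=> //; rewrite derive_mx//; apply/matrixP => i j.
by rewrite mxE; have [] := H i j.
Qed.

Lemma is_derive_mul m n p (A : V -> 'M[R]_(m, n)) (B : V -> 'M[R]_(n, p)) x v dA dB :
  is_derive x v A dA -> is_derive x v B dB ->
  is_derive x v (fun y => A y *m B y) (dA *m B x + A x *m dB).
Proof.
move=> /is_derive_mx hA /is_derive_mx hB; apply/is_derive_mx => i j.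
have -> : (fun y => (A y *m B y) i j) =
    \sum_l ((fun y => A y i l) * (fun y => B y l j)).
  by apply/funext => y; rewrite mxE fct_sumE.
rewrite !mxE -big_split /=.
apply: is_derive_sum => l.
apply: (is_derive_eq (is_deriveM (hA i l) (hB l j))).
by rewrite /GRing.scale /=; ring.
Qed.

Lemma is_derive_tr m n (A : V -> 'M[R]_(m, n)) x v dA :
  is_derive x v A dA -> is_derive x v (fun y => (A y)^T) dA^T.
Proof.
move=> /is_derive_mx hA; apply/is_derive_mx => i j; rewrite mxE.
have -> : (fun y => (A y)^T i j) = (fun y => A y j i) by apply/funext => y; rewrite mxE.
exact: hA.
Qed.

Lemma is_derive_trace n (A : V -> 'M[R]_n) x v dA :
  is_derive x v A dA -> is_derive x v (fun y => \tr (A y) : R^o) (\tr dA).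
Proof.
move=> /is_derive_mx hA.
have -> : (fun y => \tr (A y) : R^o) = \sum_i (fun y => A y i i).
  by apply/funext => y; rewrite fct_sumE.
by apply: is_derive_sum => l; exact: hA.
Qed.

End MatrixFunctions.

Section Schwarz.
Context {R : realType} {V : normedModType R}.

Lemma is_derive_line (W : normedModType R) (f : V -> W) x u (a : R) :
  differentiable f (x + a *: u) ->
  is_derive (a : R^o) 1 (fun s : R^o => f (x + s *: u)) ('D_u f (x + a *: u)).
Proof.
move=> df.
have dl : is_diff (a : R^o) (fun s : R^o => x + s *: u) (fun s : R^o => s *: u).
  have -> : (fun s : R^o => x + s *: u) = cst x + (fun s : R^o => s *: u) by [].
  apply: (is_diff_eq (is_diffD (is_diff_cst _ _) (is_diff_scalel _ _))).
  by apply/funext => s; rewrite !fctE add0r.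
have dfl : differentiable (f \o (fun s : R^o => x + s *: u)) (a : R^o).
  by apply: differentiable_comp.
split; first exact: diff_derivable dfl.
apply: (etrans (derive_comp (f := fun s : R^o => x + s *: u) 1 _ df)) => //.
by congr (derive f _ _); rewrite deriveE// diff_val scale1r.
Qed.

Lemma line_mvt (f : V -> R^o) x u (s : R) : 0 < s ->
  (forall a, 0 <= a <= s -> differentiable f (x + a *: u)) ->
  exists2 a, 0 < a < s & f (x + s *: u) - f x = s * 'D_u f (x + a *: u).
Proof.
move=> s0 df.
have [||a as_ E] := @MVT R (fun a => f (x + a *: u)) (fun a => 'D_u f (x + a *: u)) 0 s s0.
- move=> a; rewrite in_itv /= => /andP[a0 a1]; apply: is_derive_line.
  by apply: df; rewrite !ltW.
- apply: continuous_in_subspaceT => a; rewrite inE /= in_itv /= => /andP[a0 a1].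
  have /is_derive_line[/derivable1_diffP dl _] : differentiable f (x + a *: u).
    by apply: df; rewrite a0.
  exact: (differentiable_continuous dl).
- exists a; first by rewrite in_itv in as_.
  by move: E; rewrite scale0r addr0 subr0 mulrC.
Qed.

Lemma second_difference (f : V -> R^o) x u v (s : R) : 0 < s ->
  (forall a b, 0 <= a <= s -> 0 <= b <= s ->
    differentiable f (x + a *: u + b *: v) /\
    differentiable ('D_u f) (x + a *: u + b *: v)) ->
  exists a b, [/\ 0 < a < s, 0 < b < s &
    f (x + s *: u + s *: v) - f (x + s *: v) - (f (x + s *: u) - f x) =
    s * (s * 'D_v ('D_u f) (x + a *: u + b *: v))].
Proof.
move=> s0 df.
pose g y := f (y + s *: v) - f y.
have ss : 0 <= s <= s by rewrite lexx ltW.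
have s00 : (0 : R) <= 0 <= s by rewrite lexx ltW.
have dg a : 0 <= a <= s ->
    is_diff (x + a *: u) g (fun h => 'd f (x + a *: u + s *: v) h - 'd f (x + a *: u) h).
  move=> Ha.
  have [dfs _] := df a s Ha ss.
  have [df0 _] := df a 0 Ha s00; rewrite scale0r addr0 in df0.
  apply: is_diffB; last exact/differentiableP.
  have dt : is_diff (x + a *: u) (fun y => y + s *: v) id.
    have -> : (fun y => y + s *: v) = id + cst (s *: v) by [].
    apply: (is_diff_eq (is_diffD (is_diff_id _) (is_diff_cst _ _))).
    by apply/funext => h; rewrite !fctE addr0.
  exact: (is_diff_comp dt (differentiableP dfs)).
have [a Ha E] := line_mvt (f := g) (u := u) (x := x) s0
  (fun a Ha => @ex_diff _ _ _ _ _ _ _ (dg a Ha)).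
have Ha' : 0 <= a <= s by case/andP: Ha => *; rewrite !ltW.
have [b Hb E'] := line_mvt (f := 'D_u f) (u := v) (x := x + a *: u) s0
  (fun b Hb => (df a b Ha' Hb).2).
exists a, b; split => //.
have -> : f (x + s *: u + s *: v) - f (x + s *: v) - (f (x + s *: u) - f x) =
    g (x + s *: u) - g x.
  by rewrite /g; ring.
rewrite -E' E; congr (_ * _).
rewrite deriveE; last exact: (@ex_diff _ _ _ _ _ _ _ (dg a Ha')).
have [dfs _] := df a s Ha' ss.
have [df0 _] := df a 0 Ha' s00; rewrite scale0r addr0 in df0.
have -> := @diff_val _ _ _ _ _ _ _ (dg a Ha').
by rewrite !deriveE.
Qed.

Lemma near_dist_lt (g : V -> R^o) x (e : R) : 0 < e -> {for x, continuous g} ->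
  \forall y \near x, `|g x - g y| < e.
Proof. by move=> e0 cg; move: e e0; apply/cvgrPdist_lt. Qed.

Lemma schwarz_scalar (U : set V) (f : V -> R^o) x u v : open U -> Ck 2 U f -> U x ->
  'D_u ('D_v f) x = 'D_v ('D_u f) x.
Proof.
move=> oU [df cf] Ux.
pose fu : V -> R^o := 'D_u f; pose fv : V -> R^o := 'D_v f.
pose A : V -> R^o := 'D_u fv; pose B : V -> R^o := 'D_v fu.
have dfu y : U y -> differentiable fu y by apply: (cf u).1.
have dfv y : U y -> differentiable fv y by apply: (cf v).1.
have cA : {for x, continuous A} by exact: (cf v).2.
have cB : {for x, continuous B} by exact: (cf u).2.
have S1 (s : R) : 0 < s -> (forall a b : R, 0 <= a <= s -> 0 <= b <= s ->
    differentiable f (x + a *: u + b *: v) /\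
    differentiable fu (x + a *: u + b *: v)) ->
  exists a b, [/\ 0 < a < s, 0 < b < s &
    f (x + s *: u + s *: v) - f (x + s *: v) - (f (x + s *: u) - f x) =
    s * (s * B (x + a *: u + b *: v))] by exact: second_difference.
have S2 (s : R) : 0 < s -> (forall a b : R, 0 <= a <= s -> 0 <= b <= s ->
    differentiable f (x + a *: v + b *: u) /\
    differentiable fv (x + a *: v + b *: u)) ->
  exists a b, [/\ 0 < a < s, 0 < b < s &
    f (x + s *: v + s *: u) - f (x + s *: u) - (f (x + s *: v) - f x) =
    s * (s * A (x + a *: v + b *: u))] by exact: second_difference.
change (A x = B x); clear cf; clearbody A B; clearbody fu fv.
have [//|ne] := eqVneq (A x) (B x).
pose e := `|A x - B x| / 2.
have e0 : 0 < e by rewrite divr_gt0// normr_gt0 subr_eq0.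
have : \forall y \near x, [/\ U y, `|A x - A y| < e & `|B x - B y| < e].
  have nU : nbhs x U by exact: open_nbhs_nbhs.
  by apply: filterS3 nU (near_dist_lt e0 cA) (near_dist_lt e0 cB).
move=> /nbhs_ballP[r r0 /= Hr].
have uv0 : 0 < `|u| + `|v| + 1 by rewrite ltr_wpDl// addr_ge0.
pose s := r / 2 / (`|u| + `|v| + 1).
have s0 : 0 < s by rewrite !divr_gt0.
have Hs a b : 0 <= a <= s -> 0 <= b <= s -> ball x r (x + a *: u + b *: v).
  move=> /andP[a0 a1] /andP[b0 b1]; rewrite -ball_normE /ball_ /=.
  rewrite -addrA opprD addNKr normrN (le_lt_trans (ler_normD _ _))// !normrZ.
  rewrite !ger0_norm//.
  have : a * `|u| + b * `|v| <= s * (`|u| + `|v| + 1).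
    by rewrite -[leLHS]addr0 !mulrDr mulr1 !lerD ?ler_wpM2r// ltW.
  move=> /le_lt_trans; apply; rewrite /s divfK ?gt_eqF//.
  by rewrite ltr_pdivrMr// ltr_pMr// ltr1n.
have [|a [b [Ha Hb E]]] := S1 s s0.
  by move=> a b Ha Hb; have [Uy _ _] := Hr _ (Hs a b Ha Hb); split;
    [apply: df|apply: dfu].
have [|a' [b' [Ha' Hb' E']]] := S2 s s0.
  move=> b' a' Hb' Ha'; rewrite addrAC.
  by have [Uy _ _] := Hr _ (Hs _ _ Ha' Hb'); split; [apply: df|apply: dfv].
have LE (c : R) : 0 < c < s -> 0 <= c <= s by case/andP=> *; rewrite !ltW.
have [_ _ H1] := Hr _ (Hs _ _ (LE _ Ha) (LE _ Hb)).
have [_ H2 _] := Hr _ (Hs _ _ (LE _ Hb') (LE _ Ha')).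
rewrite (addrAC x (b' *: u)) in H2.
have EE : B (x + a *: u + b *: v) = A (x + a' *: v + b' *: u).
  apply: (mulfI (lt0r_neq0 s0)); apply: (mulfI (lt0r_neq0 s0)).
  by rewrite -E -E' (addrAC x (s *: v)) addrAC opprB [RHS]addrAC opprB
    -!addrA; congr (_ + _); rewrite addrCA.
move: H1; rewrite EE => H1.
have : `|A x - B x| < e + e.
  apply: le_lt_trans (ltrD H2 H1).
  have -> : A x - B x = (A x - A (x + a' *: v + b' *: u)) -
     (B x - A (x + a' *: v + b' *: u)) by ring.
  exact: ler_normB.
by rewrite /e -splitr ltxx.
Qed.

Lemma schwarz (W : normedModType R) (U : set V) (f : V -> W) x u v : fin_dim W ->
  open U -> Ck 2 U f -> U x -> 'D_u ('D_v f) x = 'D_v ('D_u f) x.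
Proof.
move=> fW oU cf Ux; apply: (fin_dim_eq fW) => L cL.
have E a b : L ('D_a ('D_b f) x) = 'D_a ('D_b (L \o f)) x.
  rewrite -(derive_lincomp _ cL); last exact: (cf.2 b).1.
  apply: near_eq_derive; near=> y.
  apply/esym/(derive_lincomp _ cL)/cf.1.
  by near: y; exact: open_nbhs_nbhs.
rewrite 2!E; apply: (@schwarz_scalar U (L \o f)) => //; exact: Ck_lincomp.
Unshelve. all: by end_near. Qed.

End Schwarz.

Section Jacobian.
Context {R : realType}.
Implicit Types (F G : 'cV[R]_4 -> 'cV[R]_4) (U : set 'cV[R]_4).
Implicit Types (u v z : 'cV[R]_4).

Lemma cV_sum (v : 'cV[R]_4) : v = \sum_j v j 0 *: delta_mx j 0.
Proof.
rewrite [LHS]matrix_sum_delta; apply: eq_bigr => j _; exact: big_ord1.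
Qed.

Lemma jacE F z v : differentiable F z -> 'D_v F z = jac F z *m v.
Proof.
move=> dF; rewrite [in LHS](cV_sum v) derive_sumv//; apply/matrixP => i j.
rewrite summxE mxE; apply: eq_bigr => k _.
by rewrite deriveZv// ord1 !mxE mulrC.
Qed.

Lemma mulmx_cVP (A B : 'M[R]_4) : (forall v : 'cV[R]_4, A *m v = B *m v) -> A = B.
Proof.
move=> AB; apply/matrixP => i j.
have /matrixP/(_ i 0) := AB (delta_mx j 0).
by rewrite -!colE !mxE.
Qed.

Lemma jac_comp F G z : differentiable F z -> differentiable G (F z) ->
  jac (G \o F) z = jac G (F z) *m jac F z.
Proof.
move=> dF dG; apply: mulmx_cVP => v.
have dGF : differentiable (G \o F) z by exact: differentiable_comp.
apply: (etrans (esym (jacE v dGF))); apply: (etrans (derive_comp v dF dG)).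
by apply: (etrans (jacE _ dG)); rewrite -mulmxA; congr (_ *m _); exact: jacE.
Qed.

Lemma jac_id z : jac id z = 1%:M.
Proof. by apply: mulmx_cVP => v; rewrite -(jacE (F := id))// derive_id mul1mx. Qed.

Lemma near_eq_jac F G z : (\forall y \near z, F y = G y) -> jac F z = jac G z.
Proof.
by move=> FG; apply/matrixP => i j; rewrite !mxE (near_eq_derive _ FG).
Qed.

Lemma smooth_jac F U : open U -> smooth_on U F -> smooth_on U (jac F).
Proof.
move=> oU sF k; apply: Ck_mx => // i j.
apply: (Ck_eq (f := fun z => ('D_(delta_mx j 0) F z) i 0 : R^o)) => //.
  by move=> z _; rewrite mxE.
by apply: Ck_coord => //; apply: (sF k.+1).2.
Qed.

Lemma smooth_diff (V W : normedModType R) (U : set V) (f : V -> W) x :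
  smooth_on U f -> U x -> differentiable f x.
Proof. by move=> sf; apply: (sf 1%N).1. Qed.

Lemma derive_jac F U u v z : open U -> smooth_on U F -> U z ->
  'D_u (jac F) z *m v = 'D_u ('D_v F) z.
Proof.
move=> oU sF Uz.
have dj : derivable (jac F) z u.
  by apply/diff_derivable/(smooth_diff (smooth_jac oU sF)).
have E : 'D_u (fun y => jac F y *m v) z = 'D_u (jac F) z *m v.
  have [_ {1}->] := is_derive_mul (derivableP dj) (is_derive_cst v z u).
  by rewrite mulmx0 addr0.
apply: (etrans (esym E)); apply: near_eq_derive; near=> y; rewrite -jacE//.
by apply: smooth_diff sF _; near: y; exact: open_nbhs_nbhs.
Unshelve. all: by end_near. Qed.

Lemma derive_jac_sym F U z u v : open U -> smooth_on U F -> U z ->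
  'D_u (jac F) z *m v = 'D_v (jac F) z *m u.
Proof.
move=> oU sF Uz; apply: (etrans (derive_jac u v oU sF Uz)).
apply: (etrans _ (esym (derive_jac v u oU sF Uz))).
exact: (schwarz u v (fin_dim_mx _ _) oU (sF 2%N) Uz).
Qed.

End Jacobian.

(** * Linear algebra of metric connections *)

Section Entries.
Context {R : realType} {m n : nat}.
Implicit Types (A B : 'M[R]_(m, n)).
Lemma entD A B i j : (A + B) i j = A i j + B i j. Proof. by rewrite mxE. Qed.
Lemma entN A i j : (- A) i j = - A i j. Proof. by rewrite mxE. Qed.
Lemma entZ a A i j : (a *: A) i j = a * A i j. Proof. by rewrite mxE. Qed.
Lemma trmxD A B : (A + B)^T = A^T + B^T. Proof. exact: linearD. Qed.
Lemma trmxN A : (- A)^T = - A^T. Proof. exact: linearN. Qed.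
Lemma trmxZ a A : (a *: A)^T = a *: A^T. Proof. exact: linearZ. Qed.
Lemma ent0 i j : (0 : 'M[R]_(m, n)) i j = 0. Proof. by rewrite mxE. Qed.
End Entries.

(* Equalities between sums of matrix products are reduced to [ring] on entries,
   the products being atoms. *)
Ltac mx_ring := apply/matrixP => ? ?; rewrite ?(entD, entN, entZ, ent0); ring.

Section Gdot.
Context {R : realType}.
Implicit Types (G A B : 'M[R]_4) (v w x y z : 'cV[R]_4).

Lemma gdotDl G v w x : gdot G (v + w) x = gdot G v x + gdot G w x.
Proof. by rewrite /gdot linearD /= !mulmxDl mxE. Qed.
Lemma gdotDr G v w x : gdot G x (v + w) = gdot G x v + gdot G x w.
Proof. by rewrite /gdot !mulmxDr mxE. Qed.
Lemma gdotNl G v x : gdot G (- v) x = - gdot G v x.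
Proof. by rewrite /gdot linearN /= !mulNmx mxE. Qed.
Lemma gdotNr G v x : gdot G x (- v) = - gdot G x v.
Proof. by rewrite /gdot !mulmxN mxE. Qed.
Lemma gdotZl G a v x : gdot G (a *: v) x = a * gdot G v x.
Proof. by rewrite /gdot linearZ /= -!scalemxAl mxE. Qed.
Lemma gdotZr G a v x : gdot G x (a *: v) = a * gdot G x v.
Proof. by rewrite /gdot -!scalemxAr mxE. Qed.
Lemma gdot_mull G (A : 'M[R]_4) v w : gdot G (A *m v) w = gdot (A^T *m G) v w.
Proof. by rewrite /gdot trmx_mul !mulmxA. Qed.
Lemma gdot_mulr G (A : 'M[R]_4) v w : gdot G v (A *m w) = gdot (G *m A) v w.
Proof. by rewrite /gdot !mulmxA. Qed.

Lemma gdotDm A B v w : gdot (A + B) v w = gdot A v w + gdot B v w.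
Proof. by rewrite /gdot mulmxDr mulmxDl mxE. Qed.
Lemma gdotNm A v w : gdot (- A) v w = - gdot A v w.
Proof. by rewrite /gdot mulmxN mulNmx mxE. Qed.
Lemma gdotZm a A v w : gdot (a *: A) v w = a * gdot A v w.
Proof. by rewrite /gdot -scalemxAr -scalemxAl mxE. Qed.

Lemma gdot_delta G (i j : 'I_4) : gdot G (delta_mx i 0) (delta_mx j 0) = G i j.
Proof. by rewrite /gdot trmx_delta -rowE -colE !mxE. Qed.

Lemma gdot_inj G G' : (forall v w, gdot G v w = gdot G' v w) -> G = G'.
Proof. by move=> H; apply/matrixP => i j; rewrite -!gdot_delta. Qed.

Lemma gdot_nondeg G v : G^T = G -> G \in unitmx ->
  (forall w, gdot G v w = 0) -> v = 0.
Proof.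
move=> GT uG H; apply: (can_inj (mulKmx uG)); rewrite mulmx0.
apply/matrixP => i j; rewrite ord1 ent0 -(H (delta_mx i 0)) gdotC// /gdot.
by rewrite trmx_delta -mulmxA -rowE [RHS]mxE.
Qed.

Lemma gdot_sum G v w : gdot G v w = \sum_i \sum_j v i 0 * w j 0 * G i j.
Proof.
rewrite /gdot mxE exchange_big /=; apply: eq_bigr => j _.
rewrite mxE mulr_suml; apply: eq_bigr => i _; rewrite mxE; ring.
Qed.

(* The algebraic fact behind both the uniqueness of the Levi-Civita connection
   and the vanishing of [nabla J]. *)
Lemma sym_skew_zero (C : 'cV[R]_4 -> 'cV[R]_4 -> 'cV[R]_4 -> R) :
  (forall x y z, C x y z = C y x z) -> (forall x y z, C x y z = - C x z y) ->
  forall x y z, C x y z = 0.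
Proof.
move=> S K x y z.
have E : C x y z = - C x y z.
  by rewrite {1}S K S K S K opprK.
by move: E; lra.
Qed.

End Gdot.

Section Directional.
Context {R : realType}.
Implicit Types (dF : 'I_4 -> 'M[R]_4) (v w : 'cV[R]_4).

Definition dir dF v : 'M[R]_4 := \sum_i v i 0 *: dF i.

Lemma dirE dF v i j : dir dF v i j = \sum_l v l 0 * dF l i j.
Proof. by rewrite summxE; apply: eq_bigr => l _; rewrite mxE. Qed.

Lemma dir_delta dF i : dir dF (delta_mx i 0) = dF i.
Proof.
apply/matrixP => k l; rewrite dirE (bigD1 i)//= mxE !eqxx mul1r big1 ?addr0// => j ne.
by rewrite mxE (negbTE ne) mul0r.
Qed.

Lemma dirD dF v w : dir dF (v + w) = dir dF v + dir dF w.
Proof. by rewrite -big_split; apply: eq_bigr => i _; rewrite mxE scalerDl. Qed.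

Lemma dirZ dF a v : dir dF (a *: v) = a *: dir dF v.
Proof. by rewrite scaler_sumr; apply: eq_bigr => i _; rewrite mxE scalerA. Qed.

Lemma dir_derive (F : 'cV[R]_4 -> 'M[R]_4) (z v : 'cV[R]_4) : differentiable F z ->
  dir (fun i => 'D_(delta_mx i 0 : 'cV[R]_4) F z) v = 'D_v F z.
Proof.
move=> dF; rewrite [in RHS](cV_sum v) derive_sumv//.
by apply: eq_bigr => i _; rewrite deriveZv.
Qed.

End Directional.

Section Christoffel.
Context {R : realType}.
Implicit Types (G : 'M[R]_4) (dG : 'I_4 -> 'M[R]_4) (v w : 'cV[R]_4).

(* The connection matrix v |-> Gamma(v) of a metric with Gram matrix G and
   partial derivatives dG. *)
Definition levi_civita_mx G dG v : 'M[R]_4 :=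
  \matrix_(k, j) \sum_(i < 4) (2^-1 * \sum_(l < 4) invmx G k l *
    (dG i j l + dG j i l - dG l i j)) * v i 0.

Definition levi_civita_low dG v : 'M[R]_4 :=
  \matrix_(l, j) \sum_(i < 4) 2^-1 * (dG i j l + dG j i l - dG l i j) * v i 0.

Lemma levi_civita_mxE G dG v : levi_civita_mx G dG v = invmx G *m levi_civita_low dG v.
Proof.
apply/matrixP => k j; rewrite !mxE.
under eq_bigr => i _ do rewrite mulr_sumr mulr_suml.
rewrite exchange_big; apply: eq_bigr => l _; rewrite mxE mulr_sumr.
by apply: eq_bigr => i _; ring.
Qed.

Lemma levi_civita_lowE G dG v : G \in unitmx -> G *m levi_civita_mx G dG v = levi_civita_low dG v.
Proof. by move=> uG; rewrite levi_civita_mxE mulKVmx. Qed.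

Lemma levi_civita_mx_metric G dG v : G^T = G -> G \in unitmx -> (forall i, (dG i)^T = dG i) ->
  dir dG v = (levi_civita_mx G dG v)^T *m G + G *m levi_civita_mx G dG v.
Proof.
move=> GT uG dGT.
have -> : (levi_civita_mx G dG v)^T *m G = (levi_civita_low dG v)^T.
  by rewrite -(levi_civita_lowE dG v uG) trmx_mul GT.
rewrite levi_civita_lowE//; apply/matrixP => l j; rewrite dirE !mxE -big_split.
apply: eq_bigr => i _ /=.
have S a b c : dG a b c = dG a c b by rewrite -[in LHS]dGT mxE.
by rewrite (S i j l); field.
Qed.

Lemma levi_civita_mx_sym G dG v w : (forall i, (dG i)^T = dG i) ->
  levi_civita_mx G dG v *m w = levi_civita_mx G dG w *m v.
Proof.
move=> dGT; rewrite !levi_civita_mxE -!mulmxA; congr (_ *m _).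
apply/matrixP => l k; rewrite ord1 !mxE.
under eq_bigr => j _ do rewrite mxE mulr_suml.
rewrite exchange_big; apply: eq_bigr => i _ /=; rewrite mxE mulr_suml.
apply: eq_bigr => j _ /=.
have S a b c : dG a b c = dG a c b by rewrite -[in LHS]dGT mxE.
by rewrite (S l j i) ; ring.
Qed.

Lemma levi_civita_mxD G dG v w : levi_civita_mx G dG (v + w) = levi_civita_mx G dG v + levi_civita_mx G dG w.
Proof.
apply/matrixP => i j; rewrite !mxE -big_split; apply: eq_bigr => k _ /=.
by rewrite mxE mulrDr.
Qed.

Lemma levi_civita_mxZ G dG a v : levi_civita_mx G dG (a *: v) = a *: levi_civita_mx G dG v.
Proof.
apply/matrixP => i j; rewrite !mxE mulr_sumr; apply: eq_bigr => k _ /=.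
by rewrite mxE mulrCA.
Qed.

Lemma levi_civita_mx_unique G dG (Gam : 'cV[R]_4 -> 'M[R]_4) :
  G^T = G -> G \in unitmx -> (forall i, (dG i)^T = dG i) ->
  (forall v w, Gam v *m w = Gam w *m v) ->
  (forall v, dir dG v = (Gam v)^T *m G + G *m Gam v) ->
  forall v, Gam v = levi_civita_mx G dG v.
Proof.
move=> GT uG dGT GS GM v; apply: mulmx_cVP => w.
suff H : forall x y z, gdot G ((Gam x - levi_civita_mx G dG x) *m y) z = 0.
  apply/eqP; rewrite -subr_eq0 -mulmxBl; apply/eqP.
  by apply: (gdot_nondeg GT uG) => z; apply: H.
apply: sym_skew_zero => x y z; rewrite !mulmxBl.
  by rewrite (GS x y) (levi_civita_mx_sym G x y dGT).
have E : (Gam x)^T *m G + G *m Gam x = (levi_civita_mx G dG x)^T *m G + G *m levi_civita_mx G dG x.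
  by rewrite -GM -levi_civita_mx_metric.
have : gdot ((Gam x)^T *m G + G *m Gam x) y z =
    gdot ((levi_civita_mx G dG x)^T *m G + G *m levi_civita_mx G dG x) y z by rewrite E.
rewrite !gdotDm -!gdot_mull -!gdot_mulr !gdotDl !gdotNl.
by rewrite (gdotC (Gam x *m z)) // (gdotC (levi_civita_mx G dG x *m z))//; lra.
Qed.

End Christoffel.

Section Kahler.
Context {R : realType}.
Variables (G J : 'M[R]_4) (dG dJ : 'I_4 -> 'M[R]_4).
Hypotheses (GT : G^T = G) (uG : G \in unitmx) (dGT : forall i, (dG i)^T = dG i).
Hypotheses (JJ : J *m J = - 1%:M) (GJ : (G *m J)^T = - (G *m J)).
Hypotheses (dJJ : forall i, dJ i *m J + J *m dJ i = 0)
  (dGJ : forall i, (dG i *m J + G *m dJ i)^T = - (dG i *m J + G *m dJ i)).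
Hypothesis (Nij : forall i j k, \sum_(l < 4) (J l i * dJ l k j - J l j * dJ l k i
   - J k l * (dJ i l j - dJ j l i)) = 0).
Hypothesis (dOmega : forall i j k,
  ((dJ i)^T *m G + J^T *m dG i) j k + ((dJ j)^T *m G + J^T *m dG j) k i
  + ((dJ k)^T *m G + J^T *m dG k) i j = 0).
Implicit Types (x y z v : 'cV[R]_4).
Let Gam := levi_civita_mx G dG.
Let nJ v := dir dJ v + Gam v *m J - J *m Gam v.

Lemma lin_zero (W : lmodType R) (f : 'cV[R]_4 -> W) :
  (forall x y, f (x + y) = f x + f y) -> (forall a x, f (a *: x) = a *: f x) ->
  (forall i, f (delta_mx i 0) = 0) -> forall x, f x = 0.
Proof.
move=> fD fZ f0 x; rewrite (cV_sum x).
elim/big_ind: _ => [|u v fu fv|i _]; last by rewrite fZ f0 scaler0.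
  by have := fZ 0 0; rewrite !scale0r.
by rewrite fD fu fv addr0.
Qed.

Lemma nijenhuis_vec x y :
  dir dJ (J *m x) *m y - dir dJ (J *m y) *m x - J *m (dir dJ x *m y - dir dJ y *m x) = 0.
Proof.
move: x; apply: lin_zero => [x x'|a x|i].
- by rewrite ?(mulmxDr, dirD, mulmxDl, mulmxN); mx_ring.
- rewrite -scalemxAr !dirZ -?scalemxAl -?scalemxAr.
  by rewrite ?(mulmxDr, mulmxN) -?scalemxAr; mx_ring.
move: y; apply: lin_zero => [x x'|a x|j].
- by rewrite ?(mulmxDr, dirD, mulmxDl, mulmxN); mx_ring.
- rewrite -!scalemxAr !dirZ -?scalemxAl -?scalemxAr.
  by rewrite ?(mulmxDr, mulmxN) -?scalemxAr; mx_ring.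
rewrite !dir_delta -!colE; apply/matrixP => k l; rewrite ord1 ent0.
apply: etrans (Nij i j k); rewrite !(entD, entN) [(J *m _) k 0]mxE.
rewrite ![(col _ (dir _ _)) _ _]mxE !dirE -!sumrB.
by apply: eq_bigr => m _; rewrite !mxE.
Qed.

Lemma cyclic_trilinear (M : 'cV[R]_4 -> 'M[R]_4) :
  (forall u v, M (u + v) = M u + M v) -> (forall a u, M (a *: u) = a *: M u) ->
  (forall i j k : 'I_4, M (delta_mx i 0) j k + M (delta_mx j 0) k i +
     M (delta_mx k 0) i j = 0) ->
  forall x y z, gdot (M x) y z + gdot (M y) z x + gdot (M z) x y = 0.
Proof.
move=> MD MZ M0 x y z.
move: x; apply: (@lin_zero R^o) => [x x'|a x|i].
- by rewrite MD gdotDm gdotDl gdotDr; ring.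
- by rewrite MZ gdotZm gdotZl gdotZr /GRing.scale /=; ring.
move: y; apply: (@lin_zero R^o) => [x x'|a x|j].
- by rewrite MD gdotDm gdotDl gdotDr; ring.
- by rewrite MZ gdotZm gdotZl gdotZr /GRing.scale /=; ring.
move: z; apply: (@lin_zero R^o) => [x x'|a x|k].
- by rewrite MD gdotDm gdotDl gdotDr; ring.
- by rewrite MZ gdotZm gdotZl gdotZr /GRing.scale /=; ring.
by rewrite !gdot_delta M0.
Qed.

Lemma dOmega_vec x y z :
  gdot ((dir dJ x)^T *m G + J^T *m dir dG x) y z +
  gdot ((dir dJ y)^T *m G + J^T *m dir dG y) z x +
  gdot ((dir dJ z)^T *m G + J^T *m dir dG z) x y = 0.
Proof.
apply: (@cyclic_trilinear (fun x => (dir dJ x)^T *m G + J^T *m dir dG x)).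
- by move=> u v; rewrite !dirD linearD /= mulmxDl mulmxDr; mx_ring.
- by move=> a u; rewrite !dirZ linearZ /= -scalemxAl -scalemxAr scalerDr.
by move=> i j k; rewrite !dir_delta dOmega.
Qed.

Lemma nJ_anti x : nJ x *m J + J *m nJ x = 0.
Proof.
have E : dir dJ x *m J + J *m dir dJ x = 0.
  move: x; apply: lin_zero => [x x'|a x|i].
  - by rewrite dirD mulmxDl mulmxDr; mx_ring.
  - by rewrite dirZ -scalemxAl -scalemxAr scalerDr.
  by rewrite dir_delta.
rewrite /nJ !mulmxBl !mulmxBr !mulmxDl !mulmxDr.
rewrite !mulmxA JJ -!mulmxA JJ mulNmx mul1mx mulmxN mulmx1 -[RHS]E.
by mx_ring.
Qed.

Lemma nJ_skew x : (G *m nJ x)^T = - (G *m nJ x).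
Proof.
have E : (dir dG x *m J + G *m dir dJ x)^T = - (dir dG x *m J + G *m dir dJ x).
  apply/eqP; rewrite -addr_eq0; apply/eqP; move: x; apply: lin_zero => [x x'|a x|i].
  - by rewrite !dirD mulmxDl mulmxDr !linearD /=; mx_ring.
  - by rewrite !dirZ -scalemxAl -scalemxAr -scalerDr linearZ /= -scalerDr.
  by rewrite !dir_delta dGJ addNr.
have -> : G *m nJ x = (dir dG x *m J + G *m dir dJ x) -
    ((Gam x)^T *m (G *m J) + (G *m J) *m Gam x).
  rewrite (levi_civita_mx_metric x GT uG dGT) -/(Gam x) /nJ mulmxDl mulmxBr mulmxDr !mulmxA.
  by mx_ring.
have K : ((Gam x)^T *m (G *m J) + (G *m J) *m Gam x)^T =
    - ((Gam x)^T *m (G *m J) + (G *m J) *m Gam x).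
  rewrite linearD /= [((Gam x)^T *m _)^T]trmx_mul [(_ *m Gam x)^T]trmx_mul trmxK GJ.
  by rewrite mulNmx mulmxN; mx_ring.
by rewrite linearB /= E K opprB opprK addrC.
Qed.

Let B x y z := gdot G (nJ x *m y) z.

Lemma nablaJ_eq0 x : nJ x = 0.
Proof.
have Bskew a b c : B a b c = - B a c b.
  rewrite /B gdotC// gdot_mulr gdot_mull.
  have -> : (nJ a)^T *m G = - (G *m nJ a) by rewrite -nJ_skew trmx_mul GT.
  by rewrite gdotNm opprK.
have BJ a b c : B a (J *m b) c = B a b (J *m c).
  rewrite /B mulmxA -[nJ a *m J](addrK (J *m nJ a)) nJ_anti sub0r mulNmx gdotNl.
  have JG : J^T *m G = - (G *m J) by rewrite -GJ trmx_mul GT.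
  by rewrite -(mulmxA J) (gdot_mull G J) JG gdotNm opprK gdot_mulr.
have BJJ a b c : B a b (J *m (J *m c)) = - B a b c.
  by rewrite mulmxA JJ mulNmx mul1mx /B gdotNr.
have nJJJ a : nJ (J *m (J *m a)) = - nJ a.
  have GJJ : forall v, Gam (J *m (J *m v)) = - Gam v.
    by move=> v; rewrite mulmxA JJ mulNmx mul1mx -scaleN1r /Gam levi_civita_mxZ scaleN1r.
  have DJJ : forall v, dir dJ (J *m (J *m v)) = - dir dJ v.
    by move=> v; rewrite mulmxA JJ mulNmx mul1mx -scaleN1r dirZ scaleN1r.
  by rewrite /nJ GJJ DJJ mulNmx mulmxN; mx_ring.
have Bcyc a b c : B a b c + B b c a + B c a b = 0.
  have om u v : gdot (J^T *m G) u v = - gdot (J^T *m G) v u.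
    rewrite -(gdot_mull G J u v) -(gdot_mull G J v u) gdotC// gdot_mulr.
    rewrite -[G *m J]opprK -GJ trmx_mul GT.
    by rewrite gdotNm gdot_mull.
  have E u v w : gdot ((dir dJ u)^T *m G + J^T *m dir dG u) v w =
      B u v w + gdot (J^T *m G) (Gam u *m v) w - gdot (J^T *m G) (Gam u *m w) v.
    have -> : dir dJ u = nJ u - Gam u *m J + J *m Gam u by rewrite /nJ; mx_ring.
    rewrite (levi_civita_mx_metric u GT uG dGT) -/(Gam u) (om (Gam u *m w)) opprK.
    rewrite gdot_mull gdot_mulr /B gdot_mull.
    rewrite -!gdotDm; congr (gdot _ _ _).
    rewrite !trmxD !trmxN !trmx_mul !mulmxDl !mulNmx mulmxDr !mulmxA.
    by mx_ring.
  have := dOmega_vec a b c; rewrite !E => <-.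
  by rewrite /Gam (levi_civita_mx_sym G a b dGT) (levi_civita_mx_sym G a c dGT) (levi_civita_mx_sym G b c dGT); ring.
have C0 a b c : B (J *m a) b c + B a b (J *m c) = 0.
  pose C a b c := B (J *m a) b c + B a b (J *m c).
  rewrite -/(C a b c); apply: sym_skew_zero => {a b c} a b c; last first.
    rewrite /C Bskew (Bskew a) -(BJ a c b).
    by rewrite opprD.
  have nJE v w : nJ v *m w = dir dJ v *m w + Gam v *m (J *m w) - J *m (Gam v *m w).
    by rewrite /nJ mulmxBl mulmxDl !mulmxA.
  have GS v w : Gam v *m w = Gam w *m v by apply: levi_civita_mx_sym.
  have N : nJ (J *m a) *m b - nJ (J *m b) *m a - J *m (nJ a *m b - nJ b *m a) = 0.
    rewrite -[RHS](nijenhuis_vec a b) !nJE (GS (J *m a) b) (GS (J *m b) a).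
    rewrite (GS (J *m a) (J *m b)) (GS b a) ?(mulmxDr, mulmxN, opprD, opprK).
    by mx_ring.
  have Jl v w : gdot G (J *m v) w = - gdot G v (J *m w).
    rewrite gdot_mull gdot_mulr -gdotNm; congr (gdot _ _ _).
    by rewrite -GJ trmx_mul GT.
  have : gdot G (nJ (J *m a) *m b - nJ (J *m b) *m a - J *m (nJ a *m b - nJ b *m a)) c = 0.
    by rewrite N /gdot trmx0 !mul0mx mxE.
  rewrite !gdotDl !gdotNl Jl gdotDl gdotNl /C /B; lra.
have H a b c : B c a b = 0.
  have := Bcyc a b c.
  have := Bcyc (J *m a) (J *m b) c.
  have -> : B (J *m a) (J *m b) c = B a b c.
    by have := C0 a (J *m b) c; rewrite (BJ a) BJJ => /eqP; rewrite subr_eq0 => /eqP.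
  have -> : B (J *m b) c (J *m a) = B b c a.
    by have := C0 b c (J *m a); rewrite BJJ => /eqP; rewrite subr_eq0 => /eqP.
  rewrite BJ BJJ; lra.
apply: mulmx_cVP => v; rewrite mul0mx.
by apply: (gdot_nondeg GT uG) => w; apply: H.
Qed.

End Kahler.

(** * The Pfaffian and the Hodge star *)

Section Pfaffian.
Context {R : realType}.
Implicit Types (Om G J F : 'M[R]_4) (v w : 'cV[R]_4).

Notation o0 := (@Ordinal 4 0 isT).
Notation o1 := (@Ordinal 4 1 isT).
Notation o2 := (@Ordinal 4 2 isT).
Notation o3 := (@Ordinal 4 3 isT).

Lemma sum4 (W : nmodType) (f : 'I_4 -> W) : \sum_i f i = f o0 + f o1 + f o2 + f o3.
Proof.
rewrite !big_ord_recl big_ord0 addr0 !addrA.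
by congr (_ + _ + _ + _); congr f; apply: val_inj.
Qed.

Lemma ord4P (P : 'I_4 -> Prop) : P o0 -> P o1 -> P o2 -> P o3 -> forall i, P i.
Proof.
move=> P0 P1 P2 P3 [[|[|[|[|//]]]] Hi].
- by rewrite (_ : Ordinal Hi = o0)//; apply: val_inj.
- by rewrite (_ : Ordinal Hi = o1)//; apply: val_inj.
- by rewrite (_ : Ordinal Hi = o2)//; apply: val_inj.
- by rewrite (_ : Ordinal Hi = o3)//; apply: val_inj.
Qed.

Lemma vandermonde4 (x : 'rV[R]_4) : \det (Vandermonde 4 x) =
  (x 0 o1 - x 0 o0) * (x 0 o2 - x 0 o0) * (x 0 o3 - x 0 o0) *
  (x 0 o2 - x 0 o1) * (x 0 o3 - x 0 o1) * (x 0 o3 - x 0 o2).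
Proof.
rewrite det_Vandermonde.
have prod4 (f : 'I_4 -> R) : \prod_i f i = f o0 * f o1 * f o2 * f o3.
  rewrite !big_ord_recl big_ord0 mulr1 !mulrA.
  by congr (_ * _ * _ * _); congr f; apply: val_inj.
have pr i (f : 'I_4 -> R) : \prod_(j < 4 | (i < j)%N) f j =
    (if (i < o0)%N then f o0 else 1) * (if (i < o1)%N then f o1 else 1) *
    (if (i < o2)%N then f o2 else 1) * (if (i < o3)%N then f o3 else 1).
  by rewrite big_mkcond prod4.
by rewrite prod4 !pr /=; ring.
Qed.

(* The Levi-Civita symbol is a Vandermonde determinant up to the factor
   [det (Vandermonde (0, 1, 2, 3)) = 12]. *)
Lemma epsE (i j k l : 'I_4) : eps i j k l = 12^-1 *
  ((j%:R - i%:R) * (k%:R - i%:R) * (l%:R - i%:R) * (k%:R - j%:R) *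
   (l%:R - j%:R) * (l%:R - k%:R) : R).
Proof.
pose x : 'rV[R]_4 := \row_a (tnth [tuple i; j; k; l] a)%:R.
pose y : 'rV[R]_4 := \row_(a < 4) (a : nat)%:R.
have E : (\matrix_(a < 4, b < 4) (tnth [tuple i; j; k; l] a == b)%:R : 'M[R]_4)
    *m (Vandermonde 4 y)^T = (Vandermonde 4 x)^T.
  apply/matrixP => a b; rewrite !mxE (bigD1 (tnth [tuple i; j; k; l] a))//=.
  rewrite !mxE eqxx mul1r big1 ?addr0// => c ne.
  by rewrite !mxE eq_sym (negbTE ne) mul0r.
have := congr1 determinant E; rewrite det_mulmx !det_tr !vandermonde4 !mxE /=.
rewrite -/(eps i j k l) => H.
have -> : eps i j k l = 12^-1 * (eps i j k l * 12) :> R by field.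
congr (_ * _); rewrite -[RHS]H; congr (_ * _); ring.
Qed.

Definition pfaffian Om : R := Om o0 o1 * Om o2 o3 - Om o0 o2 * Om o1 o3 + Om o0 o3 * Om o1 o2.

Definition star Om : 'M[R]_4 :=
  \matrix_(i < 4, j < 4) \sum_(k < 4) \sum_(l < 4) eps i j k l * Om k l.

Lemma star_mul Om : Om^T = - Om -> star Om *m Om = (- (2 * pfaffian Om))%:M.
Proof.
move=> OmT.
have S i j : Om i j = - Om j i by rewrite -[in RHS]entN -OmT mxE.
have D i : Om i i = 0 by have := S i i; lra.
have starE i j : star Om i j = 2 * (eps i j o0 o1 * Om o0 o1 + eps i j o0 o2 * Om o0 o2
  + eps i j o0 o3 * Om o0 o3 + eps i j o1 o2 * Om o1 o2 + eps i j o1 o3 * Om o1 o3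
  + eps i j o2 o3 * Om o2 o3).
  rewrite mxE !sum4 !D (S o1 o0) (S o2 o0) (S o3 o0) (S o2 o1) (S o3 o1) (S o3 o2).
  by rewrite !epsE /=; field.
apply/matrixP => i k; rewrite mxE sum4 !starE mxE /pfaffian.
move: i; apply: ord4P; move: k; apply: ord4P;
  rewrite !epsE /= ?D ?(S o1 o0) ?(S o2 o0) ?(S o3 o0) ?(S o2 o1) ?(S o3 o1) ?(S o3 o2);
  by field.
Qed.

Lemma det2 (A : 'M[R]_2) : \det A =
  A ord0 ord0 * A (lift ord0 ord0) (lift ord0 ord0)
  - A ord0 (lift ord0 ord0) * A (lift ord0 ord0) ord0.
Proof.
rewrite (expand_det_row _ ord0) !big_ord_recl big_ord0 /cofactor !det_mx11 !mxE /=.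
rewrite (_ : lift (lift ord0 ord0) 0 = ord0); last exact: val_inj.
by rewrite /bump /= addn0 addn1 expr0 expr1; ring.
Qed.

Lemma det3 (A : 'M[R]_3) : let i0 := ord0 in let i1 := lift ord0 ord0 in
  let i2 := lift ord0 (lift ord0 ord0) in \det A =
  A i0 i0 * (A i1 i1 * A i2 i2 - A i1 i2 * A i2 i1)
  - A i0 i1 * (A i1 i0 * A i2 i2 - A i1 i2 * A i2 i0)
  + A i0 i2 * (A i1 i0 * A i2 i1 - A i1 i1 * A i2 i0).
Proof.
move=> i0 i1 i2; pose a (m n : nat) := A (inord m) (inord n).
have aE i j : A i j = a i j by rewrite /a !inord_val.
rewrite (expand_det_row _ ord0) !big_ord_recl big_ord0 /cofactor.
rewrite !det2 !mxE !aE /= /bump /=; ring.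
Qed.

Lemma det4 (A : 'M[R]_4) : \det A =
   A o0 o0 * (A o1 o1 * (A o2 o2 * A o3 o3 - A o2 o3 * A o3 o2)
     - A o1 o2 * (A o2 o1 * A o3 o3 - A o2 o3 * A o3 o1)
     + A o1 o3 * (A o2 o1 * A o3 o2 - A o2 o2 * A o3 o1))
 - A o0 o1 * (A o1 o0 * (A o2 o2 * A o3 o3 - A o2 o3 * A o3 o2)
     - A o1 o2 * (A o2 o0 * A o3 o3 - A o2 o3 * A o3 o0)
     + A o1 o3 * (A o2 o0 * A o3 o2 - A o2 o2 * A o3 o0))
 + A o0 o2 * (A o1 o0 * (A o2 o1 * A o3 o3 - A o2 o3 * A o3 o1)
     - A o1 o1 * (A o2 o0 * A o3 o3 - A o2 o3 * A o3 o0)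
     + A o1 o3 * (A o2 o0 * A o3 o1 - A o2 o1 * A o3 o0))
 - A o0 o3 * (A o1 o0 * (A o2 o1 * A o3 o2 - A o2 o2 * A o3 o1)
     - A o1 o1 * (A o2 o0 * A o3 o2 - A o2 o2 * A o3 o0)
     + A o1 o2 * (A o2 o0 * A o3 o1 - A o2 o1 * A o3 o0)).
Proof.
pose a (m n : nat) := A (inord m) (inord n).
have aE i j : A i j = a i j by rewrite /a !inord_val.
rewrite (expand_det_row _ o0) !big_ord_recl big_ord0 /cofactor.
rewrite !det3 !mxE !aE /= /bump /=; ring.
Qed.

Lemma pfaffian_congr F Om : Om^T = - Om -> pfaffian (F^T *m Om *m F) = \det F * pfaffian Om.
Proof.
move=> OmT.
have S i j : Om i j = - Om j i by rewrite -[in RHS]entN -OmT mxE.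
have D i : Om i i = 0 by have := S i i; lra.
have E i j : (F^T *m Om *m F) i j =
    \sum_k \sum_l F k i * Om k l * F l j.
  rewrite mxE exchange_big; apply: eq_bigr => l _ /=.
  by rewrite mxE mulr_suml; apply: eq_bigr => k _; rewrite mxE.
rewrite /pfaffian !E !sum4 !D (S o1 o0) (S o2 o0) (S o3 o0) (S o2 o1) (S o3 o1) (S o3 o2).
by rewrite det4; ring.
Qed.

Lemma complex_frame_col J v w i (a : 'I_4) :
  complex_frame J v w i a = tnth [tuple v; J *m v; w; J *m w] a i 0.
Proof. by rewrite mxE. Qed.

Lemma frame_gram (B : 'M[R]_4) J v w (a b : 'I_4) :
  ((complex_frame J v w)^T *m B *m complex_frame J v w) a b =
  gdot B (tnth [tuple v; J *m v; w; J *m w] a) (tnth [tuple v; J *m v; w; J *m w] b).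
Proof.
rewrite gdot_sum mxE exchange_big; apply: eq_bigr => l _ /=.
rewrite mxE mulr_suml; apply: eq_bigr => k _.
rewrite [_^T _ _]mxE !complex_frame_col; ring.
Qed.

End Pfaffian.

Section Hermitian.
Context {R : realType} (G J : 'M[R]_4).
Implicit Types (v w : 'cV[R]_4).
Hypotheses (GT : G^T = G) (Gpos : forall v, v != 0 -> 0 < gdot G v v).
Hypotheses (JJ : J *m J = - 1%:M) (JG : J^T *m G *m J = G).

Lemma posdef_unit : G \in unitmx.
Proof.
rewrite -row_free_unit -kermx_eq0; apply: contraT => /rowV0Pn[v /sub_kermxP vG v0].
have : v^T != 0 by rewrite trmx_eq0.
by move=> /Gpos; rewrite /gdot trmxK vG mul0mx mxE ltxx.
Qed.
Let uG := posdef_unit.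

Lemma JGE : J^T *m G = - (G *m J).
Proof. by rewrite -[in RHS]JG -!mulmxA JJ !mulmxN mulmx1 opprK. Qed.

Lemma GJ_skew : (G *m J)^T = - (G *m J).
Proof. by rewrite trmx_mul GT JGE. Qed.

Lemma gdot_J v w : gdot G (J *m v) (J *m w) = gdot G v w.
Proof. by rewrite gdot_mull gdot_mulr JG. Qed.

Lemma gdot_J_self v : gdot G v (J *m v) = 0.
Proof.
have : gdot G v (J *m v) = - gdot G v (J *m v).
  rewrite {1}gdotC// gdot_mull JGE gdotNm gdot_mulr; lra.
lra.
Qed.

Lemma gdot_Jr v w : gdot G v (J *m w) = - gdot G w (J *m v).
Proof. by rewrite gdotC// gdot_mull JGE gdotNm gdot_mulr. Qed.

Lemma pfaffian_frame v w : pfaffian ((complex_frame J v w)^T *m (- (G *m J)) *m complex_frame J v w) =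
  gdot G v v * gdot G w w - gdot G v w ^+ 2 - gdot G v (J *m w) ^+ 2.
Proof.
have E x y : gdot (- (G *m J)) x y = - gdot G x (J *m y).
  by rewrite gdotNm gdot_mulr.
have EJ x y : gdot (- (G *m J)) x (J *m y) = gdot G x y.
  by rewrite E mulmxA JJ mulNmx mul1mx gdotNr opprK.
rewrite /pfaffian !frame_gram !(tnth_nth 0) /= !EJ !E gdot_J.
have -> : gdot G (J *m v) w = - gdot G v (J *m w) by rewrite gdot_mull gdot_mulr JGE gdotNm.
by ring.
Qed.

Lemma bessel v w : 0 <= gdot G v v * gdot G w w - gdot G v w ^+ 2 - gdot G v (J *m w) ^+ 2.
Proof.
have pos x : 0 <= gdot G x x.
  have [->|/Gpos/ltW//] := eqVneq x 0.
  by rewrite /gdot mulmx0 mxE.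
have [->|v0] := eqVneq v 0.
  by rewrite /gdot trmx0 !mul0mx mxE expr0n /= mul0r !subr0.
have a0 := Gpos v0.
set a := gdot G v v in a0 *; set b := gdot G v w; set c := gdot G v (J *m w).
have cE : gdot G (J *m v) w = - c by rewrite /c gdot_mull gdot_mulr JGE gdotNm.
have := pos (a *: w - b *: v + c *: (J *m v)).
rewrite !(gdotDl, gdotDr, gdotNl, gdotNr, gdotZl, gdotZr) gdot_J.
rewrite (gdotC w v)// (gdotC w (J *m v))// (gdotC (J *m v) v)// gdot_J_self cE -/a -/b.
move=> H; have {H} : 0 <= a * (a * gdot G w w - b ^+ 2 - c ^+ 2).
  apply: le_trans H _; rewrite le_eqVlt; apply/orP; left; apply/eqP; ring.
by rewrite pmulr_rge0.
Qed.

Lemma exists_unitary_frame : exists v w, [/\ v != 0, w != 0, gdot G v w = 0 &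
  gdot G v (J *m w) = 0].
Proof.
pose v : 'cV[R]_4 := delta_mx 0 0.
have v0 : v != 0.
  apply/eqP => /matrixP/(_ 0 0); rewrite !mxE /= => /eqP.
  by rewrite oner_eq0.
pose C : 'M[R]_(4, 1 + 1) := row_mx (G *m v) (G *m J *m v).
have : kermx C != 0.
  rewrite kermx_eq0 /row_free; apply/negP => /eqP rk.
  by have := rank_leq_col C; rewrite rk.
move=> /rowV0Pn[u /sub_kermxP uC u0].
have := uC; rewrite /C mul_mx_row -[RHS]row_mx0 => /eq_row_mx[u1 u2].
exists v, u^T; split => //; first by rewrite trmx_eq0.
  by rewrite gdotC// /gdot trmxK -mulmxA u1 mxE.
by rewrite gdot_Jr /gdot trmxK -!mulmxA mulmxA -mulmxA (mulmxA G) u2 mxE oppr0.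
Qed.

Lemma pfaffian_hermitian : 0 <= \det G /\ orient J * pfaffian (- (G *m J)) = Num.sqrt (\det G).
Proof.
have OmT : (- (G *m J))^T = - - (G *m J) by rewrite trmxN GJ_skew.
have P v w : \det (complex_frame J v w) * pfaffian (- (G *m J)) =
    gdot G v v * gdot G w w - gdot G v w ^+ 2 - gdot G v (J *m w) ^+ 2.
  by rewrite -pfaffian_congr// pfaffian_frame.
have [v [w [v0 w0 vw vJw]]] := exists_unitary_frame.
have P0 := P v w; rewrite vw vJw expr0n /= !subr0 in P0.
set F := complex_frame J v w in P0; set p := pfaffian _ in P0 P *.
set a := gdot G v v in P0; set b := gdot G w w in P0.
have a0 : 0 < a by apply: Gpos. have b0 : 0 < b by apply: Gpos.
have ab0 : 0 < a * b by rewrite mulr_gt0.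
have dG : \det F ^+ 2 * \det G = (a * b) ^+ 2.
  have -> : \det F ^+ 2 * \det G = \det (F^T *m G *m F).
    by rewrite !det_mulmx det_tr; ring.
  rewrite det4 !frame_gram !(tnth_nth 0) /= !gdot_J -/a -/b.
  rewrite (gdotC w v)// vw vJw !gdot_J_self.
  have JvJ x y : gdot G (J *m x) y = - gdot G x (J *m y) by rewrite gdot_mull gdot_mulr JGE gdotNm.
  rewrite !JvJ vJw !gdot_J_self (gdot_Jr w v) vJw; ring.
have F0 : \det F != 0.
  apply/eqP => F0; move: P0; rewrite F0 mul0r => /eqP.
  by rewrite eq_sym gt_eqF.
have dGE : \det G = p ^+ 2.
  apply: (mulfI (expf_neq0 2 F0)); rewrite dG -P0; ring.
rewrite dGE sqrtr_sqr; split; first exact: sqr_ge0.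
rewrite /orient; case: asboolP => [[v' [w' d0]]|nd].
  have := bessel v' w'; rewrite -P pmulr_rge0// => p0.
  by rewrite mul1r ger0_norm.
have : \det F < 0.
  rewrite lt_neqAle F0 leNgt; apply/negP => Fp; apply: nd.
  by exists v, w.
move=> Fn; have pn : p <= 0.
  have := ltW ab0; rewrite -P0 nmulr_rge0//.
by rewrite mulN1r ler0_norm.
Qed.

Lemma hodge_alpha : hodge G J (alpha_of G J) = alpha_of G J.
Proof.
have [det_ge0 pfE] := pfaffian_hermitian.
have dG0 : \det G != 0 by rewrite -unitfE -unitmxE.
have E : G *m alpha_of G J *m G = - (G *m J).
  by rewrite /alpha_of mulmxN mulNmx !mulmxA mulmxKV.
rewrite /hodge E -/(star (- (G *m J))).
have OmT : (- (G *m J))^T = - - (G *m J) by rewrite trmxN GJ_skew.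
have OmJ : (- (G *m J)) *m (alpha_of G J) = - 1%:M.
  by rewrite /alpha_of mulmxN mulNmx opprK !mulmxA -(mulmxA G) JJ mulmxN mulmx1 mulNmx mulmxV.
have -> : star (- (G *m J)) = (2 * pfaffian (- (G *m J))) *: alpha_of G J.
  have := congr1 (fun X => X *m alpha_of G J) (star_mul OmT).
  rewrite -mulmxA OmJ mulmxN mulmx1 mul_scalar_mx scaleNr => /eqP.
  by rewrite eqr_opp => /eqP.
have s0 : Num.sqrt (\det G) != 0.
  by rewrite sqrtr_eq0 -ltNge lt_neqAle eq_sym dG0 det_ge0.
rewrite scalerA -[RHS]scale1r; congr (_ *: _).
rewrite -[X in X / _]mulr1.
have -> : orient J * 1 / (2 * Num.sqrt (\det G)) * (2 * pfaffian (- (G *m J))) =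
  (orient J * pfaffian (- (G *m J))) / Num.sqrt (\det G) by field.
by rewrite pfE divff.
Qed.

End Hermitian.

(** * Charts *)

Lemma near_continuous (T U : topologicalType) (f : T -> U) x (P : U -> Prop) :
  {for x, continuous f} -> (\forall u \near f x, P u) -> \forall y \near x, P (f y).
Proof. by move=> cf Pf; exact: (cf _ Pf). Qed.

Section Atlas.
Context {R : realType} {V : normedModType R} (X : charted V).
Implicit Types (x y : X) (S N : set X) (z v w : V).

Definition is_atlas : Prop :=
  [/\ forall x, cdom x x,
      forall x y, cdom x y -> cinv x (cmap x y) = y,
      forall x y, open (cmap x @` (cdom x `&` cdom y)) &
      forall x y,
        smooth_on (cmap x @` (cdom x `&` cdom y)) (cmap y \o cinv x)].

Definition local_rep (W : Type) S x (f : X -> W) (F : V -> W) z : Prop :=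
  \forall z' \near z, forall y, S y -> cdom x y -> cmap x y = z' -> f y = F z'.

Definition overlap x y : set V := cmap x @` (cdom x `&` cdom y).
Definition trans x y : V -> V := cmap y \o cinv x.

Hypothesis atl : is_atlas.

Lemma cdom_refl x : cdom x x. Proof. by have [H _ _ _] := atl. Qed.
Lemma cmapK x y : cdom x y -> cinv x (cmap x y) = y. Proof. by have [_ H _ _] := atl; apply: H. Qed.
Lemma open_overlap x y : open (overlap x y). Proof. by have [_ _ H _] := atl; exact: H. Qed.
Lemma smooth_trans x y : smooth_on (overlap x y) (trans x y). Proof. by have [_ _ _ H] := atl; exact: H. Qed.

Lemma overlapP x y z : overlap x y z ->
  [/\ cdom x (cinv x z), cdom y (cinv x z) & cmap x (cinv x z) = z].
Proof. by move=> [w [xw yw] <-]; rewrite cmapK. Qed.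

Lemma overlap_cmap x y (w : X) : cdom x w -> cdom y w -> overlap x y (cmap x w).
Proof. by move=> *; exists w. Qed.

Lemma trans_cmap x y (w : X) : cdom x w -> trans x y (cmap x w) = cmap y w.
Proof. by move=> xw; rewrite /trans /= cmapK. Qed.

Lemma diff_trans x y z : overlap x y z -> differentiable (trans x y) z.
Proof. by apply: smooth_diff; exact: smooth_trans. Qed.

Lemma near_overlap x y z : overlap x y z -> \forall z' \near z, overlap x y z'.
Proof. by move=> o; apply: open_nbhs_nbhs; split => //; exact: open_overlap. Qed.

Lemma overlap_sym x y z : overlap x y z -> overlap y x (trans x y z).
Proof. by move=> [w [xw yw] <-]; rewrite trans_cmap//; exists w. Qed.

Lemma trans_trans x y (u : X) z : overlap x y z -> trans y u (trans x y z) = trans x u z.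
Proof. by move=> [w [xw yw] <-]; rewrite !trans_cmap. Qed.

Lemma near_trans_id x z : overlap x x z -> \forall z' \near z, trans x x z' = z'.
Proof.
move=> o; near=> z'; have : overlap x x z' by near: z'; exact: near_overlap.
by move=> [w [xw _] <-]; rewrite trans_cmap.
Unshelve. all: by end_near. Qed.

Lemma tchange_id x v : tchange x x v = v.
Proof.
have o : overlap x x (cmap x x) by apply: overlap_cmap; exact: cdom_refl.
have := near_eq_derive (W := V) v (near_trans_id o).
by move=> /= E; apply: (etrans E); rewrite derive_id.
Qed.

Lemma curve_diff S x v c : curve S x v c ->
  differentiable (cmap x \o c : R^o -> V) 0 /\ 'D_1 (cmap x \o c : R^o -> V) 0 = v.
Proof.
move=> [e e0 [c0 _ sc dc]]; split; last by rewrite -dc derive1E.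
by apply: smooth_diff sc _; rewrite /= normr0.
Qed.

Lemma near_ball0 (e : R) : 0 < e -> \forall s \near (0 : R^o), `|s| < e.
Proof.
move=> e0; near=> s; near: s; apply/nbhs_ballP; exists e => //= s.
by rewrite -ball_normE /ball_ /= sub0r normrN.
Unshelve. all: by end_near. Qed.

Lemma curve_derive_rep (W : normedModType R) S x v c (f : X -> W) (F : V -> W) :
  curve S x v c -> local_rep S x f F (cmap x x) -> differentiable F (cmap x x) ->
  derive1 (f \o c) 0 = 'D_v F (cmap x x).
Proof.
move=> Hc fF dF; have [dc <-] := curve_diff Hc.
have [e e0 [c0 Sc _ _]] := Hc.
have E0 : (cmap x \o c) (0 : R^o) = cmap x x by rewrite /= c0.
rewrite derive1E -E0 -derive_comp//; last by rewrite E0.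
apply: near_eq_derive.
have cc : {for (0 : R^o), continuous (cmap x \o c : R^o -> V)}.
  exact: differentiable_continuous.
have N1 : \forall s \near (0 : R^o), forall y, S y -> cdom x y ->
    cmap x y = (cmap x \o c) s -> f y = F ((cmap x \o c) s).
  apply: (near_continuous (P := fun z => forall y, S y -> cdom x y ->
    cmap x y = z -> f y = F z) cc); rewrite E0; exact: fF.
have N2 := near_ball0 e0.
near=> s; have [Ss ds] : S (c s) /\ cdom x (c s) by apply: Sc; near: s.
have H : forall y, S y -> cdom x y ->
    cmap x y = (cmap x \o c) s -> f y = F ((cmap x \o c) s) by near: s.
exact: H.
Unshelve. all: by end_near. Qed.

Lemma dv_rep S x v (f : X -> R) (F : V -> R^o) : tangent S x v ->
  local_rep S x f F (cmap x x) -> differentiable F (cmap x x) ->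
  dv S f x v = 'D_v F (cmap x x).
Proof.
move=> [c Hc] fF dF; rewrite /dv.
apply: get_unique => [|d [c' Hc' ->]].
  by exists c => //; rewrite (curve_derive_rep (W := R^o) Hc fF dF).
exact: (curve_derive_rep (W := R^o) Hc' fF dF).
Qed.

Lemma dv_ext S x v (f f' : X -> R) : (forall y, S y -> f y = f' y) ->
  dv S f x v = dv S f' x v.
Proof.
move=> ff'; rewrite /dv; congr (get _); apply/seteqP.
have E c : curve S x v c -> derive1 (f \o c : R^o -> R^o) 0 = derive1 (f' \o c : R^o -> R^o) 0.
  move=> [e e0 [_ Sc _ _]]; rewrite !derive1E; apply: near_eq_derive.
  near=> s; apply: ff'; apply: (Sc s _).1; near: s; exact: near_ball0.
by split=> d [c Hc ->]; exists c => //; rewrite E.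
Unshelve. all: by end_near. Qed.

Lemma dv_zero S N x v (f : X -> R) (F : V -> R^o) : N `<=` S -> tangent N x v ->
  local_rep S x f F (cmap x x) -> differentiable F (cmap x x) ->
  (forall y, N y -> f y = 0) -> dv S f x v = 0.
Proof.
move=> NS [c Hc] fF dF f0.
have HcS : curve S x v c.
  move: Hc => [e e0 [c0 Nc sc dc]]; exists e => //; split => // s /Nc[/NS].
  by split.
rewrite (@dv_rep _ _ _ _ F)//; last by exists c.
rewrite -(curve_derive_rep (W := R^o) HcS fF dF).
rewrite -[RHS](derive1_cst (V := R^o) 0 0) !derive1E; apply: near_eq_derive.
move: Hc => [e e0 [_ Nc _ _]].
near=> s; apply: f0; apply: (Nc s _).1; near: s; exact: near_ball0.
Unshelve. all: by end_near. Qed.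

Lemma rep_trans (W : Type) S x y (f : X -> W) (F : V -> W) : cdom x y ->
  local_rep S x f F (cmap x y) -> local_rep S y f (F \o trans y x) (cmap y y).
Proof.
move=> xy fF; have yy := cdom_refl y.
have o : overlap y x (cmap y y) by exact: overlap_cmap.
have ct : {for cmap y y, continuous (trans y x)}.
  by apply: differentiable_continuous; exact: diff_trans.
have N1 : \forall z' \near cmap y y, forall u, S u -> cdom x u ->
    cmap x u = trans y x z' -> f u = F (trans y x z').
  apply: (near_continuous (P := fun z => forall u, S u -> cdom x u ->
    cmap x u = z -> f u = F z) ct); rewrite trans_cmap//; exact: fF.
near=> z' => u Su yu uz.
have [d1 d2 d3] : [/\ cdom y (cinv y z'), cdom x (cinv y z') & cmap y (cinv y z') = z'].
  by apply: overlapP; near: z'; exact: near_overlap.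
have uE : u = cinv y z' by rewrite -uz cmapK.
have H : forall u, S u -> cdom x u ->
    cmap x u = trans y x z' -> f u = F (trans y x z') by near: z'.
by apply: H => //; rewrite uE.
Unshelve. all: by end_near. Qed.

Lemma dv_chart S x y v (f : X -> R) (F : V -> R^o) : tangent S y v -> cdom x y ->
  local_rep S x f F (cmap x y) -> differentiable F (cmap x y) ->
  dv S f y v = 'D_(tchange y x v) F (cmap x y).
Proof.
move=> tv xy fF dF; have yy := cdom_refl y.
have o : overlap y x (cmap y y) by exact: overlap_cmap.
have dt := diff_trans o.
have dF' : differentiable F (trans y x (cmap y y)) by rewrite trans_cmap.
rewrite (dv_rep tv (rep_trans xy fF)); last exact: differentiable_comp.
by apply: (etrans (derive_comp v dt dF')); rewrite trans_cmap.
Qed.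

Lemma smooth_along_chart (W : normedModType R) S x (L : {linear V -> W}) : continuous L ->
  smooth_along (S `&` cdom x) (fun y => L (cmap x y)).
Proof.
move=> cL y [Sy xy]; exists (overlap y x), (fun z => L (trans y x z)); split.
- exact: open_overlap.
- by apply: overlap_cmap => //; exact: cdom_refl.
- by move=> k; apply: Ck_lincomp => //; [exact: open_overlap|exact: smooth_trans].
- by move=> u _ yu _; rewrite trans_cmap.
Qed.

Lemma smooth_at_rep (W : normedModType R) S x (f : X -> W) : smooth_at S x f ->
  exists (O : set V) (F : V -> W), [/\ open O, O (cmap x x), smooth_on O F &
    local_rep S x f F (cmap x x)].
Proof.
move=> [U [F [oO Ox sF fF]]]; exists U, F; split => //.
near=> z => y Sy xy yz; rewrite -yz; apply: fF => //; rewrite yz.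
by near: z; exact: open_nbhs_nbhs.
Unshelve. all: by end_near. Qed.

Lemma rep_val (W : Type) S x y (f : X -> W) (F : V -> W) : S y -> cdom x y ->
  local_rep S x f F (cmap x y) -> F (cmap x y) = f y.
Proof. by move=> Sy xy /nbhs_singleton /(_ y Sy xy erefl). Qed.

(* The torsion-free identity tested on the coordinate functions at x. *)
Lemma torsion_chart S (h : X -> V -> V -> R) D xi eta (Xi Eta : V -> V) x :
  fin_dim V -> levi_civita S h D -> vfield S xi -> vfield S eta -> S x ->
  local_rep S x (fun y => tchange y x (xi y)) Xi (cmap x x) ->
  differentiable Xi (cmap x x) ->
  local_rep S x (fun y => tchange y x (eta y)) Eta (cmap x x) ->
  differentiable Eta (cmap x x) ->
  D x (xi x) eta - D x (eta x) xi = 'D_(xi x) Eta (cmap x x) - 'D_(eta x) Xi (cmap x x).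
Proof.
move=> fV [[Dvf _ _ _] [Dtor _]] vxi veta Sx rX dX rE dE.
have xx := cdom_refl x.
apply: (fin_dim_eq fV) => L cL; rewrite !linearB /=.
pose f y := L (cmap x y) : R.
have rL y S' : local_rep S' x f L (cmap x y).
  by apply: nearW => z u _ _ <-.
have fE v : tangent S x v -> dv S f x v = L v.
  move=> tv; rewrite (dv_rep tv (rL x S)); last exact: linear_differentiable.
  by rewrite derive_lin.
have sf : smooth_along (S `&` cdom x) (f : X -> R^o) by apply: smooth_along_chart.
have := Dtor x f xi eta Sx vxi veta sf.
rewrite fE; last exact: (Dvf _ _ vxi veta x Sx).1.
rewrite fE; last exact: (Dvf _ _ veta vxi x Sx).1.
have second zeta (Zeta : V -> V) v : vfield S zeta -> tangent S x v ->
    local_rep S x (fun y => tchange y x (zeta y)) Zeta (cmap x x) ->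
    differentiable Zeta (cmap x x) ->
    dv S (fun y => dv S f y (zeta y)) x v = L ('D_v Zeta (cmap x x)).
  move=> vz tv rZ dZ; rewrite (@dv_rep _ _ _ _ (L \o Zeta))//.
  - by rewrite derive_lincomp.
  - apply: filterS rZ => z Hz y Sy xy yz.
    rewrite (@dv_chart _ x _ _ _ L) => //; last 2 first.
    + exact: (vz y Sy).1.
    + exact: linear_differentiable.
    by rewrite derive_lin// (Hz y).
  - exact: differentiable_lincomp.
have -> := second eta Eta (xi x) veta (vxi x Sx).1 rE dE.
have -> := second xi Xi (eta x) vxi (veta x Sx).1 rX dX.
by [].
Qed.

End Atlas.

Section PairDerivative.
Context {R : realType}.
Implicit Types (V W Z : normedModType R).

Lemma differentiable_fst V W (m : V * W) : differentiable (fst : V * W -> V) m.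
Proof.
have lin : linear (fst : V * W -> V) by [].
have [L LE] := linear_pack lin; rewrite -LE; apply: linear_differentiable.
by rewrite LE => x; exact: cvg_fst.
Qed.

Lemma differentiable_snd V W (m : V * W) : differentiable (snd : V * W -> W) m.
Proof.
have lin : linear (snd : V * W -> W) by [].
have [L LE] := linear_pack lin; rewrite -LE; apply: linear_differentiable.
by rewrite LE => x; exact: cvg_snd.
Qed.

Lemma derive_fst V W (m u : V * W) : 'D_u (fst : V * W -> V) m = u.1.
Proof.
have lin : linear (fst : V * W -> V) by [].
have [L LE] := linear_pack lin; rewrite -LE derive_lin//.
by rewrite LE => x; exact: cvg_fst.
Qed.

Lemma derive_snd V W (m u : V * W) : 'D_u (snd : V * W -> W) m = u.2.
Proof.
have lin : linear (snd : V * W -> W) by [].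
have [L LE] := linear_pack lin; rewrite -LE derive_lin//.
by rewrite LE => x; exact: cvg_snd.
Qed.

Lemma is_derive_fst V W Z (f : V -> Z) (m u : V * W) : differentiable f m.1 ->
  is_derive m u (fun m => f m.1) ('D_(u.1) f m.1).
Proof.
move=> df; have d1 := differentiable_fst m; split.
  by apply: diff_derivable; exact: (differentiable_comp d1 df).
by apply: (etrans (derive_comp u d1 df)); rewrite derive_fst.
Qed.

Lemma is_derive_snd V W (m u : V * W) : is_derive m u snd u.2.
Proof.
split; last exact: derive_snd.
by apply: diff_derivable; exact: differentiable_snd.
Qed.

Lemma derive_pair V W Z (f : V -> W) (g : V -> Z) x v :
  differentiable f x -> differentiable g x ->
  'D_v (fun y => (f y, g y)) x = ('D_v f x, 'D_v g x).
Proof.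
move=> df dg; rewrite deriveE; last exact: differentiable_pair.
by rewrite diff_pair// -(deriveE v df) -(deriveE v dg).
Qed.

Lemma Ck_fst_comp V W Z k (U : set V) (f : V -> Z) :
  fin_dim V -> fin_dim Z -> open U -> Ck k U f ->
  Ck k [set m : V * W | U m.1] (fun m => f m.1).
Proof.
move=> fV fZ oU cf.
have o' : open [set m : V * W | U m.1].
  by apply: (open_comp (f := fst)) => // m _; exact: cvg_fst.
apply: (Ck_comp (U' := U)) => //.
exact: (Ck_fst (f := id) o' (Ck_id _ _)).
Qed.

End PairDerivative.

Section Base.
Context {R : realType} (M : charted 'cV[R]_4).
Hypothesis atl : is_atlas M.
Implicit Types (p q r : M) (z v : 'cV[R]_4).

Lemma jac_trans_comp p q r z : overlap p q z -> cdom r (cinv p z) ->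
  jac (trans p r) z = jac (trans q r) (trans p q z) *m jac (trans p q) z.
Proof.
move=> o rz; have [pz qz zE] := overlapP atl o.
have opr : overlap p r z by exists (cinv p z).
have oqr : overlap q r (trans p q z) by exists (cinv p z).
apply: (etrans _ (jac_comp (diff_trans atl o) (diff_trans atl oqr))).
apply: near_eq_jac; near=> z'.
have o' : overlap p q z' by near: z'; exact: (near_overlap atl o).
by rewrite /= (trans_trans atl).
Unshelve. all: by end_near. Qed.

Lemma jac_trans_id p z : overlap p p z -> jac (trans p p) z = 1%:M.
Proof.
move=> o; rewrite -(jac_id z); apply: near_eq_jac.
exact: (near_trans_id atl o).
Qed.

Lemma jac_transK p q z : overlap p q z ->
  jac (trans q p) (trans p q z) *m jac (trans p q) z = 1%:M.
Proof.
move=> o; have [pz qz zE] := overlapP atl o.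
rewrite -(jac_trans_comp (r := p))// jac_trans_id//.
by exists (cinv p z).
Qed.

Lemma jac_trans_unit p q z : overlap p q z -> jac (trans p q) z \in unitmx.
Proof. by move=> /jac_transK /mulmx1_unit []. Qed.

Lemma smooth_jac_trans p q : smooth_on (overlap p q) (jac (trans p q)).
Proof. apply: smooth_jac; [exact: open_overlap|exact: smooth_trans]. Qed.

Lemma overlap_center p q : cdom q p -> overlap p q (cmap p p).
Proof. by move=> qp; apply: overlap_cmap => //; exact: cdom_refl. Qed.

Notation TM := (tensor2 M).
Implicit Types (e f : TM).

Lemma tensor_cmapE e f : cmap e f =
  (cmap e.1 f.1, jac (trans f.1 e.1) (cmap f.1 f.1) *m f.2 *m
     (jac (trans f.1 e.1) (cmap f.1 f.1))^T).
Proof. by []. Qed.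

Lemma tensor_cmap_fiber e f : e.1 = f.1 -> cmap e f = (cmap f.1 f.1, f.2).
Proof.
move=> ef; rewrite tensor_cmapE ef jac_trans_id; last exact/overlap_center/cdom_refl.
by rewrite trmx1 mulmx1 mul1mx.
Qed.

Lemma tensor_cmapK e f : cdom e f -> cinv e (cmap e f) = f.
Proof.
move=> ef; rewrite /= (cmapK atl ef).
have H : overlap f.1 e.1 (cmap f.1 f.1) by exact: overlap_center.
have K := jac_transK H; rewrite (trans_cmap atl _ (cdom_refl atl _)) in K.
rewrite -[X in jac X (cmap e.1 f.1)]/(trans e.1 f.1).
rewrite -[X in jac X (cmap f.1 f.1)]/(trans f.1 e.1).
move: K; set A := jac _ _; set B := jac _ _ => K.
have KT : B^T *m A^T = 1%:M by rewrite -trmx_mul K trmx1.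
by rewrite !mulmxA K mul1mx -mulmxA KT mulmx1; case: f {ef H A B K KT}.
Qed.

Lemma tensor_trans e f (m : 'cV[R]_4 * 'M[R]_4) : overlap e.1 f.1 m.1 ->
  trans e f m = (trans e.1 f.1 m.1, jac (trans e.1 f.1) m.1 *m m.2 *m
     (jac (trans e.1 f.1) m.1)^T).
Proof.
move=> o; have [d1 d2 zE] := overlapP atl o.
set q := cinv e.1 m.1.
have oq : overlap e.1 q m.1 by exists q => //; split => //; exact: cdom_refl.
rewrite (jac_trans_comp oq d2) trmx_mul.
pose T1 := jac (trans e.1 q) m.1; pose T2 := jac (trans q f.1) (cmap q q).
have -> : trans e f m = (cmap f.1 q, T2 *m (T1 *m m.2 *m T1^T) *m T2^T) by [].
by rewrite -/T1 !mulmxA.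
Qed.

Lemma tensor_overlap e f : overlap e f = [set m | overlap e.1 f.1 m.1].
Proof.
apply/seteqP; split=> [m [u [eu fu] <-]|m o]; first by exists u.1.
have [d1 d2 zE] := overlapP atl o.
have oee : overlap e.1 e.1 m.1 by exists (cinv e.1 m.1).
exists (cinv e m) => //.
apply: (etrans (tensor_trans (e := e) (f := e) oee)).
rewrite jac_trans_id// trmx1 mul1mx mulmx1.
have -> : trans e.1 e.1 m.1 = m.1 by [].
by case: (m).
Qed.

Lemma tensor_atlas : is_atlas TM.
Proof.
have oo (e f : TM) : open [set m : 'cV[R]_4 * 'M[R]_4 | overlap e.1 f.1 m.1].
  apply: (open_comp (f := fst)); first by move=> m _; exact: cvg_fst.
  exact: open_overlap.
split.
- by move=> e; exact: (cdom_refl atl e.1).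
- exact: tensor_cmapK.
- by move=> e f; rewrite -/(overlap e f) tensor_overlap; exact: oo.
move=> e f; rewrite -/(overlap e f) tensor_overlap => k.
apply: (Ck_eq (oo e f) (f := fun m => (trans e.1 f.1 m.1,
    jac (trans e.1 f.1) m.1 *m m.2 *m (jac (trans e.1 f.1) m.1)^T))).
  by move=> m o; rewrite -[RHS]/(trans e f m) tensor_trans.
have cj : Ck k [set m : 'cV[R]_4 * 'M[R]_4 | overlap e.1 f.1 m.1]
    (fun m => jac (trans e.1 f.1) m.1).
  apply: Ck_fst_comp; [exact: fin_dim_mx|exact: fin_dim_mx|exact: open_overlap|].
  exact: smooth_jac_trans.
apply: Ck_pair => //.
  apply: Ck_fst_comp; [exact: fin_dim_mx|exact: fin_dim_mx|exact: open_overlap|].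
  exact: smooth_trans.
apply: Ck_mul => //; last exact: Ck_tr.
apply: Ck_mul => //.
exact: (Ck_snd (f := id) (oo e f) (Ck_id _ _)).
Qed.

Lemma tensor_tchange e f (u : 'cV[R]_4 * 'M[R]_4) : cdom f e ->
  let T := jac (trans e.1 f.1) in let z := cmap e.1 e.1 in
  tchange e f u = (T z *m u.1,
    'D_(u.1) T z *m e.2 *m (T z)^T + T z *m u.2 *m (T z)^T
    + T z *m e.2 *m ('D_(u.1) T z)^T).
Proof.
move=> fe T z; have o : overlap e.1 f.1 z by exact: overlap_center.
have dT : differentiable T z by apply: smooth_diff (@smooth_jac_trans _ _) o.
have ce : cmap e e = (z, e.2) by rewrite tensor_cmap_fiber.
rewrite /tchange -/(trans e f) ce.
have dtr : differentiable (fun m : 'cV[R]_4 * 'M[R]_4 => trans e.1 f.1 m.1) (z, e.2).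
  apply: (differentiable_comp (f := fst)); first exact: differentiable_fst.
  exact: (diff_trans atl o).
pose Q (m : 'cV[R]_4 * 'M[R]_4) := T m.1 *m m.2 *m (T m.1)^T.
have near_o : \forall m \near (z, e.2), overlap e.1 f.1 m.1.
  apply: (near_continuous (P := overlap e.1 f.1) (f := fst)); first exact: cvg_fst.
  exact: (near_overlap atl o).
have dQ : differentiable Q (z, e.2).
  have : differentiable (snd \o trans e f) (z, e.2).
    apply: differentiable_comp; last exact: differentiable_snd.
    by apply: (diff_trans tensor_atlas); rewrite tensor_overlap.
  apply: near_eq_diff; apply: filterS near_o => m om.
  exact: (congr1 snd (tensor_trans (e := e) (f := f) om)).
have E : 'D_u (trans e f) (z, e.2) =
    'D_u (fun m : 'cV[R]_4 * 'M[R]_4 => (trans e.1 f.1 m.1, Q m)) (z, e.2).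
  by apply: near_eq_derive; apply: filterS near_o => m om; rewrite tensor_trans.
apply: (etrans E); apply: (etrans (derive_pair _ dtr dQ)); congr pair.
  have [_ E1] := is_derive_fst (W := 'M[R]_4) (m := (z, e.2)) u (diff_trans atl o).
  by apply: (etrans E1); exact: (jacE u.1 (diff_trans atl o)).
have i1 := is_derive_fst (W := 'M[R]_4) (m := (z, e.2)) u dT.
have i2 := is_derive_mul (is_derive_mul i1 (is_derive_snd (z, e.2) u)) (is_derive_tr i1).
by have [_ E2] := i2; apply: (etrans E2); rewrite /= mulmxDl.
Qed.

End Base.

(** * The metric in charts *)

Section MetricInCharts.
Context {R : realType} (M : charted 'cV[R]_4).
Hypothesis atl : is_atlas M.
Variables g J : M -> 'M[R]_4.
Hypothesis ah : almost_hermitian g J.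
Implicit Types (p q r : M) (z v w : 'cV[R]_4).

Lemma g_sym p : (g p)^T = g p. Proof. by have [[H _ _] _] := ah. Qed.
Lemma g_pos p v : v != 0 -> 0 < gdot (g p) v v.
Proof. by have [[_ H _] _] := ah; apply: H. Qed.
Lemma J_sq p : J p *m J p = - 1%:M. Proof. by have [_ [H _ _]] := ah. Qed.
Lemma J_isom p : (J p)^T *m g p *m J p = g p.
Proof.
have [_ [_ H _]] := ah; apply: gdot_inj => v w; rewrite -(H p v w).
by rewrite gdot_mull gdot_mulr.
Qed.
Lemma g_unit p : g p \in unitmx.
Proof. by apply: posdef_unit => v; exact: g_pos. Qed.

Lemma smooth_gloc p : smooth_on (overlap p p) (gloc g p).
Proof. by rewrite /overlap setIid; have [[_ _ H] _] := ah. Qed.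
Lemma smooth_Jloc p : smooth_on (overlap p p) (Jloc J p).
Proof. by rewrite /overlap setIid; have [_ [_ _ H]] := ah. Qed.

Lemma overlapl p q z : overlap p q z -> overlap p p z.
Proof. by move=> [w [pw _] <-]; exists w. Qed.

Lemma overlap_self p : overlap p p (cmap p p).
Proof. by apply: overlap_center => //; exact: cdom_refl. Qed.

Lemma gloc_trans p q z : overlap p q z -> gloc g p z =
  (jac (trans p q) z)^T *m gloc g q (trans p q z) *m jac (trans p q) z.
Proof.
move=> o; have [pz qz zE] := overlapP atl o.
have E : cinv q (trans p q z) = cinv p z by exact: (cmapK atl qz).
rewrite /gloc E -[jac _ z]/(jac (trans p (cinv p z)) z) (jac_trans_comp atl o); last exact: (cdom_refl atl).
by rewrite trmx_mul !mulmxA.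
Qed.

Lemma Jloc_trans p q z : overlap p q z -> Jloc J p z =
  invmx (jac (trans p q) z) *m Jloc J q (trans p q z) *m jac (trans p q) z.
Proof.
move=> o; have [pz qz zE] := overlapP atl o.
have E : cinv q (trans p q z) = cinv p z by exact: (cmapK atl qz).
have rr := cdom_refl atl (cinv p z).
rewrite /Jloc E -[jac _ z]/(jac (trans p (cinv p z)) z) (jac_trans_comp atl o rr).
rewrite -[jac _ (trans p q z)]/(jac (trans q (cinv p z)) (trans p q z)).
have u1 : jac (trans p q) z \in unitmx by apply: jac_trans_unit.
have u2 : jac (trans q (cinv p z)) (trans p q z) \in unitmx.
  by apply: jac_trans_unit => //; exists (cinv p z).
have invM (A B : 'M[R]_4) : A \in unitmx -> B \in unitmx ->
    invmx (A *m B) = invmx B *m invmx A.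
  move=> uA uB; have uAB : A *m B \in unitmx by rewrite unitmx_mul uA.
  apply: (can_inj (mulKmx uAB)).
  by rewrite mulmxV// mulmxA -(mulmxA A) mulmxV// mulmx1 mulmxV.
move: (jac (trans q _) _) (jac (trans p q) z) u1 u2 => B A uA uB.
by rewrite (invM _ _ uB uA) !mulmxA.
Qed.

Lemma gloc_center p : gloc g p (cmap p p) = g p.
Proof.
rewrite /gloc (cmapK atl (cdom_refl atl p)).
have -> : jac (cmap p \o cinv p) (cmap p p) = 1%:M.
  by exact: (jac_trans_id atl (overlap_self p)).
by rewrite trmx1 mul1mx mulmx1.
Qed.

Lemma Jloc_center p : Jloc J p (cmap p p) = J p.
Proof.
rewrite /Jloc (cmapK atl (cdom_refl atl p)).
have -> : jac (cmap p \o cinv p) (cmap p p) = 1%:M.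
  by exact: (jac_trans_id atl (overlap_self p)).
by rewrite invmx1 mul1mx mulmx1.
Qed.

Lemma chart_frame p z : overlap p p z -> exists q (T : 'M[R]_4),
  [/\ T \in unitmx, gloc g p z = T^T *m g q *m T & Jloc J p z = invmx T *m J q *m T].
Proof.
move=> o; have [pz _ zE] := overlapP atl o.
exists (cinv p z), (jac (trans p (cinv p z)) z); split => //.
apply: (jac_trans_unit atl); exists (cinv p z) => //; split=> //; exact: cdom_refl.
Qed.

Lemma gloc_sym p z : (gloc g p z)^T = gloc g p z.
Proof. by rewrite /gloc !trmx_mul trmxK g_sym mulmxA. Qed.

Lemma gloc_unit p z : overlap p p z -> gloc g p z \in unitmx.
Proof.
by move=> /chart_frame[q [T [uT -> _]]]; rewrite !unitmx_mul unitmx_tr uT g_unit.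
Qed.

Lemma Jloc_sq p z : overlap p p z -> Jloc J p z *m Jloc J p z = - 1%:M.
Proof.
move=> /chart_frame[q [T [uT _ ->]]].
rewrite !mulmxA mulmxK// -(mulmxA (invmx T)) J_sq mulmxN mulmx1 mulNmx.
by rewrite mulVmx.
Qed.

Lemma gJloc_skew p z : overlap p p z ->
  (gloc g p z *m Jloc J p z)^T = - (gloc g p z *m Jloc J p z).
Proof.
move=> /chart_frame[q [T [uT -> ->]]]; rewrite !mulmxA mulmxK//.
have S := GJ_skew (g_sym q) (J_sq q) (J_isom q).
rewrite -(mulmxA T^T) trmx_mul [(T^T *m _)^T]trmx_mul trmxK S.
by rewrite mulNmx mulmxN mulmxA.
Qed.

Definition dgloc p z (i : 'I_4) : 'M[R]_4 := 'D_(delta_mx i 0 : 'cV[R]_4) (gloc g p) z.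
Definition dJloc p z (i : 'I_4) : 'M[R]_4 := 'D_(delta_mx i 0 : 'cV[R]_4) (Jloc J p) z.
Definition conn_loc p z v : 'M[R]_4 := levi_civita_mx (gloc g p z) (dgloc p z) v.

Lemma diff_gloc p z : overlap p p z -> differentiable (gloc g p) z.
Proof. by apply: smooth_diff; exact: smooth_gloc. Qed.
Lemma diff_Jloc p z : overlap p p z -> differentiable (Jloc J p) z.
Proof. by apply: smooth_diff; exact: smooth_Jloc. Qed.

Lemma is_derive_gloc p z v : overlap p p z -> is_derive z v (gloc g p) (dir (dgloc p z) v).
Proof.
move=> o; have d := diff_gloc o; split; first exact: diff_derivable.
by apply/esym; exact: dir_derive.
Qed.

Lemma is_derive_Jloc p z v : overlap p p z -> is_derive z v (Jloc J p) (dir (dJloc p z) v).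
Proof.
move=> o; have d := diff_Jloc o; split; first exact: diff_derivable.
by apply/esym; exact: dir_derive.
Qed.

Lemma is_derive_unique (V W : normedModType R) (f f' : V -> W) (x u : V) (a b : W) :
  (\forall y \near x, f y = f' y) -> is_derive x u f a -> is_derive x u f' b -> a = b.
Proof.
by move=> ff [_ <-] [_ <-]; exact: near_eq_derive.
Qed.

Lemma dgloc_sym p z i : overlap p p z -> (dgloc p z i)^T = dgloc p z i.
Proof.
move=> o; have := is_derive_gloc (delta_mx i 0) o; rewrite dir_delta => d.
apply: is_derive_unique (is_derive_tr d) d.
by near=> y; exact: gloc_sym.
Unshelve. all: by end_near. Qed.

Lemma conn_loc_metric p z v : overlap p p z -> dir (dgloc p z) v =
  (conn_loc p z v)^T *m gloc g p z + gloc g p z *m conn_loc p z v.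
Proof.
move=> o; apply: levi_civita_mx_metric; [exact: gloc_sym|exact: gloc_unit|].
by move=> i; exact: dgloc_sym.
Qed.

Lemma conn_loc_sym p z v w : overlap p p z -> conn_loc p z v *m w = conn_loc p z w *m v.
Proof. by move=> o; apply: levi_civita_mx_sym => i; exact: dgloc_sym. Qed.

Lemma conn_mxE p v : conn_mx g p v = conn_loc p (cmap p p) v.
Proof.
by apply/matrixP => i j; rewrite !mxE; apply: eq_bigr => k _; rewrite gloc_center.
Qed.

Lemma pullback_metric (T G D Gm Ga : 'M[R]_4) : T *m Ga = D + Gm *m T ->
  (D^T *m G + T^T *m (Gm^T *m G + G *m Gm)) *m T + T^T *m G *m D =
  Ga^T *m (T^T *m G *m T) + T^T *m G *m T *m Ga.
Proof.
move=> E; rewrite -(mulmxA _ T Ga) E.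
have -> : Ga^T *m (T^T *m G *m T) = (T *m Ga)^T *m (G *m T) by rewrite trmx_mul !mulmxA.
by rewrite E trmxD trmx_mul ?(mulmxDr, mulmxDl) !mulmxA; mx_ring.
Qed.

Lemma conn_loc_change p q z v : overlap q p z ->
  jac (trans q p) z *m conn_loc q z v =
  'D_v (jac (trans q p)) z + conn_loc p (trans q p z) (jac (trans q p) z *m v) *m jac (trans q p) z.
Proof.
move=> o; set T := jac (trans q p).
have oq : overlap q q z by exact: overlapl o.
have op : overlap p p (trans q p z) by exact: overlapl (overlap_sym atl o).
have uT : T z \in unitmx by exact: jac_trans_unit.
have dT : differentiable T z by apply: smooth_diff (smooth_jac_trans atl _ _) o.
set G := gloc g p (trans q p z).
pose Gm u := conn_loc p (trans q p z) u.
pose Ga u := invmx (T z) *m ('D_u T z + Gm (T z *m u) *m T z).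
have TGa u : T z *m Ga u = 'D_u T z + Gm (T z *m u) *m T z by rewrite mulKVmx.
suff H : Ga v = conn_loc q z v by rewrite -H TGa.
apply: levi_civita_mx_unique; [exact: gloc_sym|exact: gloc_unit|by move=> i; exact: dgloc_sym| |] => u.
  move=> w; rewrite /Ga -!mulmxA; congr (_ *m _); rewrite !mulmxDl -!mulmxA.
  congr (_ + _); last exact: conn_loc_sym.
  exact: (derive_jac_sym u w (open_overlap atl q p) (smooth_trans atl q p) o).
have E : \forall y \near z, gloc g q y = (T y)^T *m gloc g p (trans q p y) *m T y.
  apply: filterS (near_overlap atl o) => y oy; exact: gloc_trans.
have iT : is_derive z u T ('D_u T z) by apply/derivableP/diff_derivable.
have ig : is_derive z u (gloc g p \o trans q p) (dir (dgloc p (trans q p z)) (T z *m u)).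
  have dt := diff_trans atl o; have dg := diff_gloc op; split.
    by apply: diff_derivable; exact: differentiable_comp.
  apply: (etrans (derive_comp u dt dg)); rewrite (jacE u dt).
  by apply/esym; exact: dir_derive.
have := is_derive_mul (is_derive_mul (is_derive_tr iT) ig) iT.
move=> /(is_derive_unique E (is_derive_gloc u oq)) ->.
rewrite (conn_loc_metric _ op) -/(Gm _) -/G (gloc_trans o) -/T /=.
exact: pullback_metric (TGa u).
Qed.

End MetricInCharts.

Section BivectorMetric.
Context {R : realType}.
Implicit Types (G J A B C S T : 'M[R]_4).

Lemma bivecC G A B : G^T = G -> bivec_metric G A B = bivec_metric G B A.
Proof.
move=> GT; rewrite /bivec_metric -[in LHS]mxtrace_tr !trmx_mul trmxK GT.
by rewrite mxtrace_mulC !mulmxA.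
Qed.
Lemma bivecDl G A B C : bivec_metric G (A + B) C = bivec_metric G A C + bivec_metric G B C.
Proof. by rewrite /bivec_metric trmxD !mulmxDl mxtraceD mulrDr. Qed.
Lemma bivecDr G A B C : bivec_metric G C (A + B) = bivec_metric G C A + bivec_metric G C B.
Proof. by rewrite /bivec_metric mulmxDr !mulmxDl mxtraceD mulrDr. Qed.
Lemma bivecZl G a A C : bivec_metric G (a *: A) C = a * bivec_metric G A C.
Proof. by rewrite /bivec_metric trmxZ -!scalemxAl mxtraceZ mulrCA. Qed.
Lemma bivecZr G a A C : bivec_metric G C (a *: A) = a * bivec_metric G C A.
Proof. by rewrite /bivec_metric -scalemxAr -!scalemxAl mxtraceZ mulrCA. Qed.
Lemma bivecNl G A C : bivec_metric G (- A) C = - bivec_metric G A C.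
Proof. by rewrite -scaleN1r bivecZl mulN1r. Qed.
Lemma bivecNr G A C : bivec_metric G C (- A) = - bivec_metric G C A.
Proof. by rewrite -scaleN1r bivecZr mulN1r. Qed.
Lemma bivec0r G C : bivec_metric G C 0 = 0.
Proof. by rewrite -(scale0r 0) bivecZr mul0r. Qed.

Lemma bivec_nat G S T A B : S *m T = 1%:M ->
  bivec_metric (S^T *m G *m S) (T *m A *m T^T) (T *m B *m T^T) = bivec_metric G A B.
Proof.
move=> ST; have ST' : T^T *m S^T = 1%:M by rewrite -trmx_mul ST trmx1.
rewrite /bivec_metric !trmx_mul trmxK; congr (_ * _).
rewrite (_ : T *m (A^T *m T^T) *m (S^T *m G *m S) *m (T *m B *m T^T) *m (S^T *m G *m S) =
  T *m (A^T *m (T^T *m S^T) *m G *m (S *m T) *m B *m (T^T *m S^T) *m G) *m S); last first.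
  by rewrite !mulmxA.
by rewrite ST ST' !mulmx1 -(mulmxA T) mxtrace_mulC -(mulmxA _ S) ST mulmx1.
Qed.

Lemma gdot_nat G S T (v w : 'cV[R]_4) : S *m T = 1%:M ->
  gdot (S^T *m G *m S) (T *m v) (T *m w) = gdot G v w.
Proof.
move=> ST; rewrite -(gdot_mulr _ S) -gdot_mull; congr gdot.
  by rewrite mulmxA ST mul1mx.
by rewrite mulmxA ST mul1mx.
Qed.

Lemma bivec_alphaE G J A : G \in unitmx ->
  bivec_metric G A (alpha_of G J) = - (4^-1 * \tr (A^T *m (G *m J))).
Proof.
move=> uG; rewrite /bivec_metric /alpha_of mulmxN mulNmx !mulmxA mulmxKV//.
by rewrite -mulmxA linearN /= mulrN.
Qed.

Lemma alpha_nat G J S T : S *m T = 1%:M -> G \in unitmx ->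
  alpha_of (S^T *m G *m S) (T *m J *m S) = T *m alpha_of G J *m T^T.
Proof.
move=> ST uG; have TS := mulmx1C ST.
have ST' : T^T *m S^T = 1%:M by rewrite -trmx_mul ST trmx1.
have TS' : S^T *m T^T = 1%:M by rewrite -trmx_mul TS trmx1.
have uG' : S^T *m G *m S \in unitmx.
  have [uS _] := mulmx1_unit ST.
  by rewrite !unitmx_mul unitmx_tr uS uG.
rewrite /alpha_of; have -> : invmx (S^T *m G *m S) = T *m invmx G *m T^T.
  apply: (can_inj (mulKmx uG')); rewrite mulmxV//.
  rewrite (_ : S^T *m G *m S *m (T *m invmx G *m T^T) = S^T *m (G *m (S *m T) *m invmx G) *m T^T); last by rewrite !mulmxA.
  by rewrite ST mulmx1 mulmxV// mulmx1.
rewrite mulmxN mulNmx; congr (- _).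
rewrite (_ : T *m J *m S *m (T *m invmx G *m T^T) = T *m (J *m (S *m T) *m invmx G) *m T^T); last by rewrite !mulmxA.
by rewrite ST mulmx1.
Qed.

End BivectorMetric.

Section Parallel.
Context {R : realType} (M : charted 'cV[R]_4).
Hypothesis atl : is_atlas M.
Variables g J : M -> 'M[R]_4.
Hypothesis ah : almost_hermitian g J.
Hypothesis kah : kahler g J.
Implicit Types (p q r : M) (z v w : 'cV[R]_4).

Lemma nablaJ p v : let z := cmap p p in
  dir (dJloc J p z) v + conn_loc g p z v *m Jloc J p z - Jloc J p z *m conn_loc g p z v = 0.
Proof.
move=> z; have o : overlap p p z by exact: overlap_self.
have iG i := is_derive_gloc ah (delta_mx i 0) o.
have iJ i := is_derive_Jloc ah (delta_mx i 0) o.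
apply: (@nablaJ_eq0 R (gloc g p z) (Jloc J p z) (dgloc g p z) (dJloc J p z)).
- exact: (gloc_sym ah _ _).
- exact: (gloc_unit atl ah o).
- by move=> i; exact: (dgloc_sym ah).
- exact: (Jloc_sq atl ah o).
- exact: (gJloc_skew atl ah o).
- move=> i; have := iJ i; rewrite dir_delta => d.
  apply: (is_derive_unique (f' := cst (- 1%:M)) _ (is_derive_mul d d)).
  apply: filterS (near_overlap atl o) => y oy; exact: (Jloc_sq atl ah oy).
- move=> i; have dJ := iJ i; have dG := iG i; rewrite !dir_delta in dJ dG.
  have d := is_derive_mul dG dJ.
  have d' : is_derive z (delta_mx i 0) (fun y => - (gloc g p y *m Jloc J p y))
      (- (dgloc g p z i *m Jloc J p z + gloc g p z *m dJloc J p z i)).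
    exact: (is_deriveN d).
  apply: is_derive_unique (is_derive_tr d) d'.
  by apply: filterS (near_overlap atl o) => y oy; exact: (gJloc_skew atl ah oy).
- move=> i j k; have [H _] := kah; have := H p i j k.
  by rewrite /nijenhuis -(Jloc_center atl J p).
move=> i j k; have [_ H] := kah; have := H p i j k.
have E l : partial p (kahler_form g J p) l =
    (dJloc J p z l)^T *m gloc g p z + (Jloc J p z)^T *m dgloc g p z l.
  have dJ := iJ l; have dG := iG l; rewrite !dir_delta in dJ dG.
  by have [_] := is_derive_mul (is_derive_tr dJ) dG.
by rewrite !E.
Qed.

Lemma nablaJE p v : let z := cmap p p in
  dir (dJloc J p z) v = Jloc J p z *m conn_loc g p z v - conn_loc g p z v *m Jloc J p z.
Proof.
move=> z; have := nablaJ p v; rewrite -/z => H.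
by apply/eqP; rewrite -subr_eq0 opprB addrA; apply/eqP.
Qed.

Definition alpha_loc p z : 'M[R]_4 := alpha_of (gloc g p z) (Jloc J p z).

Lemma smooth_alpha p : smooth_on (overlap p p) (alpha_loc p).
Proof.
have oo := open_overlap atl p p.
move=> k; apply: CkN => //; apply: Ck_mul => //.
  exact: (smooth_Jloc ah).
apply: Ck_invmx => //; last exact: (smooth_gloc ah).
by move=> z o; exact: (gloc_unit atl ah).
Qed.

Lemma alpha_mul_gloc p z : overlap p p z -> alpha_loc p z *m gloc g p z = - Jloc J p z.
Proof.
by move=> o; rewrite /alpha_loc /alpha_of mulNmx mulmxKV//; exact: (gloc_unit atl ah).
Qed.

Lemma skew_congr (G A : 'M[R]_4) : G^T = G -> G \in unitmx ->
  (G *m A *m G)^T = - (G *m A *m G) -> A^T = - A.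
Proof.
move=> GT uG H; apply: (can_inj (mulmxK uG)); apply: (can_inj (mulKmx uG)).
by rewrite mulNmx mulmxN !mulmxA -H !trmx_mul GT mulmxA.
Qed.

Lemma alpha_parallel_algebra (G A I Gm dA : 'M[R]_4) : G \in unitmx -> A *m G = - I ->
  dA *m G + A *m (Gm^T *m G + G *m Gm) = - (I *m Gm - Gm *m I) ->
  dA = - (Gm *m A + A *m Gm^T).
Proof.
move=> uG AG H; have IE : I = - (A *m G) by rewrite AG opprK.
apply: (can_inj (mulmxK uG)).
have -> : dA *m G = - (I *m Gm - Gm *m I) - A *m (Gm^T *m G + G *m Gm) by rewrite -H addrK.
by rewrite IE !mulNmx !mulmxN !mulmxDr !mulmxDl !mulmxA; mx_ring.
Qed.

Lemma alpha_parallel p v : let z := cmap p p in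
  'D_v (alpha_loc p) z = - (conn_loc g p z v *m alpha_loc p z + alpha_loc p z *m (conn_loc g p z v)^T).
Proof.
move=> z; have o : overlap p p z by exact: overlap_self.
have uG := gloc_unit atl ah o.
have da : is_derive z v (alpha_loc p) ('D_v (alpha_loc p) z).
  by apply/derivableP/diff_derivable/(smooth_diff (@smooth_alpha p)).
have d := is_derive_mul da (is_derive_gloc ah v o).
have d' : is_derive z v (fun y => - Jloc J p y) (- dir (dJloc J p z) v).
  exact: (is_deriveN (is_derive_Jloc ah v o)).
have E : \forall y \near z, alpha_loc p y *m gloc g p y = - Jloc J p y.
  by apply: filterS (near_overlap atl o) => y oy; exact: alpha_mul_gloc.
have := is_derive_unique E d d'.
rewrite (conn_loc_metric atl ah v o) nablaJE -/z.
move: (alpha_mul_gloc o) uG => aG uG H; apply: alpha_parallel_algebra uG aG H.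
Qed.

Lemma alpha_center p : alpha_loc p (cmap p p) = alpha_of (g p) (J p).
Proof. by rewrite /alpha_loc (gloc_center atl) (Jloc_center atl). Qed.

Lemma alpha_skew p : (alpha_of (g p) (J p))^T = - alpha_of (g p) (J p).
Proof.
have uG := g_unit ah p; have GT := g_sym ah p.
have S := GJ_skew GT (J_sq ah p) (J_isom ah p).
have E : g p *m alpha_of (g p) (J p) *m g p = - (g p *m J p).
  by rewrite /alpha_of mulmxN mulNmx !mulmxA mulmxKV.
by apply: (skew_congr GT uG); rewrite E trmxN S.
Qed.

Lemma alpha_norm p : bivec_metric (g p) (alpha_of (g p) (J p)) (alpha_of (g p) (J p)) = 1.
Proof.
have uG := g_unit ah p.
rewrite bivec_alphaE// alpha_skew mulNmx /alpha_of mulNmx opprK !mulmxA mulmxKV// (J_sq ah).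
by rewrite linearN /= mxtrace1; field.
Qed.

Lemma alpha_hodge p :
  hodge (g p) (J p) (alpha_of (g p) (J p)) = alpha_of (g p) (J p).
Proof.
apply: hodge_alpha; [exact: (g_sym ah p)|by move=> v; exact: (g_pos ah)|
  exact: (J_sq ah p)|exact: (J_isom ah p)].
Qed.

End Parallel.

(** * The twistor space in charts *)

Section TwistorCharts.
Context {R : realType} (M : charted 'cV[R]_4).
Hypothesis atl : is_atlas M.
Variables g J : M -> 'M[R]_4.
Hypothesis ah : almost_hermitian g J.
Local Notation TM := (tensor2 M).
Local Notation E := ('cV[R]_4 * 'M[R]_4)%type.
Implicit Types (p q : M) (e y : TM) (m u w : E) (z v : 'cV[R]_4).

Definition alpha_bivec p : 'M[R]_4 := alpha_of (g p) (J p).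
Definition height e : R := bivec_metric (g e.1) e.2 (alpha_bivec e.1).
Definition height_grad e : E := (0, alpha_bivec e.1 - height e *: e.2).
Definition height_loc p m : R := bivec_metric (gloc g p m.1) m.2 (alpha_loc g J p m.1).
Definition height_grad_loc p m : E := (0, alpha_loc g J p m.1 - height_loc p m *: m.2).

(* The covariant derivative of a bivector field with value A and derivative P, C
   being the connection matrix. *)
Definition nabla (C A P : 'M[R]_4) : 'M[R]_4 := P + (C *m A + A *m C^T).
Definition vert_loc p m u : 'M[R]_4 := nabla (conn_loc g p m.1 u.1) m.2 u.2.
Definition h_loc t p m u w : R := gdot (gloc g p m.1) u.1 w.1 +
  t * bivec_metric (gloc g p m.1) (vert_loc p m u) (vert_loc p m w).

Lemma chart_data p q : cdom p q ->
  let T := jac (trans q p) (cmap q q) in let S := jac (trans p q) (cmap p q) in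
  [/\ S *m T = 1%:M, gloc g p (cmap p q) = S^T *m g q *m S &
      Jloc J p (cmap p q) = T *m J q *m S].
Proof.
move=> pq T S; have qq := cdom_refl atl q.
have o : overlap q p (cmap q q) by exact: overlap_center.
have o' : overlap p q (cmap p q) by exact: overlap_cmap.
have ST : S *m T = 1%:M.
  by have := jac_transK atl o; rewrite (trans_cmap atl _ qq).
split; first exact: ST.
  by rewrite (gloc_trans atl g o') (trans_cmap atl _ pq) (gloc_center atl).
rewrite (Jloc_trans atl J o') (trans_cmap atl _ pq) (Jloc_center atl).
congr (_ *m _ *m _); have [uS _] := mulmx1_unit ST.
by apply: (can_inj (mulKmx uS)); rewrite mulmxV.
Qed.

Lemma alpha_chart p q : cdom p q -> let T := jac (trans q p) (cmap q q) in
  alpha_loc g J p (cmap p q) = T *m alpha_bivec q *m T^T.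
Proof.
move=> pq T; have [ST gE JE] := chart_data pq.
by rewrite /alpha_loc gE JE; apply: alpha_nat ST _; exact: (g_unit ah).
Qed.

Lemma height_chart e y : cdom e y -> height y = height_loc e.1 (cmap e y).
Proof.
move=> ey; have [ST gE JE] := chart_data ey.
by rewrite /height_loc tensor_cmapE (alpha_chart ey) gE bivec_nat.
Qed.

Lemma norm_chart e y : cdom e y -> bivec_metric (g y.1) y.2 y.2 =
  bivec_metric (gloc g e.1 (cmap e y).1) (cmap e y).2 (cmap e y).2.
Proof.
by move=> ey; have [ST gE JE] := chart_data ey; rewrite tensor_cmapE gE bivec_nat.
Qed.

Lemma height_grad_chart e y : cdom e y -> tchange y e (height_grad y) = height_grad_loc e.1 (cmap e y).
Proof.
move=> ey; rewrite (tensor_tchange atl _ ey) /height_grad_loc -(height_chart ey) !tensor_cmapE.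
rewrite (alpha_chart ey).
set D := 'D__ _ _; have -> : D = 0 by exact: derive0.
rewrite /height_grad /=; move: (jac _ _) (height y) => T a; congr pair; first by rewrite mulmx0.
rewrite trmx0 mulmx0 !mul0mx addr0 add0r mulmxBr mulmxBl; congr (_ - _).
by rewrite -scalemxAr -scalemxAl.
Qed.

Lemma vertE e u : vert g e u = nabla (conn_mx g e.1 u.1) e.2 u.2.
Proof. by rewrite /vert /hlift /= opprK. Qed.

Lemma vert_center e u : vert g e u = vert_loc e.1 (cmap e e) u.
Proof. by rewrite vertE /vert_loc (tensor_cmap_fiber atl erefl) /= (conn_mxE atl). Qed.

Lemma nabla_nat (T Ga D Gp B P : 'M[R]_4) : T *m Ga = D + Gp *m T ->
  nabla Gp (T *m B *m T^T) (D *m B *m T^T + T *m P *m T^T + T *m B *m D^T) =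
  T *m nabla Ga B P *m T^T.
Proof.
move=> H; rewrite /nabla.
have -> : T *m (P + (Ga *m B + B *m Ga^T)) *m T^T =
   T *m P *m T^T + (T *m Ga) *m B *m T^T + T *m B *m (T *m Ga)^T.
  by rewrite trmx_mul !mulmxDr !mulmxDl !mulmxA; mx_ring.
by rewrite H trmxD trmx_mul !mulmxDr !mulmxDl !mulmxA; mx_ring.
Qed.

Lemma vert_chart e y u : cdom e y -> let T := jac (trans y.1 e.1) (cmap y.1 y.1) in
  vert_loc e.1 (cmap e y) (tchange y e u) = T *m vert g y u *m T^T.
Proof.
move=> ey T; have o : overlap y.1 e.1 (cmap y.1 y.1) by exact: overlap_center.
rewrite vertE /vert_loc (tensor_tchange atl _ ey) tensor_cmapE; apply: nabla_nat.
have := conn_loc_change atl ah u.1 o; rewrite (trans_cmap atl _ (cdom_refl atl _)).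
by rewrite (conn_mxE atl); exact.
Qed.

Lemma h_loc_nat t p m (G S T VU VW : 'M[R]_4) (v1 v2 : 'cV[R]_4) (U W : E) :
  S *m T = 1%:M -> gloc g p m.1 = S^T *m G *m S ->
  U.1 = T *m v1 -> W.1 = T *m v2 ->
  vert_loc p m U = T *m VU *m T^T -> vert_loc p m W = T *m VW *m T^T ->
  h_loc t p m U W = gdot G v1 v2 + t * bivec_metric G VU VW.
Proof.
move=> ST gE U1 W1 VUE VWE.
by rewrite /h_loc VUE VWE U1 W1 gE (bivec_nat _ _ _ ST) (gdot_nat _ _ _ ST).
Qed.

Lemma h_chart t e y u w : cdom e y ->
  h_metric g t y u w = h_loc t e.1 (cmap e y) (tchange y e u) (tchange y e w).
Proof.
move=> ey; have [ST gE JE] := chart_data ey; apply/esym.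
have U1 : (tchange y e u).1 = _ := congr1 fst (tensor_tchange atl u ey).
have W1 : (tchange y e w).1 = _ := congr1 fst (tensor_tchange atl w ey).
have VU := vert_chart u ey; have VW := vert_chart w ey.
have gE' : gloc g e.1 (cmap e y).1 = _ := gE.
clear JE gE; move: ST gE' U1 W1 VU VW.
move: (tchange y e u) (tchange y e w) => U W ST gE U1 W1 VU VW.
exact: (@h_loc_nat t e.1 (cmap e y) _ _ _ _ _ _ _ U W ST gE U1 W1 VU VW).
Qed.

Lemma bivec_derive_algebra (G A B A' B' C : 'M[R]_4) :
  4^-1 * \tr (((A'^T *m G + A^T *m (C^T *m G + G *m C)) *m B + A^T *m G *m B') *m G
     + A^T *m G *m B *m (C^T *m G + G *m C)) =
  bivec_metric G (nabla C A A') B + bivec_metric G A (nabla C B B').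
Proof.
rewrite /bivec_metric /nabla -mulrDr; congr (_ * _).
have E : \tr (A^T *m G *m B *m (G *m C)) = \tr (C *m (A^T *m G *m B *m G)).
  by rewrite mulmxA mxtrace_mulC.
rewrite !trmxD !trmx_mul trmxK ?(mulmxDr, mulmxDl) !mxtraceD E !mulmxA; ring.
Qed.

Lemma is_derive_bivec_loc p m u (A B : E -> 'M[R]_4) dA dB : overlap p p m.1 ->
  is_derive m u A dA -> is_derive m u B dB ->
  is_derive m u (fun m => bivec_metric (gloc g p m.1) (A m) (B m) : R^o)
    (bivec_metric (gloc g p m.1) (nabla (conn_loc g p m.1 u.1) (A m) dA) (B m) +
     bivec_metric (gloc g p m.1) (A m) (nabla (conn_loc g p m.1 u.1) (B m) dB)).
Proof.
move=> o iA iB.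
have iG : is_derive m u (fun m : E => gloc g p m.1)
    ((conn_loc g p m.1 u.1)^T *m gloc g p m.1 + gloc g p m.1 *m conn_loc g p m.1 u.1).
  have [_ d] := is_derive_gloc ah u.1 o.
  apply: is_derive_eq (is_derive_fst (f := gloc g p) u (diff_gloc ah o)) _.
  by apply: (etrans d); exact: (conn_loc_metric atl ah).
have := is_derive_mul (is_derive_mul (is_derive_mul (is_derive_tr iA) iG) iB) iG.
move=> /is_derive_trace iT; have iZ := is_deriveZ 4^-1 iT.
apply: is_derive_eq iZ _; exact: bivec_derive_algebra.
Qed.

Hypothesis kah : kahler g J.

Lemma nabla_alpha e u : nabla (conn_loc g e.1 (cmap e.1 e.1) u.1)
   (alpha_loc g J e.1 (cmap e.1 e.1)) ('D_(u.1) (alpha_loc g J e.1) (cmap e.1 e.1)) = 0.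
Proof. by have H := alpha_parallel atl ah kah e.1 u.1; rewrite /nabla {1}H addNr. Qed.

Lemma is_derive_height e u : is_derive (cmap e e) u (height_loc e.1 : E -> R^o)
  (bivec_metric (g e.1) (vert g e u) (alpha_bivec e.1)).
Proof.
rewrite vert_center (tensor_cmap_fiber atl erefl).
have o : overlap e.1 e.1 (cmap e.1 e.1) by exact: overlap_self.
have da : differentiable (alpha_loc g J e.1) (cmap e.1 e.1).
  exact: smooth_diff (smooth_alpha atl ah e.1) o.
have ia := is_derive_fst (f := alpha_loc g J e.1) (m := (cmap e.1 e.1, e.2)) u da.
have := is_derive_bivec_loc (m := (cmap e.1 e.1, e.2)) o (is_derive_snd _ u) ia.
move=> H; apply: is_derive_eq H _.
by rewrite nabla_alpha /= (gloc_center atl) (alpha_center atl) bivec0r addr0.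
Qed.

Lemma is_derive_norm e u : is_derive (cmap e e) u
  (fun m : E => bivec_metric (gloc g e.1 m.1) m.2 m.2 : R^o)
  (2 * bivec_metric (g e.1) (vert g e u) e.2).
Proof.
rewrite vert_center (tensor_cmap_fiber atl erefl).
have o : overlap e.1 e.1 (cmap e.1 e.1) by exact: overlap_self.
have is2 := is_derive_snd (cmap e.1 e.1, e.2) u.
have H := is_derive_bivec_loc (m := (cmap e.1 e.1, e.2)) o is2 is2.
apply: is_derive_eq H _; rewrite /= (gloc_center atl).
by rewrite [X in _ + X]bivecC ?(g_sym ah)// /vert_loc /=; ring.
Qed.

End TwistorCharts.

Section MoreDerivatives.
Context {R : realType} {V : normedModType R}.

Lemma Ck_scale k (U : set V) m n (f : V -> R^o) (A : V -> 'M[R]_(m, n)) : open U ->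
  Ck k U f -> Ck k U A -> Ck k U (fun x => f x *: A x).
Proof.
move=> oU cf cA; apply: Ck_mx => // i j.
apply: (Ck_eq (f := fun x => f x * A x i j : R^o)) => //.
  by move=> x _; rewrite mxE.
by apply: CkM => //; exact: Ck_coord.
Qed.

Lemma is_derive_scale m n (f : V -> R^o) (A : V -> 'M[R]_(m, n)) x v df dA :
  is_derive x v f df -> is_derive x v A dA ->
  is_derive x v (fun y => f y *: A y) (df *: A x + f x *: dA).
Proof.
move=> iF /is_derive_mx iA; apply/is_derive_mx => i j.
have -> : (fun y => (f y *: A y) i j : R^o) = f * (fun y => A y i j).
  by apply/funext => y; rewrite mxE.
apply: (is_derive_eq (is_deriveM iF (iA i j))).
by rewrite !mxE /GRing.scale /=; ring.
Qed.

Lemma is_derive_dir (C : 'I_4 -> 'M[R]_4) (X : V -> 'cV[R]_4) x v dX :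
  is_derive x v X dX -> is_derive x v (fun y => dir C (X y)) (dir C dX).
Proof.
move=> /is_derive_mx iX; apply/is_derive_mx => i j; rewrite dirE.
have -> : (fun y => dir C (X y) i j : R^o) = \sum_l (fun y => C l i j * X y l 0).
  by apply/funext => y; rewrite dirE fct_sumE; apply: eq_bigr => l _; rewrite mulrC.
apply: is_derive_sum => l; apply: (is_derive_eq (is_deriveZ (C l i j) (iX l 0))).
by rewrite mulrC.
Qed.

Lemma is_derive_on_line (W : normedModType R) (f f' : V -> W) x v d :
  (forall h, f (h *: v + x) = f' (h *: v + x)) ->
  is_derive x v f d -> is_derive x v f' d.
Proof.
move=> ff' [df <-].
have E : (fun h => h^-1 *: ((f \o shift x) (h *: v) - f x)) =
    (fun h => h^-1 *: ((f' \o shift x) (h *: v) - f' x)).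
  apply/funext => h /=; rewrite ff'; congr (_ *: (_ - _)).
  by have := ff' 0; rewrite scale0r add0r.
by split; [move: df; rewrite /derivable E|rewrite /derive E].
Qed.

End MoreDerivatives.

Section HodgeLinear.
Context {R : realType}.
Implicit Types (G J A B : 'M[R]_4).

Lemma hodgeD G J A B : hodge G J (A + B) = hodge G J A + hodge G J B.
Proof.
rewrite /hodge -scalerDr; congr (_ *: _); apply/matrixP => i j; rewrite !mxE -big_split.
apply: eq_bigr => k _; rewrite -big_split; apply: eq_bigr => l _ /=.
by rewrite mulmxDr mulmxDl mxE mulrDr.
Qed.

Lemma hodgeZ G J a A : hodge G J (a *: A) = a *: hodge G J A.
Proof.
rewrite /hodge [RHS]scalerA (mulrC a) -[RHS]scalerA; congr (_ *: _); apply/matrixP => i j.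
rewrite !mxE mulr_sumr; apply: eq_bigr => k _.
rewrite mulr_sumr; apply: eq_bigr => l _ /=.
by rewrite -scalemxAr -scalemxAl mxE mulrCA.
Qed.

End HodgeLinear.

Section TwistorSpace.
Context {R : realType} (M : charted 'cV[R]_4).
Hypothesis atl : is_atlas M.
Variables g J : M -> 'M[R]_4.
Hypothesis ah : almost_hermitian g J.
Local Notation TM := (tensor2 M).
Local Notation E := ('cV[R]_4 * 'M[R]_4)%type.
Implicit Types (p q : M) (e y : TM) (m u v w : E).
Local Notation S := (twistor g J : set TM).

Definition chart_dom p : set E := [set m | overlap p p m.1].

Lemma open_chart_dom p : open (chart_dom p).
Proof.
apply: (open_comp (f := fst)); first by move=> m _; exact: cvg_fst.
exact: open_overlap.
Qed.

Lemma chart_dom_center e : chart_dom e.1 (cmap e e).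
Proof. by rewrite (tensor_cmap_fiber atl erefl); exact: overlap_self. Qed.

Lemma smooth_fst_comp (W : normedModType R) p (f : 'cV[R]_4 -> W) : fin_dim W ->
  smooth_on (overlap p p) f -> smooth_on (chart_dom p) (fun m => f m.1).
Proof.
move=> fW sf k; apply: Ck_fst_comp => //; first exact: fin_dim_mx.
exact: open_overlap.
Qed.

Lemma fin_dim_E : fin_dim E.
Proof. by apply: fin_dim_pair; exact: fin_dim_mx. Qed.

Lemma smooth_gloc_fst p : smooth_on (chart_dom p) (fun m => gloc g p m.1).
Proof. exact: smooth_fst_comp (fin_dim_mx _ _) (smooth_gloc ah p). Qed.

Lemma smooth_alpha_fst p : smooth_on (chart_dom p) (fun m => alpha_loc g J p m.1).
Proof. exact: smooth_fst_comp (fin_dim_mx _ _) (smooth_alpha atl ah p). Qed.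

Lemma smooth_snd (U : set E) : open U -> smooth_on U (fun m => m.2).
Proof. by move=> oU k; apply: (Ck_snd (f := id) oU); exact: Ck_id. Qed.

Lemma Ck_bivec k p (U : set E) (A B : E -> 'M[R]_4) : open U -> U `<=` chart_dom p ->
  Ck k U A -> Ck k U B ->
  Ck k U (fun m => bivec_metric (gloc g p m.1) (A m) (B m) : R^o).
Proof.
move=> oU Up cA cB.
have cG : Ck k U (fun m => gloc g p m.1) := Ck_subset Up (@smooth_gloc_fst p k).
apply: (@CkZ _ _ R^o _ _ 4^-1 (fun m => \tr ((A m)^T *m gloc g p m.1 *m B m *m gloc g p m.1))) => //.
apply: Ck_trace => //; apply: Ck_mul (cG) => //; apply: Ck_mul cB => //.
apply: Ck_mul (cG) => //; exact: Ck_tr.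
Qed.

Lemma smooth_norm p : smooth_on (chart_dom p)
  (fun m => bivec_metric (gloc g p m.1) m.2 m.2 : R^o).
Proof.
move=> k; have s2 := smooth_snd (@open_chart_dom p) k.
by apply: (Ck_bivec (@open_chart_dom p) _ s2 s2).
Qed.

Lemma smooth_height_loc p : smooth_on (chart_dom p) (height_loc g J p : E -> R^o).
Proof.
move=> k; have s2 := smooth_snd (@open_chart_dom p) k.
by apply: (Ck_bivec (@open_chart_dom p) _ s2 (@smooth_alpha_fst p k)).
Qed.

Lemma smooth_height_grad_loc p : smooth_on (chart_dom p) (height_grad_loc g J p).
Proof.
have oo := @open_chart_dom p.
move=> k; apply: Ck_pair => //; first exact: Ck_cst.
apply: CkD => //; first exact: smooth_alpha_fst.
apply: CkN => //; apply: Ck_scale => //; first exact: smooth_height_loc.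
exact: smooth_snd.
Qed.

Lemma Ck_conn_loc k p (U : set E) (X : E -> 'cV[R]_4) : open U -> U `<=` chart_dom p ->
  Ck k U X -> Ck k U (fun m => conn_loc g p m.1 (X m)).
Proof.
move=> oU Up cX.
have cG : Ck k U (fun m => gloc g p m.1) := Ck_subset Up (@smooth_gloc_fst p k).
have cdG i : Ck k U (fun m => dgloc g p m.1 i).
  have sD : smooth_on (overlap p p) (fun z => dgloc g p z i).
    by move=> n; exact: (smooth_gloc ah p n.+1).2.
  exact: (Ck_subset Up (smooth_fst_comp (fin_dim_mx _ _) sD k)).
apply: (Ck_eq (f := fun m => invmx (gloc g p m.1) *m levi_civita_low (dgloc g p m.1) (X m))) => //.
  by move=> m _; rewrite /conn_loc levi_civita_mxE.
apply: Ck_mul => //.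
  by apply: Ck_invmx => // m /Up o; exact: (gloc_unit atl ah o).
apply: Ck_mx => // l j.
apply: (Ck_eq (f := fun m => \sum_i (2^-1 *: (dgloc g p m.1 i j l + dgloc g p m.1 j i l -
  dgloc g p m.1 l i j : R^o)) * X m i 0 : R^o)) => //.
  by move=> m _; rewrite mxE.
apply: Ck_sum => // i; apply: CkM => //; last exact: Ck_coord.
apply: CkZ => //; apply: CkD => //; last by apply: CkN => //; exact: Ck_coord.
by apply: CkD => //; exact: Ck_coord.
Qed.

Lemma Ck_vert_loc k p (U : set E) (X : E -> E) : open U -> U `<=` chart_dom p ->
  Ck k U X -> Ck k U (fun m => vert_loc g p m (X m)).
Proof.
move=> oU Up cX; have s2 := smooth_snd oU k.
have cGm := Ck_conn_loc oU Up (Ck_fst oU cX).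
apply: CkD => //; first exact: Ck_snd.
by apply: CkD => //; apply: Ck_mul => //; exact: Ck_tr.
Qed.

Lemma Ck_h_loc k t p (U : set E) (X Y : E -> E) : open U -> U `<=` chart_dom p ->
  Ck k U X -> Ck k U Y -> Ck k U (fun m => h_loc g t p m (X m) (Y m) : R^o).
Proof.
move=> oU Up cX cY.
have cG : Ck k U (fun m => gloc g p m.1) := Ck_subset Up (@smooth_gloc_fst p k).
apply: CkD => //.
  apply: (Ck_coord (f := fun m => ((X m).1)^T *m gloc g p m.1 *m (Y m).1)) => //.
  apply: Ck_mul => //; last exact: Ck_fst.
  by apply: Ck_mul => //; apply: Ck_tr => //; exact: Ck_fst.
apply: (@CkZ _ _ R^o _ _ t (fun m => bivec_metric (gloc g p m.1) (vert_loc g p m (X m)) (vert_loc g p m (Y m)))) => //.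
apply: (Ck_bivec oU Up); exact: Ck_vert_loc.
Qed.

Lemma rep_all (W : Type) (N : set TM) e (f : TM -> W) (F : E -> W) z :
  (forall y, cdom e y -> f y = F (cmap e y)) -> local_rep N e f F z.
Proof.
by move=> H; near=> z' => y _ ey <-; exact: H.
Unshelve. all: by end_near. Qed.

Lemma conn_mx0 p : conn_mx g p 0 = 0.
Proof.
apply/matrixP => i j; rewrite !mxE big1// => k _.
by rewrite mxE mulr0.
Qed.

Lemma vert_vertical e (A : 'M[R]_4) : vert g e (0, A) = A.
Proof. by rewrite vertE /nabla /= conn_mx0 trmx0 mulmx0 mul0mx !addr0. Qed.

Lemma vertD e u v : vert g e (u + v) = vert g e u + vert g e v.
Proof.
rewrite !vertE /nabla /= !(conn_mxE atl) /conn_loc levi_civita_mxD trmxD mulmxDl mulmxDr; mx_ring.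
Qed.

Lemma vertZ e a u : vert g e (a *: u) = a *: vert g e u.
Proof.
rewrite !vertE /nabla /= !(conn_mxE atl) /conn_loc levi_civita_mxZ trmxZ -scalemxAl -scalemxAr.
by rewrite !scalerDr.
Qed.

Lemma vert_perp e v : tangent S e v -> bivec_metric (g e.1) (vert g e v) e.2 = 0.
Proof.
move=> [c Hc]; pose f y : R^o := bivec_metric (g y.1) y.2 y.2.
pose F m : R^o := bivec_metric (gloc g e.1 m.1) m.2 m.2.
have rF : local_rep S e f F (cmap e e).
  by apply: rep_all => y ey; exact: norm_chart.
have dF : differentiable F (cmap e e).
  exact: smooth_diff (@smooth_norm e.1) (chart_dom_center e).
have := curve_derive_rep Hc rF dF.
have [_ ->] := is_derive_norm atl ah e v.
have -> : derive1 (f \o c) 0 = 0.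
  rewrite -[RHS](derive1_cst (V := R^o) 1 0) !derive1E; apply: near_eq_derive.
  have [d d0 [_ Sc _ _]] := Hc.
  near=> s; have [[_ _ n1] _] : S (c s) /\ cdom e (c s).
    by apply: Sc; near: s; exact: near_ball0.
  exact: n1.
by move=> H; apply: (mulfI (_ : 2 != 0 :> R)); rewrite ?pnatr_eq0// -H mulr0.
Unshelve. all: by end_near. Qed.

End TwistorSpace.

Section Tangents.
Context {R : realType} (M : charted 'cV[R]_4).
Hypothesis atl : is_atlas M.
Variables g J : M -> 'M[R]_4.
Hypothesis ah : almost_hermitian g J.
Local Notation TM := (tensor2 M).
Local Notation E := ('cV[R]_4 * 'M[R]_4)%type.
Implicit Types (p q : M) (e y : TM) (m u v w : E).
Local Notation S := (twistor g J : set TM).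
Local Notation Sig := (Sigma_J g J : set TM).

Lemma open_ball0 (d : R) : open [set s : R^o | `|s| < d].
Proof.
rewrite (_ : [set s : R^o | `|s| < d] = ball (0 : R^o) d); first exact: ball_open.
by apply/seteqP; split=> s; rewrite -ball_normE /ball_ /= sub0r normrN.
Qed.

Lemma proj_perp (G A B : 'M[R]_4) : G^T = G -> bivec_metric G B B = 1 ->
  bivec_metric G (A - bivec_metric G B A *: B) B = 0.
Proof.
by move=> GT n1; rewrite bivecDl bivecNl bivecZl n1 mulr1 bivecC// subrr.
Qed.

Lemma proj_skew (A B : 'M[R]_4) (a : R) : A^T = - A -> B^T = - B ->
  (A - a *: B)^T = - (A - a *: B).
Proof. by move=> sA sB; rewrite trmxD trmxN trmxZ sA sB scalerN opprK opprD opprK. Qed.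

Lemma proj_hodge (G I A B : 'M[R]_4) (a : R) : hodge G I A = A -> hodge G I B = B ->
  hodge G I (A - a *: B) = A - a *: B.
Proof. by move=> hA hB; rewrite hodgeD -scaleN1r !hodgeZ hA hB. Qed.

Lemma rsqrt_mul (x : R) : 0 < x -> (Num.sqrt x)^-1 * ((Num.sqrt x)^-1 * x) = 1.
Proof.
by move=> x0; rewrite mulrA -invfM -expr2 sqr_sqrtr ?ltW// mulVf// gt_eqF.
Qed.

Lemma diff_rsqrt (x : R) : 0 < x -> differentiable (fun x => (Num.sqrt x)^-1 : R^o) (x : R^o).
Proof.
move=> x0; have o : open [set x : R^o | 0 < x] by exact: open_gt.
have : Ck 1 [set x : R^o | 0 < x] (fun x : R^o => (Num.sqrt x)^-1 : R^o).
  by apply: (Ck_rsqrt (f := id)) => //; exact: Ck_id.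
by move=> [H _]; exact: H.
Qed.

Lemma normalized_tangent (N : set TM) e v (b : R -> TM) (d : R) :
  S e -> 0 < d -> b 0 = e ->
  (forall s, `|s| < d -> [/\ cdom e (b s), (b s).2^T = - (b s).2 &
     hodge (g (b s).1) (J (b s).1) (b s).2 = (b s).2]) ->
  smooth_on [set s : R^o | `|s| < d] (cmap e \o b : R^o -> E) ->
  derive1 (cmap e \o b) 0 = v ->
  bivec_metric (g e.1) (vert g e v) e.2 = 0 ->
  (forall s a, `|s| < d -> S ((b s).1, a *: (b s).2) -> N ((b s).1, a *: (b s).2)) ->
  tangent N e v.
Proof.
move=> Se d0 b0 Hb sb db perp HN.
pose gam : R^o -> E := cmap e \o b.
pose F m : R^o := bivec_metric (gloc g e.1 m.1) m.2 m.2.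
pose n s : R^o := F (gam s).
pose nn s : R := bivec_metric (g (b s).1) (b s).2 (b s).2.
have nE (s : R) : `|s| < d -> n s = nn s.
  by move=> /Hb[eb _ _]; rewrite /n /F /gam /= -(norm_chart atl g J eb).
have z0 : `|0 : R| < d by rewrite normr0.
have n0 : n 0 = 1 by rewrite nE// /nn b0; have [_ _] := Se.
have dgam : differentiable gam (0 : R^o) by exact: smooth_diff sb _.
have gam0 : gam 0 = cmap e e by rewrite /gam /= b0.
have dF : differentiable F (cmap e e).
  exact: smooth_diff (@smooth_norm _ _ atl g J ah e.1) (chart_dom_center atl e).
have dF0 : differentiable F (gam 0) by rewrite gam0.
have dn : differentiable n (0 : R^o) by exact: (differentiable_comp dgam dF0).
have [d1 d10 Hd1] : exists2 d1 : R, 0 < d1 & forall s : R, `|s| < d1 -> 0 < n s.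
  have cn : {for (0 : R^o), continuous n} by exact: differentiable_continuous.
  have : \forall s \near (0 : R^o), 0 < n s.
    apply: (near_continuous (P := fun a : R^o => 0 < a) cn).
    by rewrite n0; apply: open_nbhs_nbhs; split; [exact: open_gt|exact: ltr01].
  move=> /nbhs_ballP[d1 d10 Hd1]; exists d1; first exact: d10.
  move=> s sd1; apply: Hd1.
  by rewrite -ball_normE /ball_ /= sub0r normrN.
pose d2 := Num.min d d1.
have d20 : 0 < d2 by rewrite lt_min d0.
have lt2 (s : R) : `|s| < d2 -> `|s| < d /\ `|s| < d1 by rewrite lt_min => /andP.
pose r s : R^o := (Num.sqrt (n s))^-1.
pose c s : TM := ((b s).1, r s *: (b s).2).
have cE s : cmap e (c s) = ((gam s).1, r s *: (gam s).2).
  have gE : gam s = _ := tensor_cmapE e (b s).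
  apply: (etrans (tensor_cmapE e (c s))); rewrite gE; congr pair.
  by rewrite [(c s).2]/= [(_, _).2]/= -scalemxAr -scalemxAl.
have Sc s : `|s| < d2 -> S (c s).
  move=> /lt2[sd sd1]; have [_ sk ho] := Hb s sd; split => /=.
  - by rewrite trmxZ sk scalerN.
  - by rewrite hodgeZ ho.
  rewrite bivecZl bivecZr -/(nn s) -(nE s sd); exact: rsqrt_mul (Hd1 s sd1).
have oU := @open_ball0 d2.
have U2 : [set s : R^o | `|s| < d2] `<=` [set s : R^o | `|s| < d] by move=> s /lt2[].
have sgam k : Ck k [set s : R^o | `|s| < d2] gam by exact: Ck_subset U2 (sb k).
have sn k : Ck k [set s : R^o | `|s| < d2] n.
  apply: (Ck_comp (U' := chart_dom e.1) (f := F)); [exact: fin_dim_E|exact: fin_dimR|exact: oU| |exact: sgam|].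
    move=> s /lt2[/Hb[eb _ _] _]; exists (b s).1; [split; exact: eb|reflexivity].
  exact: (smooth_norm atl ah).
have sr k : Ck k [set s : R^o | `|s| < d2] r.
  by apply: (Ck_rsqrt oU _ (sn k)); move=> s /lt2[_]; exact: Hd1.
exists c; exists d2; [exact: d20|split].
- rewrite /c /r n0 b0 sqrtr1 invr1 scale1r; by case: (e).
- move=> s sd2; split; last by have [] := Hb s (lt2 s sd2).1.
  by apply: HN; [exact: (lt2 s sd2).1|exact: Sc].
- move=> k; apply: (Ck_eq oU (f := fun s => ((gam s).1, r s *: (gam s).2))).
    by move=> s _; exact: (esym (cE s)).
  exact: (Ck_pair oU (Ck_fst oU (sgam k))
    (Ck_scale oU (sr k) (Ck_snd oU (sgam k)))).
have igam : is_derive (0 : R^o) 1 gam v.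
  by split; [exact: diff_derivable|rewrite -db derive1E].
have ngam : 'D_1 n (0 : R^o) = 0.
  apply: (etrans (derive_comp (f := gam) (g := F) 1 dgam dF0)).
  have [_ ->] := igam; rewrite gam0; have [_ ->] := is_derive_norm atl ah e v.
  by rewrite perp mulr0.
have ir : is_derive (0 : R^o) 1 r 0.
  have dq : differentiable (fun x : R^o => (Num.sqrt x)^-1 : R^o) (n 0).
    by apply: diff_rsqrt; rewrite n0.
  split.
    by apply: diff_derivable; exact: (differentiable_comp dn dq).
  apply: (etrans (derive_comp (f := n) (g := fun x : R^o => (Num.sqrt x)^-1 : R^o) 1 dn dq)).
  by rewrite ngam derive0.
have ig1 : is_derive (0 : R^o) 1 (fun s => (gam s).1) v.1.
  split.
    by apply: diff_derivable; exact: (differentiable_comp dgam (differentiable_fst _)).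
  apply: (etrans (derive_comp (f := gam) (g := fst) 1 dgam (differentiable_fst _))).
  by rewrite derive_fst; have [_ ->] := igam.
have ig2 : is_derive (0 : R^o) 1 (fun s => (gam s).2) v.2.
  split.
    by apply: diff_derivable; exact: (differentiable_comp dgam (differentiable_snd _)).
  apply: (etrans (derive_comp (f := gam) (g := snd) 1 dgam (differentiable_snd _))).
  by rewrite derive_snd; have [_ ->] := igam.
rewrite derive1E; have -> : cmap e \o c = fun s => ((gam s).1, r s *: (gam s).2).
  by apply/funext => s; exact: cE.
have Uz : [set s : R^o | `|s| < d2] 0 by rewrite /= normr0.
have dA : differentiable (fun s => (gam s).1) (0 : R^o).
  exact: (differentiable_comp dgam (differentiable_fst _)).
have dB : differentiable (fun s : R^o => r s *: (gam s).2) (0 : R^o).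
  exact: (Ck_scale oU (sr 1%N) (Ck_snd oU (sgam 1%N))).1.
apply: (etrans (derive_pair _ dA dB)).
have [_ ->] := ig1; have [_ ->] := is_derive_scale ir ig2.
by rewrite scale0r add0r /r n0 sqrtr1 invr1 scale1r -surjective_pairing.
Qed.

Lemma alpha_bivec_norm p : bivec_metric (g p) (alpha_bivec g J p) (alpha_bivec g J p) = 1.
Proof. exact: (alpha_norm ah). Qed.

Lemma height_grad_perp e : S e -> bivec_metric (g e.1) (alpha_bivec g J e.1 - height g J e *: e.2) e.2 = 0.
Proof.
by move=> [_ _ n1]; exact: proj_perp (g_sym ah e.1) n1.
Qed.

Lemma height_grad_tangent e : S e -> tangent S e (height_grad g J e).
Proof.
move=> Se; have [sk ho n1] := Se.
set A := alpha_bivec g J e.1 - height g J e *: e.2.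
have skA : A^T = - A.
  exact: (proj_skew _ (alpha_skew ah e.1) sk).
have hoA : hodge (g e.1) (J e.1) A = A.
  exact: (proj_hodge _ (alpha_hodge ah e.1) ho).
have pA : bivec_metric (g e.1) A e.2 = 0 by exact: height_grad_perp.
have -> : height_grad g J e = (0, A) by [].
clearbody A.
pose b (s : R) : TM := (e.1, e.2 + s *: A).
have bE : cmap e \o b = fun s => (cmap e.1 e.1, e.2 + s *: A).
  by apply/funext => s; exact: (tensor_cmap_fiber atl).
apply: (@normalized_tangent S e _ b 1); [exact: Se|exact: ltr01| | | | | |by []].
- by rewrite /b scale0r addr0 -surjective_pairing.
- move=> s _; split; rewrite /b /=.
  + exact: (cdom_refl atl).
  + by rewrite trmxD trmxZ sk skA opprD scalerN.
  + by rewrite hodgeD hodgeZ ho hoA.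
- have oU := @open_ball0 1.
  rewrite bE => k; apply: Ck_pair => //; first exact: Ck_cst.
  apply: CkD => //; first exact: Ck_cst.
  by apply: (CkZl (f := id)) => //; exact: Ck_id.
- rewrite derive1E bE.
  have d2 : is_derive (0 : R^o) 1 (fun s : R^o => e.2 + s *: A) A.
    have i := is_derive_scale (is_derive_id (0 : R^o) 1) (is_derive_cst A (0 : R^o) 1).
    have i2 := is_deriveD (is_derive_cst e.2 (0 : R^o) 1) i.
    by apply: is_derive_eq i2 _; rewrite scaler0 addr0 scale1r add0r.
  apply: (etrans (derive_pair _ _ _)).
  + exact: differentiable_cst.
  + have oU := @open_ball0 1; have Uz : [set s : R^o | `|s| < 1] 0 by rewrite /= normr0.
    suff [H _] : Ck 1 [set s : R^o | `|s| < 1] (fun s : R^o => e.2 + s *: A) by exact: H.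
    apply: CkD => //; first exact: Ck_cst.
    by apply: (CkZl (f := id)) => //; exact: Ck_id.
  have [_ ->] := d2; congr pair; exact: derive_cst.
by rewrite vert_vertical.
Qed.

Lemma Sigma_sub : Sig `<=` S. Proof. by move=> e []. Qed.

Lemma height_grad_vfield : vfield S (height_grad g J).
Proof.
move=> e Se; split; first exact: height_grad_tangent.
exists (chart_dom e.1), (height_grad_loc g J e.1); split.
- exact: (open_chart_dom atl).
- exact: chart_dom_center.
- exact: (smooth_height_grad_loc atl ah).
- by move=> y _ ey _; exact: (height_grad_chart atl ah).
Qed.

End Tangents.

Section KahlerTwistor.
Context {R : realType} (M : charted 'cV[R]_4).
Hypothesis atl : is_atlas M.
Variables g J : M -> 'M[R]_4.
Hypothesis ah : almost_hermitian g J.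
Hypothesis kah : kahler g J.
Variable t : R.
Local Notation TM := (tensor2 M).
Local Notation E := ('cV[R]_4 * 'M[R]_4)%type.
Implicit Types (p q : M) (e y : TM) (m u v w : E).
Let tatl : is_atlas TM := tensor_atlas atl.
Local Notation S := (twistor g J : set TM).
Local Notation Sig := (Sigma_J g J : set TM).
Local Notation uf := (height g J).
Local Notation W := (height_grad g J).
Local Notation h := (h_metric g t).

Lemma diff_height_loc e : differentiable (height_loc g J e.1 : E -> R^o) (cmap e e).
Proof. exact: smooth_diff (@smooth_height_loc _ _ atl g J ah e.1) (chart_dom_center atl e). Qed.

Lemma height_rep (N : set TM) e z : local_rep N e uf (height_loc g J e.1) z.
Proof. by apply: rep_all => y ey; exact: (height_chart atl ah). Qed.

Lemma dv_height e v : tangent S e v -> dv S uf e v = bivec_metric (g e.1) (vert g e v) (alpha_bivec g J e.1).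
Proof.
move=> tv; rewrite (dv_rep tv (height_rep _ _ _) (diff_height_loc e)).
by have [_ ->] := is_derive_height atl ah kah e v.
Qed.

Lemma vert_height_grad e : vert g e (W e) = alpha_bivec g J e.1 - uf e *: e.2.
Proof. exact: vert_vertical. Qed.

Lemma h_height_grad e v : tangent S e v -> h e v (W e) = t * dv S uf e v.
Proof.
move=> tv; rewrite (dv_height tv) /h_metric vert_height_grad /gdot mulmx0 mxE add0r.
congr (_ * _); rewrite bivecDr -scaleNr bivecZr.
by rewrite (vert_perp atl ah tv) mulr0 addr0.
Qed.

Lemma hC e u v : h e u v = h e v u.
Proof.
rewrite /h_metric (gdotC u.1 v.1 (g_sym ah e.1)).
by rewrite (bivecC (vert g e u) (vert g e v) (g_sym ah e.1)).
Qed.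

Lemma hDl e u v w : h e (u + v) w = h e u w + h e v w.
Proof.
rewrite /h_metric (vertD atl g e u v); move: (vert g e u) (vert g e v) (vert g e w).
by move=> A B C; rewrite bivecDl gdotDl; ring.
Qed.

Lemma hNl e u w : h e (- u) w = - h e u w.
Proof.
by rewrite -scaleN1r /h_metric (vertZ atl) bivecZl gdotZl; ring.
Qed.

Lemma hDr e u v w : h e w (u + v) = h e w u + h e w v.
Proof. by rewrite !(hC e w) hDl. Qed.

Lemma hNr e u w : h e w (- u) = - h e w u.
Proof. by rewrite !(hC e w) hNl. Qed.

Lemma Sigma_height e : Sig e -> uf e = 0. Proof. by case. Qed.

Lemma dv_height_Sigma e v : tangent Sig e v -> dv S uf e v = 0.
Proof.
move=> tv; apply: (dv_zero (@Sigma_sub _ _ g J) tv (height_rep _ _ _) (diff_height_loc e)).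
by move=> y; exact: Sigma_height.
Qed.

Lemma height_smooth (N : set TM) : smooth_along N (uf : TM -> R^o).
Proof.
move=> y Sy; exists (chart_dom y.1), (height_loc g J y.1 : E -> R^o); split.
- exact: (open_chart_dom atl).
- exact: (chart_dom_center atl).
- exact: (smooth_height_loc atl ah).
- by move=> y' _ yy' _; exact: (height_chart atl ah).
Qed.

Lemma Sigma_hypersurface : hypersurface S Sig.
Proof.
split; first exact: Sigma_sub.
move=> e Se; have Te := Sigma_sub Se.
exists setT, uf; split.
- exact: openT.
- by [].
- exact: height_smooth.
- by move=> y Sy _ _; split=> [[]//|uy]; split.
exists (W e); first exact: (height_grad_tangent atl ah).
rewrite (dv_height (height_grad_tangent atl ah Te)) vert_height_grad (Sigma_height Se) scale0r subr0.
by rewrite (alpha_bivec_norm ah); apply/eqP; exact: oner_neq0.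
Qed.

Lemma Sigma_tangent e v : Sig e -> tangent S e v -> dv S uf e v = 0 -> tangent Sig e v.
Proof.
move=> Se tv dv0; have [c Hc] := tv.
have [dgam Dgam] := curve_diff Hc.
have [d d0 [c0 Sc sc dc]] := Hc.
pose psi m : E := (m.1, m.2 - height_loc g J e.1 m *: alpha_loc g J e.1 m.1).
pose b s : TM := ((c s).1, (c s).2 - uf (c s) *: alpha_bivec g J (c s).1).
have oC := open_chart_dom atl (p := e.1).
have spsi : smooth_on (chart_dom e.1) psi.
  move=> k; have c1 := Ck_fst (f := id) oC (Ck_id k (chart_dom e.1)).
  have c2 := Ck_snd (f := id) oC (Ck_id k (chart_dom e.1)).
  have c3 := Ck_scale oC (@smooth_height_loc _ _ atl g J ah e.1 k) (@smooth_alpha_fst _ _ atl g J ah e.1 k).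
  exact: (Ck_pair oC c1 (CkD oC c2 (CkN oC c3))).
have bE s : `|s| < d -> cmap e (b s) = psi (cmap e (c s)).
  move=> sd; have [_ ec] := Sc s sd.
  rewrite /psi -(height_chart atl ah ec).
  have -> : cmap e (b s) = _ := tensor_cmapE e (b s).
  have -> : cmap e (c s) = _ := tensor_cmapE e (c s).
  rewrite (alpha_chart atl ah ec); congr pair.
  rewrite [(b s).1]/= [(b s).2]/= [(_, _).2]/=.
  move: (jac _ _) (uf _) (alpha_bivec _ _ _) => T a A.
  by rewrite mulmxBr mulmxBl -scalemxAr -scalemxAl.
have oU := @open_ball0 R d.
have Uz : [set s : R^o | `|s| < d] 0 by rewrite /= normr0.
have u0 := Sigma_height Se.
apply: (@normalized_tangent _ _ atl g J ah Sig e v b d).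
- exact: Sigma_sub Se.
- exact: d0.
- by rewrite /b c0 u0 scale0r subr0 -surjective_pairing.
- move=> s sd; have [[sk ho _] ec] := Sc s sd; split; first exact: ec.
    exact: (proj_skew _ sk (alpha_skew ah (c s).1)).
  exact: (proj_hodge _ ho (alpha_hodge ah (c s).1)).
- move=> k; apply: (Ck_eq oU (f := fun s => psi (cmap e (c s)))).
    by move=> s sd; exact: (esym (bE s sd)).
  apply: (Ck_comp (U' := chart_dom e.1) (f := psi)); [exact: fin_dim_E|exact: fin_dim_E|exact: oU| |exact: (sc k)|exact: (spsi k)].
  by move=> s sd; have [_ ec] := Sc s sd; exists (c s).1; [split; exact: ec|reflexivity].
- rewrite derive1E.
  have E1 : 'D_1 (cmap e \o b : R^o -> E) 0 = 'D_1 (psi \o (cmap e \o c) : R^o -> E) 0.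
    apply: near_eq_derive; near=> s; apply: bE; near: s; exact: near_ball0.
  have cc0 : (cmap e \o c) 0 = cmap e e by rewrite /= c0.
  have dpsi : differentiable psi ((cmap e \o c) 0).
    by rewrite cc0; exact: smooth_diff spsi (chart_dom_center atl e).
  apply: (etrans E1); apply: (etrans (derive_comp (f := cmap e \o c : R^o -> E) (g := psi) 1 dgam dpsi)); rewrite Dgam cc0.
  have iu := is_derive_height atl ah kah e v.
  have ia : is_derive (cmap e e) v (fun m : E => alpha_loc g J e.1 m.1)
     ('D_v.1 (alpha_loc g J e.1) (cmap e e).1).
    apply: is_derive_fst; apply: smooth_diff (smooth_alpha atl ah e.1) _.
    exact: (chart_dom_center atl e).
  have i2 := is_deriveB (is_derive_snd (cmap e e) v) (is_derive_scale iu ia).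
  have d1 : differentiable (fun m : E => m.1) (cmap e e) by exact: differentiable_fst.
  have d2 : differentiable (fun m : E => m.2 - height_loc g J e.1 m *: alpha_loc g J e.1 m.1) (cmap e e).
    have c2 := Ck_snd (f := id) oC (Ck_id 1 (chart_dom e.1)).
    have c3 := Ck_scale oC (@smooth_height_loc _ _ atl g J ah e.1 1%N) (@smooth_alpha_fst _ _ atl g J ah e.1 1%N).
    exact: (CkD oC c2 (CkN oC c3)).1 _ (chart_dom_center atl e).
  apply: (etrans (derive_pair v d1 d2)).
  rewrite -(dv_height tv) dv0 -(height_chart atl ah (cdom_refl tatl e)) u0 in i2.
  have [_ E2] := i2; have E3 := derive_fst (cmap e e) v.
  apply: (etrans (congr2 pair E3 E2)).
  by rewrite !scale0r addr0 subr0 -surjective_pairing.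
- exact: (vert_perp atl ah tv).
move=> s a sd Sb; split; first exact: Sb.
have [[_ _ n1] ec] := Sc s sd.
have P := @proj_perp R (g (c s).1) (c s).2 (alpha_bivec g J (c s).1)
  (g_sym ah _) (alpha_bivec_norm ah _).
rewrite bivecC ?(g_sym ah)// in P.
rewrite (bivecC (alpha_bivec g J (c s).1) (c s).2 (g_sym ah _)) in P.
apply: (etrans (bivecZl _ _ _ _)); apply: (etrans _ (mulr0 a)); congr (_ * _).
by apply: (etrans (bivecC _ _ (g_sym ah _))); exact: P.
Unshelve. all: by end_near. Qed.

End KahlerTwistor.

(** * The second fundamental form *)

Section SecondFundamentalForm.
Context {R : realType} (M : charted 'cV[R]_4).
Hypothesis atl : is_atlas M.
Variables g J : M -> 'M[R]_4.
Hypothesis ah : almost_hermitian g J.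
Hypothesis kah : kahler g J.
Variable t : R.
Hypothesis t_gt0 : 0 < t.
Local Notation TM := (tensor2 M).
Local Notation E := ('cV[R]_4 * 'M[R]_4)%type.
Implicit Types (p q : M) (e y : TM) (m u v w : E).
Let tatl : is_atlas TM := tensor_atlas atl.
Local Notation S := (twistor g J : set TM).
Local Notation Sig := (Sigma_J g J : set TM).
Local Notation uf := (height g J).
Local Notation W := (height_grad g J).
Local Notation h := (h_metric g t).

Lemma conn_loc_dir p (z v : 'cV[R]_4) : conn_loc g p z v = dir (fun i => conn_loc g p z (delta_mx i 0)) v.
Proof.
rewrite {1}(cV_sum v) /dir; elim/big_rec2 : _ => [|i A B _ <-].
  by rewrite -(scale0r 0) /conn_loc levi_civita_mxZ scale0r.
by rewrite /conn_loc levi_civita_mxD levi_civita_mxZ.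
Qed.

Lemma is_derive_gdot_cst (G : 'M[R]_4) (X Y : E -> 'cV[R]_4) m u dX dY :
  is_derive m u X dX -> is_derive m u Y dY ->
  is_derive m u (fun m => gdot G (X m) (Y m) : R^o) (gdot G dX (Y m) + gdot G (X m) dY).
Proof.
move=> iX iY.
have iG : is_derive m u (fun=> G) (0 : 'M[R]_4) := is_derive_cst G m u.
have H := is_derive_mul (is_derive_mul (is_derive_tr iX) iG) iY.
have H0 := (is_derive_mx _ _ _ _).1 H 0 0.
by apply: (is_derive_eq H0); rewrite mulmx0 addr0 mxE.
Qed.

Lemma is_derive_bivec_cst (G : 'M[R]_4) (A B : E -> 'M[R]_4) m u dA dB :
  is_derive m u A dA -> is_derive m u B dB ->
  is_derive m u (fun m => bivec_metric G (A m) (B m) : R^o)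
    (bivec_metric G dA (B m) + bivec_metric G (A m) dB).
Proof.
move=> iA iB.
have iG : is_derive m u (fun=> G) (0 : 'M[R]_4) := is_derive_cst G m u.
have H := is_derive_mul (is_derive_mul (is_derive_mul (is_derive_tr iA) iG) iB) iG.
have H2 := is_deriveZ 4^-1 (is_derive_trace H).
apply: (is_derive_eq H2); rewrite !mulmx0 !addr0 mulmxDl mxtraceD.
exact: mulrDr.
Qed.

Lemma is_derive_components (X : E -> E) m u (dX : E) :
  differentiable X m -> 'D_u X m = dX ->
  is_derive m u (fun m => (X m).1) dX.1 /\ is_derive m u (fun m => (X m).2) dX.2.
Proof.
move=> dX' <-; have d1 := differentiable_fst (X m); have d2 := differentiable_snd (X m).
split; split.
- by apply: diff_derivable; exact: (differentiable_comp dX' d1).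
- apply: (etrans (derive_comp (f := X) (g := fst) u dX' d1)); exact: derive_fst.
- by apply: diff_derivable; exact: (differentiable_comp dX' d2).
- apply: (etrans (derive_comp (f := X) (g := snd) u dX' d2)); exact: derive_snd.
Qed.

Lemma is_derive_nabla (C : 'I_4 -> 'M[R]_4) (X : E -> E) m u (dX : E) :
  differentiable X m -> 'D_u X m = dX ->
  is_derive m u (fun m => nabla (dir C (X m).1) m.2 (X m).2)
    (nabla (dir C dX.1) m.2 dX.2 + (dir C (X m).1 *m u.2 + u.2 *m (dir C (X m).1)^T)).
Proof.
move=> dX' XE; have [i1 i2] := is_derive_components dX' XE.
have i3 := is_derive_dir C i1; have i4 := is_derive_snd m u.
have H := is_deriveD i2 (is_deriveD (is_derive_mul i3 i4) (is_derive_mul i4 (is_derive_tr i3))).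
by apply: (is_derive_eq H); rewrite /nabla; mx_ring.
Qed.

Lemma split_algebra (G N1 N2 C1 C2 V1 V2 : 'M[R]_4) (x y : R) :
  x + y + t * (bivec_metric G (N1 + C1) V2 + bivec_metric G V1 (N2 + C2)) =
  (x + t * bivec_metric G N1 V2) + (y + t * bivec_metric G V1 N2) +
  t * (bivec_metric G C1 V2 + bivec_metric G V1 C2).
Proof. by rewrite bivecDl bivecDr; ring. Qed.

(* The direction (0, a) is vertical: the coefficients of the metric and of the
   connection are constant along it. *)
Lemma derive_h_along_height_grad e (Xi Eta : E -> E) (a : 'M[R]_4) :
  differentiable Xi (cmap e e) -> differentiable Eta (cmap e e) ->
  let v := Xi (cmap e e) in let w := Eta (cmap e e) in
  let C (x : E) := conn_mx g e.1 x.1 *m a + a *m (conn_mx g e.1 x.1)^T in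
  'D_(0, a) (fun m => h_loc g t e.1 m (Xi m) (Eta m) : R^o) (cmap e e) =
  h e ('D_(0, a) Xi (cmap e e)) w + h e v ('D_(0, a) Eta (cmap e e)) +
  t * (bivec_metric (g e.1) (C v) (vert g e w) + bivec_metric (g e.1) (vert g e v) (C w)).
Proof.
move=> dX dY v w C.
pose K i := conn_loc g e.1 (cmap e.1 e.1) (delta_mx i 0).
have KE x : conn_mx g e.1 x = dir K x by rewrite (conn_mxE atl) conn_loc_dir.
pose f' m : R^o := gdot (g e.1) (Xi m).1 (Eta m).1 +
  t * bivec_metric (g e.1) (nabla (dir K (Xi m).1) m.2 (Xi m).2)
                           (nabla (dir K (Eta m).1) m.2 (Eta m).2).
have [iX1 _] := is_derive_components (u := (0, a)) dX erefl.
have [iY1 _] := is_derive_components (u := (0, a)) dY erefl.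
have iX := is_derive_nabla (u := (0, a)) K dX erefl; have iY := is_derive_nabla (u := (0, a)) K dY erefl.
have H := is_deriveD (is_derive_gdot_cst (g e.1) iX1 iY1)
  (is_deriveZ t (is_derive_bivec_cst (g e.1) iX iY)).
have ff' s : f' (s *: (0, a) + cmap e e) =
    h_loc g t e.1 (s *: (0, a) + cmap e e) (Xi (s *: (0, a) + cmap e e))
      (Eta (s *: (0, a) + cmap e e)).
  have E1 : (s *: ((0, a) : E) + cmap e e).1 = cmap e.1 e.1.
    by rewrite (tensor_cmap_fiber atl erefl) /= scaler0 add0r.
  rewrite /f' /h_loc /vert_loc; move: E1; move: (s *: ((0, a) : E) + cmap e e) => m -> .
  by rewrite (gloc_center atl) -!conn_loc_dir.
have [_ E2] := is_derive_on_line (W := R^o) (f := f')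
  (f' := fun m => h_loc g t e.1 m (Xi m) (Eta m)) ff' H.
apply: (etrans E2); apply: (etrans (split_algebra _ _ _ _ _ _ _ _ _)).
have vE u : nabla (dir K u.1) (cmap e e).2 u.2 = vert g e u.
  by rewrite vertE KE (tensor_cmap_fiber atl erefl).
have CE x : C x = dir K x.1 *m a + a *m (dir K x.1)^T by rewrite /C KE.
have hE u x : gdot (g e.1) u.1 x.1 + t * bivec_metric (g e.1)
    (nabla (dir K u.1) (cmap e e).2 u.2) (nabla (dir K x.1) (cmap e e).2 x.2) = h e u x.
  by rewrite !vE.
have lE u x : bivec_metric (g e.1) (dir K u.1 *m a + a *m (dir K u.1)^T)
    (nabla (dir K x.1) (cmap e e).2 x.2) = bivec_metric (g e.1) (C u) (vert g e x).
  by rewrite vE CE.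
have rE u x : bivec_metric (g e.1) (nabla (dir K x.1) (cmap e e).2 x.2)
    (dir K u.1 *m a + a *m (dir K u.1)^T) = bivec_metric (g e.1) (vert g e x) (C u).
  by rewrite vE CE.
congr (_ + _ + t * (_ + _)); [exact: hE|exact: hE|exact: lE|exact: rE].
Qed.

Lemma derive_height_grad_loc e v : uf e = 0 -> dv S uf e v = 0 -> tangent S e v ->
  'D_v (height_grad_loc g J e.1) (cmap e e) =
  (0, - (conn_mx g e.1 v.1 *m alpha_bivec g J e.1 + alpha_bivec g J e.1 *m (conn_mx g e.1 v.1)^T)).
Proof.
move=> u0 dv0 tv; have oC := open_chart_dom atl (p := e.1).
have o := chart_dom_center atl e.
have sa := @smooth_alpha_fst _ _ atl g J ah e.1; have su := @smooth_height_loc _ _ atl g J ah e.1.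
have iu := is_derive_height atl ah kah e v.
have da : differentiable (alpha_loc g J e.1) (cmap e e).1.
  exact: smooth_diff (smooth_alpha atl ah e.1) o.
have ia := is_derive_fst v da.
have i2 := is_deriveB ia (is_derive_scale iu (is_derive_snd (cmap e e) v)).
have d1 : differentiable (fun=> 0 : 'cV[R]_4) (cmap e e) by exact: differentiable_cst.
have d2 : differentiable (fun m : E => alpha_loc g J e.1 m.1 - height_loc g J e.1 m *: m.2) (cmap e e).
  have c2 := Ck_snd (f := id) oC (Ck_id 1 (chart_dom e.1)).
  exact: (CkD oC (sa 1%N) (CkN oC (Ck_scale oC (su 1%N) c2))).1 _ o.
apply: (etrans (derive_pair v d1 d2)); have [_ E2] := i2.
apply: (etrans (congr2 pair (derive_cst _ _ _) E2)); congr pair.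
rewrite -(dv_height atl ah kah tv) dv0 -(height_chart atl ah (cdom_refl tatl e)) u0 !scale0r addr0 subr0.
rewrite (conn_mxE atl) /alpha_bivec -(alpha_center atl g J) (tensor_cmap_fiber atl erefl).
exact: (alpha_parallel atl ah kah).
Qed.

Lemma h_rep (xi eta : TM -> E) e : vfield S xi -> vfield S eta -> S e ->
  exists Xi Eta : E -> E,
  [/\ local_rep S e (fun y => tchange y e (xi y)) Xi (cmap e e),
      local_rep S e (fun y => tchange y e (eta y)) Eta (cmap e e),
      differentiable Xi (cmap e e), differentiable Eta (cmap e e) &
      local_rep S e (fun y => h y (xi y) (eta y)) (fun m => h_loc g t e.1 m (Xi m) (Eta m)) (cmap e e)
      /\ differentiable (fun m => h_loc g t e.1 m (Xi m) (Eta m) : R^o) (cmap e e)].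
Proof.
move=> vx vy Se; have [_ sx] := vx e Se; have [_ sy] := vy e Se.
have [U1 [X [oU1 U1e sX rX]]] := smooth_at_rep sx.
have [U2 [Y [oU2 U2e sY rY]]] := smooth_at_rep sy.
have oU : open (U1 `&` U2 `&` chart_dom e.1).
  by apply: openI; [exact: openI|exact: (open_chart_dom atl)].
have Ue : (U1 `&` U2 `&` chart_dom e.1) (cmap e e).
  by split; [split|exact: chart_dom_center].
have s1 : U1 `&` U2 `&` chart_dom e.1 `<=` U1 by move=> m [[]].
have s2 : U1 `&` U2 `&` chart_dom e.1 `<=` U2 by move=> m [[]].
have s3 : U1 `&` U2 `&` chart_dom e.1 `<=` chart_dom e.1 by move=> m [].
exists X, Y; split; [exact: rX|exact: rY|exact: smooth_diff sX U1e|exact: smooth_diff sY U2e|split].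
  near=> m => y Sy ey ym.
  rewrite (h_chart atl ah t _ _ ey) ym.
  have Hx : forall y, S y -> cdom e y -> cmap e y = m -> tchange y e (xi y) = X m by near: m.
  have Hy : forall y, S y -> cdom e y -> cmap e y = m -> tchange y e (eta y) = Y m by near: m.
  by rewrite (Hx y Sy ey ym) (Hy y Sy ey ym).
have := Ck_h_loc atl ah t oU s3 (Ck_subset s1 (sX 1%N)) (Ck_subset s2 (sY 1%N)).
by move=> [H _]; exact: H.
Unshelve. all: by end_near. Qed.

Lemma koszul_algebra e (v w ta ta' Wx X1 Y1 q1 q2 d1 d2 : E) (P1 P2 : 'M[R]_4) :
  h e ta Wx + h e w d1 = 0 -> h e ta' Wx + h e v d2 = 0 ->
  h e X1 w + h e v Y1 + t * (bivec_metric (g e.1) P1 (vert g e w) +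
    bivec_metric (g e.1) (vert g e v) P2) = h e q1 w + h e v q2 ->
  h e ta Wx = h e ta' Wx ->
  d1 - q1 = (0, - P1) - X1 -> d2 - q2 = (0, - P2) - Y1 ->
  h e ta Wx = 0.
Proof.
move=> C1 C2 C3 T /eqP + /eqP; rewrite !subr_eq => /eqP d1E /eqP d2E.
have hv x P : h e x (0, - P) = - (t * bivec_metric (g e.1) (vert g e x) P).
  by rewrite /h_metric vert_vertical /gdot mulmx0 mxE add0r bivecNr mulrN.
move: C1 C2 C3; rewrite -T d1E d2E.
rewrite !(hDr atl ah t e) !(hNr atl ah t e) !hv.
rewrite (hC ah t e X1 w) (hC ah t e q1 w) (bivecC P1 (vert g e w) (g_sym ah e.1)).
move: (h e ta Wx) (h e w q1) (h e v q2) (h e w X1) (h e v Y1).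
move=> a q1' q2' x1 y1; move: (bivec_metric _ _ _) (bivec_metric _ _ _) => b1 b2 C1 C2 C3.
by clear -C1 C2 C3; lra.
Qed.

Lemma Sigma_J_totally_geodesic : totally_geodesic S h Sig.
Proof.
move=> D LC xi eta vxi veta txi teta e Se.
have Te := Sigma_sub Se; have u0 := Sigma_height Se.
have Wv : vfield S W := height_grad_vfield atl ah.
have [[Dvf _ _ _] [Dtor Dmet]] := LC.
have txe := txi e Se; have tee := teta e Se.
have txS : tangent S e (xi e) by have [] := vxi e Te.
have teS : tangent S e (eta e) by have [] := veta e Te.
have tWS : tangent S e (W e) by have [] := Wv e Te.
set v := xi e; set w := eta e.
set tau := D e v eta; set tau' := D e w xi.
have ttau : tangent S e tau by have [] := Dvf _ _ vxi veta e Te.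
have ttau' : tangent S e tau' by have [] := Dvf _ _ veta vxi e Te.
have hW0 (zeta : TM -> E) y : (forall x, Sig x -> tangent Sig x (zeta x)) ->
    vfield S zeta -> Sig y -> h y (zeta y) (W y) = 0.
  move=> tz vz Sy; rewrite (h_height_grad atl ah kah t); last by have [] := vz y (Sigma_sub Sy).
  by rewrite (dv_height_Sigma atl ah (tz y Sy)) mulr0.
have C0 (zeta : TM -> E) x : (forall x, Sig x -> tangent Sig x (zeta x)) ->
    vfield S zeta -> tangent Sig e x -> dv S (fun y => h y (zeta y) (W y)) e x = 0.
  move=> tz vz tx; have [Z [Om [_ _ _ _ [rH dH]]]] := h_rep vz Wv Te.
  by apply: (dv_zero (@Sigma_sub _ _ g J) tx rH dH) => y; exact: hW0.
have C1 := C0 eta v teta veta txe; have C2 := C0 xi w txi vxi tee.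
rewrite (Dmet e v eta W Te txS veta Wv) in C1.
rewrite (Dmet e w xi W Te teS vxi Wv) in C2.
have [Xi [Eta [rX rE dX dE [rH dH]]]] := h_rep vxi veta Te.
have C3 := Dmet e (W e) xi eta Te tWS vxi veta.
rewrite (dv_rep tWS rH dH) in C3.
have XiE : Xi (cmap e e) = v.
  by rewrite (rep_val Te (cdom_refl tatl e) rX) (tchange_id tatl).
have EtaE : Eta (cmap e e) = w.
  by rewrite (rep_val Te (cdom_refl tatl e) rE) (tchange_id tatl).
have WE : W e = (0, alpha_bivec g J e.1) by rewrite /height_grad u0 scale0r subr0.
have C3' := derive_h_along_height_grad (alpha_bivec g J e.1) dX dE.
rewrite -WE XiE EtaE in C3'; rewrite {}C3' in C3.
have rO : local_rep S e (fun y => tchange y e (W y)) (height_grad_loc g J e.1) (cmap e e).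
  by apply: rep_all => y ey; exact: (height_grad_chart atl ah).
have dO : differentiable (height_grad_loc g J e.1) (cmap e e).
  exact: smooth_diff (@smooth_height_grad_loc _ _ atl g J ah e.1) (chart_dom_center atl e).
have b2 := torsion_chart tatl (@fin_dim_E R) LC vxi Wv Te rX dX rO dO.
have b3 := torsion_chart tatl (@fin_dim_E R) LC veta Wv Te rE dE rO dO.
rewrite (derive_height_grad_loc u0 (dv_height_Sigma atl ah txe) txS) in b2.
rewrite (derive_height_grad_loc u0 (dv_height_Sigma atl ah tee) teS) in b3.
have du : dv S uf e tau - dv S uf e tau' = 0.
  have su : smooth_along (S `&` cdom e) (uf : TM -> R^o).
    exact: (height_smooth atl ah).
  rewrite (Dtor e uf xi eta Te vxi veta su).
  have Z (zeta : TM -> E) x : (forall x, Sig x -> tangent Sig x (zeta x)) ->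
      vfield S zeta -> tangent Sig e x -> dv S (fun y => dv S uf y (zeta y)) e x = 0.
    move=> tz vz tx; have [Z [Om [_ _ _ _ [rZ dZ]]]] := h_rep vz Wv Te.
    rewrite (@dv_ext _ _ _ S e x _ (fun y => t^-1 * h y (zeta y) (W y))); last first.
      move=> y Sy; rewrite (h_height_grad atl ah kah t); last by have [] := vz y Sy.
      by rewrite mulKf// gt_eqF.
    apply: (dv_zero (F := fun m => t^-1 *: (h_loc g t e.1 m (Z m) (Om m) : R^o)) (@Sigma_sub _ _ g J) tx).
    - by apply: filterS rZ => m Hm y Sy ey ym; rewrite (Hm y Sy ey ym).
    - exact: differentiableZ.
    by move=> y Sy; rewrite hW0// mulr0.
  by rewrite (Z eta)// (Z xi)// subrr.
have htt : h e tau (W e) = h e tau' (W e).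
  by rewrite !(h_height_grad atl ah kah t)//; congr (_ * _); apply/eqP; rewrite -subr_eq0 du.
have key : h e tau (W e) = 0.
  exact: (koszul_algebra C1 C2 C3 htt b2 b3).
apply: (Sigma_tangent atl ah kah Se ttau).
apply: (mulfI (lt0r_neq0 t_gt0)); rewrite mulr0 -(h_height_grad atl ah kah t ttau).
exact: key.
Qed.

End SecondFundamentalForm.

Theorem corollary1 (R : realType) (M : charted 'cV[R]_4)
    (g J : M -> 'M[R]_4) (t : R) :
  is_manifold M -> almost_hermitian g J -> 0 < t -> kahler g J ->
  hypersurface (twistor g J) (Sigma_J g J) /\
  totally_geodesic (twistor g J) (h_metric g t) (Sigma_J g J).
Proof.
move=> [atl _] ah t0 kah; split; first exact: Sigma_hypersurface.
exact: Sigma_J_totally_geodesic.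
Qed.
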